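(* Let $F$ be a quadratic field and $\zeta_F$ its Dedekind zeta function. Then $$\int_{-\infty}^{+\infty}\Big|\frac{\zeta_F(\tfrac12+it)}{\tfrac12+it}\Big|^2dt>\frac{\pi}{2}.$$ *)

(* Defs.v *)
From HB Require Import structures.
From mathcomp Require Export all_boot all_order all_algebra all_field.
From mathcomp Require Export finmap complex.
From mathcomp Require Export all_classical all_reals all_analysis.
From mathcomp Require summability.
Export numFieldNormedType.Exports.

Set Implicit Arguments.
Unset Strict Implicit.
Unset Printing Implicit Defensive.

Import Order.TTheory GRing.Theory Num.Theory.
Local Open Scope classical_set_scope.
Local Open Scope ring_scope.

Definition quadratic_field (F : fieldExtType rat) : Prop := \dim {:F} = 2%N.

Definition ring_of_integers (F : fieldExtType rat) : set F :=
  [set x | integralOver (intr : int -> F) x].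
Arguments ring_of_integers F : clear implicits.

Definition is_nonzero_ideal (F : fieldExtType rat) (I : set F) : Prop :=
  [/\ I `<=` ring_of_integers F,
      I 0,
      forall x y, I x -> I y -> I (x + y),
      forall a x, ring_of_integers F a -> I x -> I (a * x)
    & exists2 x, I x & x != 0].

Definition nonzero_ideal (F : fieldExtType rat) : choiceType :=
  {I : set F | `[< is_nonzero_ideal I >]}.

(* The order of O_F / I, as the number of cosets x + I with x in O_F. (fset_set
   sends infinite sets to fset0, but these quotients are finite.) *)
Definition ideal_norm (F : fieldExtType rat) (I : set F) : nat :=
  let cosets := [set [set x + y | y in I] | x in ring_of_integers F] in
  #|` fset_set cosets|%fset.

(* n ^ s = exp (s * ln n), for n > 0 *)
Definition natcpow (R : realType) (n : nat) (s : R[i]) : R[i] :=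
  let m := expR (complex.Re s * ln n%:R) in
  let a := complex.Im s * ln n%:R in
  Complex (m * cos a) (m * sin a).

(* The unordered sum of N(I)^-s over all nonzero ideals I of O_F; it converges
   for Re s > 1. *)
Definition dedekind_series (R : realType) (F : fieldExtType rat) (s : R[i]) :
    R[i] :=
  summability.sum
    (fun I : nonzero_ideal F => natcpow (ideal_norm (val I)) (- s) : R[i]^o).

(* R[i]^o carries the topology of the complex modulus. *)
Definition analytic_at (R : realType) (g : R[i] -> R[i]) (z : R[i]) : Prop :=
  exists a : nat -> R[i]^o,
    \forall w \near (z : R[i]^o), series (fun k => a k * (w - z) ^+ k) @ \oo --> (g w : R[i]^o).

Definition dedekind_continuation (R : realType) (F : fieldExtType rat)
    (sigma : R) (g : R[i] -> R[i]) : Prop :=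
  (forall z : R[i], sigma < complex.Re z -> z != 1 -> analytic_at g z) /\
  (forall z : R[i], 1 < complex.Re z -> g z = dedekind_series F z).

(* The value at s of the analytic continuation of the Dedekind series to any
   punctured half-plane {Re z > sigma, z != 1} containing s. Such domains are
   connected, so the value depends neither on sigma nor on g; a continuation
   exists for every sigma by Hecke's theorem. The value at the pole s = 1 is
   meaningless. *)
Definition dedekind_zeta (R : realType) (F : fieldExtType rat) (s : R[i]) :
    R[i] :=
  xget 0 [set w | exists (sigma : R) (g : R[i] -> R[i]),
    [/\ sigma < complex.Re s, dedekind_continuation F sigma g & g s = w]].

(* Main.v *)
Require Import Defs.
From HB Require Import structures.
From mathcomp Require Import measurable_realfun ring lra zify.
Set Implicit Arguments.
Unset Strict Implicit.
Unset Printing Implicit Defensive.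
Import Order.TTheory GRing.Theory Num.Theory.
Local Open Scope classical_set_scope.
Local Open Scope ring_scope.

(** For a nonzero ideal [I] of norm [n] and [s] of real part [> 1], [n ^ - s] is [s ^ 2] times the
    Laplace transform of [max 0 (u - ln n)], so that the zeta function is [s ^ 2] times the Laplace
    transform of [N u = \sum_I max 0 (u - ln (norm I))]. Since [kap u = N u - rho * exp u] is
    [O (exp (u / 4))], the formula [s ^ 2 * (rho / (s - 1) + laplace kap s)] continues it to
    [Re s > 1/4], and on the critical line [zeta s / s] is [s] times the Fourier transform [k^] of
    [k u = exp (- u / 2) * kap u] on the whole real line. For every trigonometric polynomial [P],
    [|s * k^|^2 >= 2 Re (k^ * P) - |P|^2 / |s|^2]; by Fourier inversion the integral of the right
    side is [2 pi] times a finite combination of values of [kap]. As [N u >= u], choosing the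
    frequencies [ln 1], [ln (3/2)], [ln 2] already gives more than [pi / 2].

    The estimate of [kap] is arithmetic. The ideals of norm [m] are counted by [\sum_(d %| m) c d]
    for a completely multiplicative [c], where [c p + 1] is the number of roots mod [p] of the
    polynomial defining the ring of integers. The square root of the discriminant [D] is a
    polynomial in a root of unity, and Frobenius identifies [c], on odd numbers, with the action of
    the Galois group on this root: it is periodic with mean zero. Abel summation concludes. *)

(** A priori the integral may be infinite and [k^] need not be integrable; only continuity and decay
    of [k] are at hand. Hence a minorant is damped by [exp (- |t| / (m + 1))], integrated by Fubini,
    and released in the limit, where the damping has become a Poisson kernel. Pointwise convergence
    there requires a continuous [k]: this is why ideals are counted with ramps and not with jumps.

    The exponent [1/4] has to be positive, to absorb a term linear in [u] and to make a recursion
    contract, and below [1/2], for [k] to decay at infinity.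

    The prime 2 is set apart because comparing two signs modulo [p] fails for [p = 2]. The even
    numbers come back through the recursion from [u] to [u - ln 2], for which [|c 2| <= 1] suffices.

    Maximality of the ring of integers enters at the ramified primes: it excludes roots modulo
    [p ^ 2], so that the count of ideals at the powers of [p] is the one given by a completely
    multiplicative [c]. *)

Notation normc := ComplexField.Normc.normc.
Notation Rez := complex.Re.
Notation Imz := complex.Im.

(** * Complex numbers as pairs of reals: modulus, limits, exponential *)

Section ComplexBasics.
Variable R : realType.
Implicit Types (z w : R[i]) (x y : R).

Lemma complexP z w : Rez z = Rez w -> Imz z = Imz w -> z = w.
Proof. by case: z w => [a b] [c d] /= -> ->. Qed.

Lemma cReM z w : Rez (z * w) = Rez z * Rez w - Imz z * Imz w.
Proof. by case: z w => [a b] [c d]. Qed.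

Lemma cImM z w : Imz (z * w) = Rez z * Imz w + Imz z * Rez w.
Proof. by case: z w => [a b] [c d]. Qed.

Lemma cReD z w : Rez (z + w) = Rez z + Rez w.
Proof. by case: z w => [a b] [c d]. Qed.

Lemma cImD z w : Imz (z + w) = Imz z + Imz w.
Proof. by case: z w => [a b] [c d]. Qed.

Lemma cReN z : Rez (- z) = - Rez z.
Proof. by case: z. Qed.

Lemma cImN z : Imz (- z) = - Imz z.
Proof. by case: z. Qed.

Lemma cRe_sum (I : Type) (r : seq I) (P : pred I) (F : I -> R[i]) :
  Rez (\sum_(i <- r | P i) F i) = \sum_(i <- r | P i) Rez (F i).
Proof. by elim/big_rec2 : _ => // i x z _ <-; rewrite cReD. Qed.

Lemma cIm_sum (I : Type) (r : seq I) (P : pred I) (F : I -> R[i]) :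
  Imz (\sum_(i <- r | P i) F i) = \sum_(i <- r | P i) Imz (F i).
Proof. by elim/big_rec2 : _ => // i x z _ <-; rewrite cImD. Qed.

Lemma cRe_natr n : Rez (n%:R : R[i]) = n%:R.
Proof. by elim: n => // n IH; rewrite -addn1 !natrD cReD IH. Qed.

Lemma cIm_natr n : Imz (n%:R : R[i]) = 0.
Proof. by elim: n => // n IH; rewrite -addn1 !natrD cImD IH addr0. Qed.

Definition ReImE := (cReM, cImM, cReD, cImD, cReN, cImN, cRe_sum, cIm_sum).

Lemma normc_ge0 z : 0 <= normc z.
Proof. by case: z => a b /=; rewrite sqrtr_ge0. Qed.

Lemma sqr_normcE z : normc z ^+ 2 = Rez z ^+ 2 + Imz z ^+ 2.
Proof. by case: z => a b /=; rewrite sqr_sqrtr// addr_ge0 ?sqr_ge0. Qed.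

Lemma normcM z w : normc (z * w) = normc z * normc w.
Proof. exact: ComplexField.Normc.normcM. Qed.

Lemma normcD z w : normc (z + w) <= normc z + normc w.
Proof. exact: le_normcD. Qed.

Lemma normcN z : normc (- z) = normc z.
Proof. exact: normcN. Qed.

Lemma normcX z n : normc (z ^+ n) = normc z ^+ n.
Proof.
elim: n => [|n IH]; first by rewrite !expr0 ComplexField.Normc.normc1.
by rewrite !exprS normcM IH.
Qed.

Lemma normc_eq0 z : (normc z == 0) = (z == 0).
Proof.
apply/eqP/eqP => [/ComplexField.Normc.eq0_normc//|->].
exact: ComplexField.Normc.normc0.
Qed.

Lemma Re_le_normc z : `|Rez z| <= normc z.
Proof.
by rewrite -ler_sqr ?nnegrE ?normc_ge0// sqr_normcE real_normK ?num_real// lerDl sqr_ge0.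
Qed.

Lemma Im_le_normc z : `|Imz z| <= normc z.
Proof.
by rewrite -ler_sqr ?nnegrE ?normc_ge0// sqr_normcE real_normK ?num_real// lerDr sqr_ge0.
Qed.

Lemma normc_le_ReIm z : normc z <= `|Rez z| + `|Imz z|.
Proof.
rewrite -ler_sqr ?nnegrE ?addr_ge0 ?normc_ge0// sqr_normcE sqrrD !real_normK ?num_real//.
by rewrite addrAC lerDl mulrn_wge0// mulr_ge0.
Qed.

Lemma normrcE z : `|z| = Complex (normc z) 0.
Proof. by case: z. Qed.

Lemma ltc_posE (e : R[i]) : 0 < e -> e = Complex (Rez e) 0 /\ 0 < Rez e.
Proof. by case: e => a b; rewrite ltcE /= => /andP[/eqP -> ->]. Qed.

(** The norm of [R[i]^o] takes its values in [R[i]], so radii are complex numbers with zero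
    imaginary part; here they become real. *)
Lemma cvgcP (T : Type) (F : set_system T) {FF : Filter F} (f : T -> R[i]^o) (l : R[i]^o) :
  (f @ F --> l) <->
  (forall e : R, 0 < e -> \forall x \near F, normc (l - f x) < e).
Proof.
split=> [h e e0|h].
  move/cvgrPdist_lt: h => h.
  have /h : 0 < (Complex e 0 : R[i]) by rewrite ltcE/= eqxx.
  by apply: filterS => x; rewrite normrcE ltcE /= eqxx.
apply/cvgrPdist_lt => e /ltc_posE[-> e0].
by apply: filterS (h _ e0) => x; rewrite normrcE ltcE /= eqxx.
Qed.

Lemma nearcP (z : R[i]) (P : set R[i]) :
  (\forall w \near (z : R[i]^o), P w) <->
  exists2 d : R, 0 < d & forall w, normc (w - z) < d -> P w.
Proof.
split.
  move=> /nbhs_ballP[e /= /ltc_posE[-> e0] h]; exists (Rez e) => // w wz.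
  by apply: h; rewrite -ball_normE /= distrC normrcE ltcE /= eqxx.
move=> [d d0 h]; apply/nbhs_ballP; exists (Complex d 0).
  by rewrite /= ltcE /= eqxx.
by move=> w; rewrite -ball_normE /= distrC normrcE ltcE /= eqxx => /h.
Qed.

Definition cexp z : R[i] :=
  Complex (expR (Rez z) * cos (Imz z)) (expR (Rez z) * sin (Imz z)).

Lemma cexpD z w : cexp (z + w) = cexp z * cexp w.
Proof.
by apply: complexP; rewrite /cexp !ReImE /= expRD ?cosD ?sinD; ring.
Qed.

Lemma cexp0 : cexp 0 = 1.
Proof. by apply: complexP; rewrite /= expR0 ?cos0 ?sin0 mul1r. Qed.

Lemma normc_cexp z : normc (cexp z) = expR (Rez z).
Proof.
rewrite /cexp /= !exprMn -mulrDr cos2Dsin2 mulr1 sqrtr_sqr ger0_norm // expR_ge0.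
Qed.

Lemma natcpowE n (s : R[i]) : natcpow n s = cexp (Complex (ln n%:R) 0 * s).
Proof.
by case: s => a b; apply: complexP;
  rewrite /= !(mul0r, subr0, addr0) !(mulrC (ln _)).
Qed.

End ComplexBasics.

(** * Differentiation rules and a comparison principle *)

Section RealDerivatives.
Variable R : realType.
Implicit Types (f g : R -> R) (t a b : R).

Lemma is_deriveD_fun f g t a b : is_derive t 1 f a -> is_derive t 1 g b ->
  is_derive t 1 (fun x => f x + g x) (a + b).
Proof. by move=> ? ?; exact: is_deriveD. Qed.

Lemma is_deriveN_fun f t a : is_derive t 1 f a -> is_derive t 1 (fun x => - f x) (- a).
Proof. by move=> ?; exact: is_deriveN. Qed.

Lemma is_deriveM_fun f g t a b : is_derive t 1 f a -> is_derive t 1 g b ->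
  is_derive t 1 (fun x => f x * g x) (f t * b + g t * a).
Proof. by move=> ? ?; exact: is_deriveM. Qed.

Lemma is_derive_comp_fun f g t a b : is_derive (g t) 1 f a -> is_derive t 1 g b ->
  is_derive t 1 (fun x => f (g x)) (b * a).
Proof. by move=> ? ?; rewrite mulrC; exact: is_derive1_comp. Qed.

Lemma is_deriveXn_fun f t a n : is_derive t 1 f a ->
  is_derive t 1 (fun x => f x ^+ n) (n%:R * f t ^+ n.-1 * a).
Proof.
move=> h; have := is_deriveX n h.
by congr is_derive; apply/funext => x; rewrite exprfctE.
Qed.

Lemma is_derive_sum_fun (n : nat) (h : nat -> R -> R) t (dh : nat -> R) :
  (forall i, is_derive t 1 (h i) (dh i)) ->
  is_derive t 1 (fun x => \sum_(i < n) h i x) (\sum_(i < n) dh i).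
Proof.
move=> hh; have := @is_derive_sum R R R n (fun i => h i) t 1 (fun i => dh i) (fun i => hh i).
by congr is_derive; apply/funext => x; rewrite fct_sumE.
Qed.

Lemma is_derive_continuous (f df : R -> R) :
  (forall t : R, is_derive t 1 f (df t)) -> continuous f.
Proof.
move=> h t; apply: differentiable_continuous; apply/derivable1_diffP.
by have [] := h t.
Qed.

Lemma is_derive_derive1 f t a : is_derive t 1 f a -> derive1 f t = a.
Proof. by move=> [_ <-]; rewrite derive1E. Qed.

(** Both [g - f] and [g + f] have a nonnegative derivative on the half-line, so they stay
    nonnegative. *)
Lemma derive_le (f df g dg : R -> R) (T : R) : 0 <= T ->
  (forall t : R, is_derive t 1 f (df t)) -> (forall t : R, is_derive t 1 g (dg t)) ->
  (forall t, 0 <= t -> `|df t| <= dg t) -> `|f 0| <= g 0 -> `|f T| <= g T.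
Proof.
move=> T0 hf hg hd h0.
have mono (h dh : R -> R) : (forall t : R, is_derive t 1 h (dh t)) ->
    (forall t, 0 <= t -> 0 <= dh t) -> h 0 <= h T.
  move=> hh h0'; apply: (@ger0_derive1_ndecr _ h 0 T) => //.
  - move=> x; rewrite in_itv /= => /andP[/ltW x0 _].
    by rewrite (is_derive_derive1 (hh x)) h0'.
  - by apply: continuous_subspaceT; exact: is_derive_continuous hh.
have h1 : (g - f) 0 <= (g - f) T.
  apply: (mono _ (fun t => dg t - df t)) => t /hd.
  by rewrite ler_norml subr_ge0 => /andP[].
have h2 : (g + f) 0 <= (g + f) T.
  apply: (mono _ (fun t => dg t + df t)) => t /hd.
  by rewrite ler_norml -subr_ge0 opprK addrC => /andP[].
move: h1 h2 h0; rewrite !fctE !ler_norml => ? ? /andP[? ?]; apply/andP; split; lra.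
Qed.

End RealDerivatives.

Ltac deriv := first
  [ apply: is_derive_id | apply: is_derive_cst
  | apply: is_derive_expR | apply: is_derive_cos | apply: is_derive_sin
  | apply: is_deriveD_fun; deriv | apply: is_deriveN_fun; deriv
  | apply: is_deriveXn_fun; deriv
  | apply: is_deriveM_fun; deriv
  | apply: (is_derive_comp_fun (f := expR)); deriv
  | apply: (is_derive_comp_fun (f := cos)); deriv
  | apply: (is_derive_comp_fun (f := sin)); deriv ].

(* [apply:] would let typeclass resolution pick another derivative. *)
Ltac derive_eq := notypeclasses refine (is_derive_eq _ _); [deriv|rewrite /GRing.scale /=].

(** * Taylor remainder of the complex exponential *)

Section CexpTaylor.
Variable R : realType.
Variable z : R[i].

Lemma natrcV n : (n%:R : R[i])^-1 = Complex (n%:R^-1) 0.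
Proof.
case: n => [|n]; first by rewrite !invr0.
apply: (mulfI (x := n.+1%:R)); first by rewrite pnatr_eq0.
rewrite divff ?pnatr_eq0//.
apply: complexP; rewrite ReImE cRe_natr cIm_natr /= ?(mul0r,mulr0,subr0,addr0)//.
by rewrite divff// pnatr_eq0.
Qed.

Let x := Rez z.
Let y := Imz z.
Let p k := Rez (z ^+ k) / k`!%:R.
Let q k := Imz (z ^+ k) / k`!%:R.
(** [A n t] and [B n t] are the real and imaginary parts of [exp (t * z)] minus the first [n] terms
    of its expansion in [t]; differentiation lowers [n], which allows an induction. *)
Let A n t := expR (t * x) * cos (t * y) - \sum_(k < n) p k * t ^+ k.
Let B n t := expR (t * x) * sin (t * y) - \sum_(k < n) q k * t ^+ k.

Let factrS k : ((k.+1)`!%:R : R) = k.+1%:R * k`!%:R.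
Proof. by rewrite factS natrM. Qed.

Let pS k : p k.+1 * k.+1%:R = x * p k - y * q k.
Proof.
have h : (k`!%:R : R) != 0 by rewrite pnatr_eq0 -lt0n fact_gt0.
have h' : (k.+1%:R : R) != 0 by rewrite pnatr_eq0.
by rewrite /p /q exprS cReM factrS /x /y; move: (k`!%:R) (k.+1%:R) h h' => a b h h'; field; rewrite ?h ?h'.
Qed.

Let qS k : q k.+1 * k.+1%:R = x * q k + y * p k.
Proof.
have h : (k`!%:R : R) != 0 by rewrite pnatr_eq0 -lt0n fact_gt0.
have h' : (k.+1%:R : R) != 0 by rewrite pnatr_eq0.
by rewrite /p /q exprS cImM factrS /x /y; move: (k`!%:R) (k.+1%:R) h h' => a b h h'; field; rewrite ?h ?h'.
Qed.

Let dsum n (r : nat -> R) (t : R) :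
  is_derive t 1 (fun t => \sum_(k < n.+1) r k * t ^+ k)
    (\sum_(k < n) r k.+1 * k.+1%:R * t ^+ k).
Proof.
apply: is_derive_eq.
  by apply: (@is_derive_sum_fun _ _ (fun k t => r k * t ^+ k)) => i; deriv.
rewrite big_ord_recl !mul0r !mulr0 !add0r; apply: eq_bigr => i _.
by rewrite lift0 /= mulr1 mulr0 addr0 mulrA.
Qed.

Let dA n (t : R) : is_derive t 1 (A n.+1) (x * A n t - y * B n t).
Proof.
rewrite {1}/A; apply: is_derive_eq.
  by apply: is_deriveD_fun; first [apply: is_deriveN_fun; apply: dsum | deriv].
under [X in _ - X]eq_bigr do rewrite pS mulrBl -(mulrA x) -(mulrA y).
by rewrite sumrB -!mulr_sumr /A /B /GRing.scale /=; ring.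
Qed.

Let dB n (t : R) : is_derive t 1 (B n.+1) (x * B n t + y * A n t).
Proof.
rewrite {1}/B; apply: is_derive_eq.
  by apply: is_deriveD_fun; first [apply: is_deriveN_fun; apply: dsum | deriv].
under [X in _ - X]eq_bigr do rewrite qS mulrDl -(mulrA x) -(mulrA y).
by rewrite big_split /= -!mulr_sumr /A /B /GRing.scale /=; ring.
Qed.

Let M := normc z.
(** The majorant has derivative [G n.+1' = 2 * M * G n + M * G n.+1]. The 2 inside the power pays
    for [|x| + |y| <= 2 * M]. *)
Let G n t := (2 * M * t) ^+ n / n`!%:R * expR (t * M).

Let M0 : 0 <= M. Proof. exact: normc_ge0. Qed.
Let xM : `|x| <= M. Proof. exact: Re_le_normc. Qed.
Let yM : `|y| <= M. Proof. exact: Im_le_normc. Qed.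

Let dG n (t : R) : is_derive t 1 (G n.+1) (2 * M * G n t + M * G n.+1 t).
Proof.
rewrite {1}/G; apply: is_derive_eq; first by deriv.
have h : (n`!%:R : R) != 0 by rewrite pnatr_eq0 -lt0n fact_gt0.
have h' : (n.+1%:R : R) != 0 by rewrite pnatr_eq0.
rewrite /G /GRing.scale /= exprS factrS; move: (n`!%:R) (n.+1%:R) h h' => a b h h'; field; by rewrite ?h ?h'.
Qed.

Let G_ge0 n t : 0 <= t -> 0 <= G n t.
Proof.
by move=> t0; rewrite mulr_ge0 ?expR_ge0// divr_ge0// exprn_ge0// !mulr_ge0.
Qed.

Let AB_le n t : 0 <= t -> `|A n t| <= G n t /\ `|B n t| <= G n t.
Proof.
elim: n t => [|n IH] t t0.
  rewrite /A /B /G !big_ord0 !subr0 expr0 fact0 divr1 mul1r !normrM.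
  have h : `|expR (t * x)| <= expR (t * M).
    by rewrite ger0_norm ?expR_ge0// ler_expR ler_wpM2l// (le_trans (ler_norm _)).
  by split; rewrite -[leRHS]mulr1; apply: ler_pM => //; rewrite ler_norml ?cos_geN1 ?cos_le1 ?sin_geN1 ?sin_le1.
have bnd (a b : R) s : 0 <= s -> `|a| <= G n s -> `|b| <= G n s ->
    `|x * a + y * b| <= 2 * M * G n s + M * G n.+1 s.
  move=> s0 ha hb.
  apply: (le_trans (ler_normD _ _)); rewrite !normrM.
  have h1 : `|x| * `|a| <= M * G n s by apply: ler_pM.
  have h2 : `|y| * `|b| <= M * G n s by apply: ler_pM.
  have h3 : 0 <= M * G n.+1 s by rewrite mulr_ge0// G_ge0.
  lra.
have G00 : 0 <= G n.+1 0 by apply: G_ge0.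
have s0 r : r 0%N = (r 0%N : R) -> \sum_(k < n.+1) r k * (0 : R) ^+ k = r 0%N.
  move=> _; rewrite big_ord_recl expr0 mulr1 big1 ?addr0// => i _.
  by rewrite lift0 expr0n /= mulr0.
split.
- apply: (derive_le t0 (dA n) (dG n)) => [s s0'|].
    have [h1 h2] := IH s s0'; rewrite -mulrN.
    by apply: bnd => //; rewrite normrN.
  rewrite /A s0// !mul0r cos0 expR0 /p expr0 fact0 /= divr1 mulr1 subrr normr0.
  exact: G00.
- apply: (derive_le t0 (dB n) (dG n)) => [s s0'|].
    by have [h1 h2] := IH s s0'; apply: bnd.
  rewrite /B s0// !mul0r sin0 expR0 /q expr0 fact0 /= divr1 mulr0 subrr normr0.
  exact: G00.
Qed.

Lemma cexp_taylor n :
  normc (cexp z - \sum_(k < n) z ^+ k / k`!%:R) <= 2 * ((2 * normc z) ^+ n / n`!%:R * expR (normc z)).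
Proof.
have [h1 h2] := AB_le n (ler01 : 0 <= (1 : R)).
have eA : Rez (cexp z - \sum_(k < n) z ^+ k / k`!%:R) = A n 1.
  rewrite cReD cReN cRe_sum /A !mul1r; congr (_ - _); apply: eq_bigr => k _.
  by rewrite natrcV cReM /= mulr0 subr0 expr1n mulr1.
have eB : Imz (cexp z - \sum_(k < n) z ^+ k / k`!%:R) = B n 1.
  rewrite cImD cImN cIm_sum /B !mul1r; congr (_ - _); apply: eq_bigr => k _.
  by rewrite natrcV cImM /= mulr0 add0r expr1n mulr1.
apply: (le_trans (normc_le_ReIm _)); rewrite eA eB.
move: h1 h2; rewrite /G !mul1r mulr1; lra.
Qed.

End CexpTaylor.

(** * Real integrals and the fundamental theorem on half-lines *)

Section RealIntegrals.
Variable R : realType.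
Notation mu := (@lebesgue_measure R).
Implicit Types (D : set R) (f g F : R -> R) (a c l : R).

Lemma integrable_dom D f g : measurable D -> measurable_fun D f ->
  (forall x, D x -> `|f x| <= g x) -> mu.-integrable D (EFin \o g) ->
  mu.-integrable D (EFin \o f).
Proof.
move=> mD mf fg; apply: le_integrable => //; first exact/measurable_EFinP.
by move=> x Dx; rewrite lee_fin (le_trans (fg _ Dx))// ler_norm.
Qed.

Lemma RintegrableD D f g : measurable D -> mu.-integrable D (EFin \o f) ->
  mu.-integrable D (EFin \o g) -> mu.-integrable D (EFin \o (fun x => f x + g x)).
Proof. by move=> mD ? ?; exact: (@integrableD _ _ _ mu D mD (EFin \o f) (EFin \o g)). Qed.

Lemma RintegrableB D f g : measurable D -> mu.-integrable D (EFin \o f) ->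
  mu.-integrable D (EFin \o g) -> mu.-integrable D (EFin \o (fun x => f x - g x)).
Proof. by move=> mD ? ?; exact: (@integrableB _ _ _ mu D mD (EFin \o f) (EFin \o g)). Qed.

Lemma RintegrableZ D c f : measurable D -> mu.-integrable D (EFin \o f) ->
  mu.-integrable D (EFin \o (fun x => c * f x)).
Proof. by move=> mD ?; exact: (@integrableZl _ _ _ mu D mD c (EFin \o f)). Qed.

Lemma Rintegrable_norm D f : mu.-integrable D (EFin \o f) ->
  mu.-integrable D (EFin \o (fun x => `|f x|)).
Proof. by move=> ?; exact: (@integrable_abse _ _ _ mu D (EFin \o f)). Qed.

Lemma RintegrableS D f : measurable D -> mu.-integrable setT (EFin \o f) ->
  mu.-integrable D (EFin \o f).
Proof. by move=> mD; apply: integrableS. Qed.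

Lemma Rdominated_convergence D (f_ : nat -> R -> R) f g : measurable D ->
  (forall n, measurable_fun D (f_ n)) ->
  (forall x, D x -> f_ ^~ x @ \oo --> f x) ->
  (forall n x, D x -> `|f_ n x| <= g x) -> mu.-integrable D (EFin \o g) ->
  (fun n => \int[mu]_(x in D) f_ n x) @ \oo --> \int[mu]_(x in D) f x.
Proof.
move=> mD mf ff fg ig.
have mf' n : measurable_fun D (EFin \o f_ n) by exact/measurable_EFinP.
have mff : measurable_fun D f by exact: measurable_fun_cvg mf ff.
have [] := @dominated_convergence _ _ _ mu D mD (fun n => EFin \o f_ n) (EFin \o f)
  (EFin \o g) mf' _ _ ig _.
- exact/measurable_EFinP.
- by apply: aeW => x Dx; apply: cvg_EFin; [exact: nearW|exact: ff].
- by apply: aeW => x n Dx; rewrite lee_fin fg.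
move=> iff _ h; apply: fine_cvg; rewrite fineK//.
exact: integrable_fin_num.
Qed.

Lemma Rintegral_FTC f F a b : a <= b -> continuous f ->
  (forall t : R, is_derive t 1 F (f t)) -> \int[mu]_(x in `[a, b]) f x = F b - F a.
Proof.
rewrite le_eqVlt => /predU1P[->|ab] cf dF.
  by rewrite set_itv1 Rintegral_set1 subrr.
have cF := is_derive_continuous dF.
rewrite /Rintegral (@continuous_FTC2 _ f F)//.
- exact: continuous_subspaceT.
- split.
  + by move=> x _; case: (dF x).
  + by apply: cvg_at_right_filter; exact: cF.
  + by apply: cvg_at_left_filter; exact: cF.
- by move=> x _; rewrite (is_derive_derive1 (dF x)).
Qed.

(** Dominated convergence along the truncations of [f] to [[a, a + n]], with [|f|] as dominating
    function. *)
Lemma Rintegral_FTCy f F a l : continuous f -> (forall t : R, is_derive t 1 F (f t)) ->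
  mu.-integrable `[a, +oo[ (EFin \o f) -> F x @[x --> +oo] --> l ->
  \int[mu]_(x in `[a, +oo[) f x = l - F a.
Proof.
move=> cf dF ify Fl.
have mf : measurable_fun setT f by exact: continuous_measurable_fun.
have ia : mu.-integrable `[a, +oo[ (EFin \o (Num.norm \o f)).
  exact: Rintegrable_norm ify.
have h : (fun n => \int[mu]_(x in `[a, +oo[) ((f \_ `[a, a + n%:R]) x)) @ \oo -->
    \int[mu]_(x in `[a, +oo[) f x.
  apply: (@Rdominated_convergence _ _ _ (Num.norm \o f)) => //.
  - move=> n; apply: measurable_funTS; apply/(measurable_restrictT _ _).1 => //.
    exact: measurable_funTS.
  - move=> x; rewrite /= in_itv /= andbT => ax.
    apply: cvg_near_cst; near=> n.
    rewrite patchE mem_set//= in_itv /= ax /= -lerBlDl.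
    by near: n; apply: nbhs_infty_ger.
  - by move=> n x _ /=; rewrite patchE; case: ifP => _ //; rewrite normr0.
have h' : (fun n : nat => F (a + n%:R) - F a) @ \oo --> l - F a.
  apply: cvgB; last exact: cvg_cst.
  apply: (cvg_comp (fun n : nat => a + n%:R) F _ Fl).
  by apply: (cvg_comp (fun n : nat => n%:R : R) (fun x => a + x) (@cvgr_idn R)); exact: cvg_addrl.
apply: (cvg_unique _ h) => //.
suff -> : (fun n => \int[mu]_(x in `[a, +oo[) ((f \_ `[a, a + n%:R]) x)) =
   (fun n : nat => F (a + n%:R) - F a) by [].
apply/funext => n; rewrite -Rintegral_mkcondr.
rewrite (_ : _ `&` _ = [set` `[a, a + n%:R]]).
  by apply: Rintegral_FTC => //; rewrite lerDl.
apply/seteqP; split=> [x []//|x /=]; rewrite !in_itv /= => /andP[-> ->].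
by rewrite andbT.
Unshelve. all: end_near. Qed.

Lemma cvg_expRN_lin c : 0 < c -> expR (- (c * x)) @[x --> +oo] --> (0 : R).
Proof.
move=> c0; apply: (cvg_comp (fun x => c * x) (fun x => expR (- x)) _ (@cvgr_expR R)).
exact: gt0_cvgMry.
Qed.

Lemma continuous_expRN_lin c : continuous (fun x : R => expR (- (c * x))).
Proof.
have d (t : R) : is_derive t 1 (fun x : R => expR (- (c * x))) (- c * expR (- (c * t))).
  by derive_eq; ring.
exact: is_derive_continuous d.
Qed.

Lemma integrable_expRN c a : 0 < c ->
  mu.-integrable `[a, +oo[ (EFin \o (fun x => expR (- (c * x)))).
Proof.
move=> c0.
pose F (x : R) : R := - c^-1 * expR (- (c * x)).
have dF (t : R) : is_derive t 1 F (expR (- (c * t))).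
  by rewrite /F; derive_eq; field; rewrite gt_eqF.
have := @ge0_continuous_FTC2y _ (fun x => expR (- (c * x)))
  F a 0.
move=> h; apply/integrableP; split.
  apply/measurable_EFinP; apply: measurable_funTS.
  by apply: continuous_measurable_fun; exact: continuous_expRN_lin.
under eq_integral do rewrite /= ger0_norm ?expR_ge0//.
rewrite h.
- by rewrite -EFinN -EFinD ltry.
- by move=> x _; rewrite expR_ge0.
- by apply: continuous_subspaceT; exact: continuous_expRN_lin.
- by rewrite -(mulr0 (- c^-1)); apply: cvgMr; exact: cvg_expRN_lin.
- by move=> x _; case: (dF x).
- by apply: cvg_at_right_filter; exact: (is_derive_continuous dF).
- by move=> x _; rewrite (is_derive_derive1 (dF x)).
Qed.

End RealIntegrals.

(** * Integrals of complex-valued functions *)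

Section ComplexIntegrals.
Variable R : realType.
Notation mu := (@lebesgue_measure R).
Implicit Types (D : set R) (f g : R -> R[i]) (h : R -> R).

Definition cint D f : R[i] :=
  Complex (\int[mu]_(u in D) Rez (f u)) (\int[mu]_(u in D) Imz (f u)).

Definition cintegrable D f :=
  mu.-integrable D (EFin \o (fun u => Rez (f u))) /\
  mu.-integrable D (EFin \o (fun u => Imz (f u))).

Definition cmeasurable D f :=
  measurable_fun D (fun u => Rez (f u)) /\ measurable_fun D (fun u => Imz (f u)).

Lemma cintegrable_dom D f h : measurable D -> cmeasurable D f ->
  (forall u, D u -> normc (f u) <= h u) -> mu.-integrable D (EFin \o h) ->
  cintegrable D f.
Proof.
move=> mD [mr mi] fh ih; split; apply: integrable_dom ih => // u Du.
- exact: le_trans (Re_le_normc _) (fh _ Du).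
- exact: le_trans (Im_le_normc _) (fh _ Du).
Qed.

(** Real and imaginary parts are bounded separately, whence the factor 2; it is harmless because the
    bound only serves to show that errors tend to 0. *)
Lemma normc_cint_le D f h : measurable D -> cintegrable D f ->
  (forall u, D u -> normc (f u) <= h u) -> mu.-integrable D (EFin \o h) ->
  normc (cint D f) <= 2 * \int[mu]_(u in D) h u.
Proof.
move=> mD [ir ii] fh ih; apply: le_trans (normc_le_ReIm _) _.
have bnd (k : R -> R) : mu.-integrable D (EFin \o k) ->
    (forall u, D u -> `|k u| <= h u) ->
    `|\int[mu]_(u in D) k u| <= \int[mu]_(u in D) h u.
  move=> ik kh; apply: le_trans (@le_normr_Rintegral _ _ R mu D k mD ik) _.
  by apply: le_Rintegral => //; exact: Rintegrable_norm.
rewrite mulr2n mulrDl mul1r; apply: lerD; apply: bnd => // u Du.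
- exact: le_trans (Re_le_normc _) (fh _ Du).
- exact: le_trans (Im_le_normc _) (fh _ Du).
Qed.

Lemma eq_cint D f g : (forall u, D u -> f u = g u) -> cint D f = cint D g.
Proof.
by move=> fg; congr Complex; apply: eq_Rintegral => u /set_mem Du; rewrite fg.
Qed.

Lemma cintegrableD D f g : measurable D -> cintegrable D f -> cintegrable D g ->
  cintegrable D (fun u => f u + g u).
Proof.
move=> mD [fr fi] [gr gi]; split.
  under eq_fun do rewrite cReD; exact: RintegrableD.
under eq_fun do rewrite cImD; exact: RintegrableD.
Qed.

Lemma cintegrableZ D (w : R[i]) f : measurable D -> cintegrable D f ->
  cintegrable D (fun u => w * f u).
Proof.
move=> mD [fr fi]; split.
  under eq_fun do rewrite cReM; apply: RintegrableB => //; exact: RintegrableZ.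
by under eq_fun do rewrite cImM; apply: RintegrableD => //; exact: RintegrableZ.
Qed.

Lemma cintD D f g : measurable D -> cintegrable D f -> cintegrable D g ->
  cint D (fun u => f u + g u) = cint D f + cint D g.
Proof.
move=> mD [fr fi] [gr gi]; apply: complexP; rewrite /cint /=.
  by under eq_Rintegral do rewrite cReD; rewrite RintegralD.
by under eq_Rintegral do rewrite cImD; rewrite RintegralD.
Qed.

Lemma cintZ D w f : measurable D -> cintegrable D f ->
  cint D (fun u => w * f u) = w * cint D f.
Proof.
move=> mD [fr fi].
have i1 c k : mu.-integrable D (EFin \o k) ->
    mu.-integrable D (EFin \o (fun u => c * k u)).
  exact: RintegrableZ.
apply: complexP; rewrite /cint.
  rewrite cReM /=; under eq_Rintegral do rewrite cReM.
  by rewrite RintegralB ?RintegralZl//; apply: i1.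
rewrite cImM /=; under eq_Rintegral do rewrite cImM.
by rewrite RintegralD ?RintegralZl//; apply: i1.
Qed.

Lemma cintegrable0 D : cintegrable D (fun=> 0).
Proof. by split; apply: integrable0. Qed.

Lemma cintegrable_sum D (I : Type) (r : seq I) (f : I -> R -> R[i]) : measurable D ->
  (forall i, cintegrable D (f i)) -> cintegrable D (fun u => \sum_(i <- r) f i u).
Proof.
move=> mD fi; elim: r => [|i r IH].
  by under eq_fun do rewrite big_nil; exact: cintegrable0.
by under eq_fun do rewrite big_cons; exact: cintegrableD.
Qed.

Lemma cint_sum D (I : Type) (r : seq I) (f : I -> R -> R[i]) : measurable D ->
  (forall i, cintegrable D (f i)) ->
  cint D (fun u => \sum_(i <- r) f i u) = \sum_(i <- r) cint D (f i).
Proof.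
move=> mD fi; elim: r => [|i r IH].
  rewrite big_nil; under [X in cint _ X]eq_fun do rewrite big_nil.
  by apply: complexP; rewrite /cint /= /Rintegral integral0.
rewrite big_cons -IH -cintD//; last exact: cintegrable_sum.
by under [X in cint _ X]eq_fun do rewrite big_cons.
Qed.

Lemma cintegrableB D f g : measurable D -> cintegrable D f -> cintegrable D g ->
  cintegrable D (fun u => f u - g u).
Proof.
move=> mD fi gi; have := cintegrableD mD fi (@cintegrableZ D (-1) g mD gi).
by under eq_fun do rewrite mulN1r.
Qed.

Lemma cintB D f g : measurable D -> cintegrable D f -> cintegrable D g ->
  cint D (fun u => f u - g u) = cint D f - cint D g.
Proof.
move=> mD fi gi; rewrite -mulN1r -cintZ// -cintD//; last exact: cintegrableZ.
by apply: eq_cint => u _; rewrite mulN1r.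
Qed.

End ComplexIntegrals.

(** * Integrals of an affine function times a complex exponential *)

Section ComplexDerivatives.
Variable R : realType.
Notation mu := (@lebesgue_measure R).
Implicit Types (f g : R -> R[i]) (t : R).

Definition cderive f t (d : R[i]) :=
  is_derive t 1 (fun u : R => Rez (f u)) (Rez d) /\
  is_derive t 1 (fun u : R => Imz (f u)) (Imz d).

Lemma cderive_cst t w : cderive (fun=> w) t 0.
Proof. by split; apply: is_derive_cst. Qed.

Lemma cderive_id t : cderive (fun u : R => Complex u 0) t 1.
Proof. by split; [apply: is_derive_id|apply: is_derive_cst]. Qed.

Lemma cderiveD f g t (a b : R[i]) : cderive f t a -> cderive g t b ->
  cderive (fun u => f u + g u) t (a + b).
Proof.
move=> [? ?] [? ?]; split; rewrite ?cReD ?cImD.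
  by under eq_fun do rewrite cReD; apply: is_deriveD_fun.
by under eq_fun do rewrite cImD; apply: is_deriveD_fun.
Qed.

Lemma cderiveM f g t (a b : R[i]) : cderive f t a -> cderive g t b ->
  cderive (fun u => f u * g u) t (f t * b + g t * a).
Proof.
move=> [fr fi] [gr gi]; split.
  under eq_fun do rewrite cReM.
  notypeclasses refine (is_derive_eq _ _).
    by notypeclasses refine (is_deriveD_fun _ _); [|notypeclasses refine (is_deriveN_fun _)];
      notypeclasses refine (is_deriveM_fun _ _); eassumption.
  by rewrite !ReImE; ring.
under eq_fun do rewrite cImM.
notypeclasses refine (is_derive_eq _ _).
  by notypeclasses refine (is_deriveD_fun _ _); notypeclasses refine (is_deriveM_fun _ _); eassumption.
by rewrite !ReImE; ring.
Qed.

Lemma cderive_cexp s t :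
  cderive (fun u : R => cexp (- s * Complex u 0)) t (- s * cexp (- s * Complex t 0)).
Proof.
case: s => x y; split; rewrite /=.
  by derive_eq; ring.
by derive_eq; ring.
Qed.

Lemma cderive_cst_eq f t (a b : R[i]) : cderive f t a -> a = b -> cderive f t b.
Proof. by move=> h <-. Qed.

Lemma cderive_continuous f (df : R -> R[i]) : (forall t, cderive f t (df t)) ->
  continuous (fun u : R => Rez (f u)) /\ continuous (fun u : R => Imz (f u)).
Proof.
move=> h; split; apply: is_derive_continuous => t; first exact: (h t).1.
exact: (h t).2.
Qed.

Lemma cint_FTCy f F (a : R) :
  continuous (fun u : R => Rez (f u)) -> continuous (fun u : R => Imz (f u)) ->
  (forall t, cderive F t (f t)) ->
  cintegrable `[a, +oo[ f -> normc (F x) @[x --> +oo] --> 0 ->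
  cint `[a, +oo[ f = - F a.
Proof.
move=> cr ci dF [ir ii] F0.
have lim0 (h : R -> R) : (forall x, `|h x| <= normc (F x)) -> h x @[x --> +oo] --> 0.
  move=> hF; apply: norm_cvg0.
  apply: (squeeze_cvgr _ (cvg_cst (0 : R)) F0).
  by apply: nearW => x; rewrite normr_ge0 hF.
apply: complexP.
  have /= -> := @Rintegral_FTCy _ _ (fun u => Rez (F u)) a 0 cr (fun t => (dF t).1) ir
    (lim0 _ (fun x => Re_le_normc _)).
  by rewrite cReN sub0r.
have /= -> := @Rintegral_FTCy _ _ (fun u => Imz (F u)) a 0 ci (fun t => (dF t).2) ii
  (lim0 _ (fun x => Im_le_normc _)).
by rewrite cImN sub0r.
Qed.

Lemma normc_real (x : R) : normc (Complex x 0) = `|x|.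
Proof. by rewrite /= expr0n /= addr0 sqrtr_sqr. Qed.

(** This family contains its own primitives and covers the transforms needed later: of a ramp, with
    [be = 1], and of an exponential, with [be = 0]. *)
Definition affexp (al be s : R[i]) (u : R) : R[i] :=
  (al + be * Complex u 0) * cexp (- s * Complex u 0).

(** Half of the exponential decay pays for the linear factor, since [c / 2 * |u|] is itself bounded
    by an exponential; [|u| <= u + 2 * |a|] takes care of negative [u]. *)
Lemma affexp_bound (al be s : R[i]) (a : R) : 0 < Rez s -> exists B, forall u, a <= u ->
  normc (affexp al be s u) <= B * expR (- (Rez s / 2 * u)).
Proof.
move=> s0; set c := Rez s in s0 *.
exists ((normc al + normc be * (2 / c)) * expR (c * `|a|)) => u au.
rewrite normcM normc_cexp.
have -> : Rez (- s * Complex u 0) = - (c * u) by rewrite cReM cReN /= mulr0 subr0 mulNr.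
have au' : `|u| <= u + 2 * `|a|.
  have := ler_norm (- a); rewrite normrN => h.
  by rewrite ler_norml; apply/andP; split; have := normr_ge0 a; lra.
set E := expR (c * `|a|) * expR (- (c / 2 * u)).
have e1 : expR (- (c * u)) <= E.
  rewrite /E -expRD ler_expR.
  have h1 : - a <= `|a| by rewrite -normrN ler_norm.
  have h2 : 0 <= c * (`|a| + u) by rewrite mulr_ge0 ?(ltW s0)//; lra.
  have h3 : 0 <= c * `|a| by rewrite mulr_ge0 ?(ltW s0).
  have -> : - (c * u) = - (c / 2 * u) - c / 2 * u by field.
  rewrite addrC lerD2r; nra.
have e2 : `|u| * expR (- (c * u)) <= 2 / c * E.
  have h1 : c / 2 * `|u| <= expR (c / 2 * (u + 2 * `|a|)).
    apply: le_trans (_ : c / 2 * (u + 2 * `|a|) <= _).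
      by rewrite ler_wpM2l// divr_ge0// ltW.
    by apply: le_trans (expR_ge1Dx _); rewrite lerDr.
  have h2 : `|u| <= 2 / c * expR (c / 2 * (u + 2 * `|a|)).
    rewrite -(@ler_pM2l _ (c / 2)) ?divr_gt0// mulrA.
    by have -> : c / 2 * (2 / c) = 1; [field; rewrite gt_eqF|rewrite mul1r].
  apply: le_trans (ler_wpM2r (expR_ge0 _) h2) _.
  rewrite -[leLHS]mulrA -expRD /E -expRD.
  by have -> // : c / 2 * (u + 2 * `|a|) + - (c * u) = c * `|a| + - (c / 2 * u) by field.
have h : normc (al + be * Complex u 0) <= normc al + normc be * `|u|.
  by apply: le_trans (normcD _ _) _; rewrite normcM normc_real.
apply: le_trans (ler_wpM2r (expR_ge0 _) h) _.
rewrite -[leRHS]mulrA -/E (mulrDl (normc al)) [leRHS](mulrDl (normc al)) -!(mulrA (normc be)).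
by apply: lerD; apply: ler_wpM2l => //; exact: normc_ge0.
Qed.

Lemma cderive_affexp al be s t :
  cderive (affexp al be s) t ((be - s * al) * cexp (- s * Complex t 0)
     - s * be * Complex t 0 * cexp (- s * Complex t 0)).
Proof.
apply: cderive_cst_eq.
  apply: cderiveM (cderive_cexp _ _).
  exact: cderiveD (cderive_cst _ _) (cderiveM (cderive_cst _ _) (cderive_id _)).
rewrite /=; ring.
Qed.

Lemma continuous_affexp al be s :
  continuous (fun u : R => Rez (affexp al be s u)) /\
  continuous (fun u : R => Imz (affexp al be s u)).
Proof. exact: cderive_continuous (cderive_affexp al be s). Qed.

Lemma cintegrable_affexp (al be s : R[i]) (a : R) : 0 < Rez s ->
  cintegrable `[a, +oo[ (affexp al be s).
Proof.
move=> s0; have [B hB] := affexp_bound al be a s0.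
have [cr ci] := continuous_affexp al be s.
apply: (@cintegrable_dom _ _ _ (fun u => B * expR (- (Rez s / 2 * u)))) => //.
- by split; apply: measurable_funTS; exact: continuous_measurable_fun.
- by move=> u; rewrite /= in_itv /= andbT; exact: hB.
- have h := @integrable_expRN R (Rez s / 2) a (divr_gt0 s0 (ltr0Sn _ _)).
  exact: RintegrableZ.
Qed.

Lemma cint_affexp (al be s : R[i]) (a : R) : 0 < Rez s ->
  cint `[a, +oo[ (affexp al be s) =
  ((al + be * Complex a 0) / s + be / s ^+ 2) * cexp (- s * Complex a 0).
Proof.
move=> s0; have sN0 : s != 0 by apply: contraTneq s0 => ->; rewrite ltxx.
have [cr ci] := continuous_affexp al be s.
rewrite (@cint_FTCy _ (affexp (- (al / s + be / s ^+ 2)) (- (be / s)) s))//.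
- by rewrite /affexp; field.
- by move=> t; apply: cderive_cst_eq; [exact: cderive_affexp|rewrite /affexp; field].
- exact: cintegrable_affexp.
- have [B hB] := affexp_bound (- (al / s + be / s ^+ 2)) (- (be / s)) 0 s0.
  apply: (squeeze_cvgr _ (cvg_cst (0 : R))).
    near=> x; rewrite normc_ge0 /=; apply: hB; near: x.
    exact: nbhs_pinfty_ge.
  rewrite -(mulr0 B); apply: cvgMr; apply: cvg_expRN_lin; exact: divr_gt0.
Unshelve. all: end_near. Qed.

End ComplexDerivatives.

(** * Integrals over the whole line *)

Section WholeLine.
Variable R : realType.
Notation mu := (@lebesgue_measure R).
Implicit Types (f g h : R -> R) (c : R).

Lemma integrable_exp_abs c : 0 < c ->
  mu.-integrable setT (EFin \o (fun u : R => expR (- (c * `|u|)))).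
Proof.
move=> c0.
have cf : continuous (fun u : R => expR (- (c * `|u|))).
  move=> u; apply: (continuous_comp (f := fun u : R => - (c * `|u|)) (g := expR)).
    by apply: continuousN; apply: continuousM; [exact: cst_continuous|exact: norm_continuous].
  exact: continuous_expR.
apply/integrableP; split.
  by apply/measurable_EFinP; exact: continuous_measurable_fun.
under eq_integral do rewrite /= ger0_norm ?expR_ge0//.
rewrite ge0_symfun_integralT//=; last by move=> u /=; rewrite normrN.
rewrite -set_itvcy.
apply: lte_mul_pinfty; rewrite ?lee_fin//.
have /integrableP[_] := integrable_expRN 0 c0.
apply: le_lt_trans; rewrite le_eqVlt; apply/orP; left; apply/eqP; apply: eq_integral => u.
rewrite inE /= in_itv /= andbT => u0.
by rewrite /= !ger0_norm// expR_ge0.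
Qed.

(** The reflection is carried out for nonnegative integrands, then applied to [f + |f|] and [|f|],
    whose difference is [f]. *)
Lemma Rintegral_split f : continuous f -> mu.-integrable setT (EFin \o f) ->
  \int[mu]_(u in setT) f u =
  \int[mu]_(u in `[0, +oo[) f u + \int[mu]_(u in `[0, +oo[) f (- u).
Proof.
have ge0_split h : continuous h -> (forall u, 0 <= h u) ->
    mu.-integrable setT (EFin \o h) ->
    \int[mu]_(u in setT) h u =
    \int[mu]_(u in `[0, +oo[) h u + \int[mu]_(u in `[0, +oo[) h (- u) /\
    mu.-integrable `[0, +oo[ (EFin \o (fun u => h (- u))).
  move=> ch h0 ih.
  have mh : measurable_fun setT h by exact: continuous_measurable_fun.
  have eN : (\int[mu]_(u in `]-oo, 0%R]) (h u)%:E =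
             \int[mu]_(u in `[0%R, +oo[) (h (- u))%:E)%E.
    rewrite -[in LHS]oppr0 ge0_integration_by_substitutionNy//.
    exact: continuous_subspaceT.
  have ihN : mu.-integrable `[0, +oo[ (EFin \o (fun u => h (- u))).
    apply/integrableP; split.
      apply/measurable_EFinP; apply: measurable_funTS.
      by apply: measurableT_comp => //; exact: oppr_measurable.
    under eq_integral do rewrite /= ger0_norm//.
    rewrite -eN; have /integrableP[_] := RintegrableS (measurable_itv `]-oo, 0]) ih.
    by under eq_integral do rewrite /= ger0_norm//.
  split=> //.
  rewrite (_ : \int[mu]_(u in `[0, +oo[) h (- u) = \int[mu]_(u in `]-oo, 0[) h u).
    rewrite addrC -Rintegral_setU//.
    - by rewrite -setCitvr setUC setUv.
    - by apply: RintegrableS ih; apply: measurableU.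
    - by apply/disj_setPS => x [] /=; rewrite !in_itv /= andbT ltNge => /negP.
  rewrite [in RHS]Rintegral_itv_bndo_bndc; last by apply: RintegrableS ih.
  by rewrite /Rintegral eN.
move=> cf jf.
have cn : continuous (fun u => `|f u|).
  by move=> u; apply: (cvg_norm (cf u)).
have [h1 i1] := ge0_split (fun u => `|f u|) cn (fun=> normr_ge0 _) (Rintegrable_norm jf).
have cp : continuous (fun u => f u + `|f u|).
  by move=> u; apply: cvgD; [exact: cf|exact: cn].
have cp0 u : 0 <= f u + `|f u| by rewrite -lerBlDl sub0r -normrN ler_norm.
have [h2 i2] := ge0_split (fun u => f u + `|f u|) cp cp0
  (RintegrableD measurableT jf (Rintegrable_norm jf)).
have mI : measurable (`[0, +oo[ : set R) by exact: measurable_itv.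
have jfI : mu.-integrable `[0, +oo[ (EFin \o f) by apply: RintegrableS jf.
have fE u : f u = (f u + `|f u|) - `|f u| by rewrite addrK.
have jfN : mu.-integrable `[0, +oo[ (EFin \o (fun u => f (- u))).
  have := RintegrableB mI i2 i1; apply: eq_integrable => // u _.
  by rewrite /= addrK.
have e1 : \int[mu]_u (f u + `|f u|) = \int[mu]_u f u + \int[mu]_u `|f u|.
  by rewrite RintegralD//; exact: Rintegrable_norm.
have e2 : \int[mu]_(u in `[0, +oo[) (f u + `|f u|) = \int[mu]_(u in `[0, +oo[) f u + \int[mu]_(u in `[0, +oo[) `|f u|.
  by rewrite RintegralD//; exact: Rintegrable_norm.
have e3 : \int[mu]_(u in `[0, +oo[) (f (- u) + `|f (- u)|) = \int[mu]_(u in `[0, +oo[) f (- u) + \int[mu]_(u in `[0, +oo[) `|f (- u)|.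
  by rewrite RintegralD//; exact: (Rintegrable_norm jfN).
by move: h2; rewrite e1 e2 e3 h1 addrACA => /addIr.
Qed.

End WholeLine.

(** * A lower bound by Fourier inversion *)

Section Poisson.
Variable R : realType.
Notation mu := (@lebesgue_measure R).
Implicit Types (f g h k : R -> R) (c e t u v y C : R).

Lemma continuous_exp_abs c : continuous (fun u => expR (- (c * `|u|))).
Proof.
move=> u; apply: (continuous_comp (f := fun u : R => - (c * `|u|)) (g := expR)).
  by apply: continuousN; apply: continuousM; [exact: cst_continuous|exact: norm_continuous].
exact: continuous_expR.
Qed.

Lemma continuous_cos_lin (a b : R) : continuous (fun u => cos (a + b * u)).
Proof.
move=> u; apply: (continuous_comp (f := fun u : R => a + b * u) (g := cos)).
  by apply: cvgD; [exact: cvg_cst|apply: cvgM; [exact: cvg_cst|exact: cvg_id]].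
exact: continuous_cos.
Qed.

Lemma cos_abs_le1 (a : R) : `|cos a| <= 1.
Proof. by rewrite ler_norml cos_geN1 cos_le1. Qed.

Lemma sin_abs_le1 (a : R) : `|sin a| <= 1.
Proof. by rewrite ler_norml sin_geN1 sin_le1. Qed.

Lemma Rintegral_exp_abs_cos c y : 0 < c ->
  \int[mu]_(t in setT) (expR (- (c * `|t|)) * cos (t * y)) = 2 * c / (c ^+ 2 + y ^+ 2).
Proof.
move=> c0.
have cf : continuous (fun t => expR (- (c * `|t|)) * cos (t * y)).
  move=> t; apply: cvgM; first exact: continuous_exp_abs.
  have := @continuous_cos_lin 0 y t.
  by under eq_fun do rewrite add0r mulrC.
rewrite Rintegral_split//; last first.
  apply: integrable_dom (integrable_exp_abs c0) => //.
    exact: continuous_measurable_fun.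
  by move=> t _; rewrite normrM ger0_norm ?expR_ge0// ler_piMr ?expR_ge0// cos_abs_le1.
(* Each half-line contributes the real part of [1 / s], the integral of [exp (- s * t)] for
   [s = c - i * y]. *)
pose s : R[i] := Complex c (- y).
have s0 : 0 < Rez s by [].
have := cint_affexp 1 0 0 s0; move=> /(congr1 (@complex.Re R)).
rewrite !mul0r !addr0 !mulr0 cexp0 mulr1 div1r /cint [X in X = _]/= => h.
have e (g : R -> R) : (forall t, 0 <= t -> g t = expR (- (c * t)) * cos (t * y)) ->
    \int[mu]_(t in `[0, +oo[) g t = c / (c ^+ 2 + y ^+ 2).
  move=> hg; have -> : c / (c ^+ 2 + y ^+ 2) = Rez s^-1 by rewrite /s /= sqrrN.
  rewrite -h; apply: eq_Rintegral => t; rewrite inE /= in_itv /= andbT => t0.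
  rewrite hg// /affexp /= !(mul0r, mulr0, subr0, addr0, add0r, mul1r, opprK, mulNr).
  by rewrite (mulrC y).
rewrite !e; first by field; rewrite gt_eqF// ltr_wpDr ?sqr_ge0 ?exprn_gt0.
- by move=> t t0; rewrite normrN ger0_norm// mulNr cosN.
- by move=> t t0; rewrite ger0_norm.
Qed.

Lemma integral_cauchy : (\int[mu]_z (2 / (1 + z ^+ 2))%:E)%E = (2 * pi)%:E.
Proof.
have -> : (\int[mu]_z (2 / (1 + z ^+ 2))%:E)%E = (2%:E * \int[mu]_z ((1 + z ^+ 2)^-1)%:E)%E.
  rewrite -ge0_integralZl//.
  - apply/measurable_EFinP; apply: continuous_measurable_fun; exact: continuous_oneDsqrV.
  - by move=> z _; rewrite lee_fin invr_ge0 addr_ge0// sqr_ge0.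
rewrite ge0_symfun_integralT.
- rewrite -set_itvcy; have -> := @integral0y_oneDsqr R.
  by rewrite -!EFinM; congr EFin; field.
- by move=> z; rewrite invr_ge0 addr_ge0// sqr_ge0.
- exact: continuous_oneDsqrV.
- by move=> z /=; rewrite sqrrN.
Qed.

(** This is [2 * pi] times the Poisson kernel of the upper half-plane, and the Fourier transform of
    [exp (- e * |t|)]. *)
Definition poisson e y : R := 2 * e / (e ^+ 2 + y ^+ 2).

Lemma poisson_ge0 e y : 0 < e -> 0 <= poisson e y.
Proof. by move=> e0; rewrite divr_ge0 ?addr_ge0 ?sqr_ge0// mulr_ge0// ltW. Qed.

Lemma continuous_poisson e v : 0 < e -> continuous (fun u => poisson e (v - u)).
Proof.
move=> e0 u; apply: cvgM; first exact: cvg_cst.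
apply: cvgV; first by rewrite gt_eqF// ltr_wpDr ?sqr_ge0 ?exprn_gt0.
apply: cvgD; first exact: cvg_cst.
apply: cvgM; (apply: cvgB; [exact: cvg_cst|exact: cvg_id]).
Qed.

Lemma poisson_subst h e v : 0 < e -> continuous h -> (forall u, 0 <= h u) ->
  (\int[mu]_u (h u * poisson e (v - u))%:E)%E =
  (\int[mu]_z (h (v + e * z) * (2 / (1 + z ^+ 2)))%:E)%E.
Proof.
move=> e0 ch h0.
pose F : R -> R := fun z => v + e * z.
have dF (z : R) : is_derive z 1 F e by rewrite /F; derive_eq; ring.
have F'E : derive1 F = cst e by apply/funext => z; rewrite (is_derive_derive1 (dF z)).
rewrite (@increasing_ge0_integration_by_substitutionT _ F).
- apply: eq_integral => z _; congr EFin.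
  have -> : (((fun u => h u * poisson e (v - u)) \o F) * derive1 F) z =
     h (v + e * z) * poisson e (v - (v + e * z)) * e by rewrite F'E.
  rewrite -mulrA; congr (_ * _).
  have n0 : 1 + z ^+ 2 != 0 by rewrite gt_eqF// ltr_wpDr ?sqr_ge0.
  have -> : poisson e (v - (v + e * z)) = 2 * e / (e ^+ 2 * (1 + z ^+ 2)).
    by rewrite /poisson; congr (_ / _); ring.
  by field; rewrite n0 gt_eqF.
- by move=> a b ab; rewrite /F ltrD2l ltr_pM2l.
- by rewrite F'E; exact: cst_continuous.
- by rewrite F'E; exact: is_cvg_cst.
- by rewrite F'E; exact: is_cvg_cst.
- by move=> z; case: (dF z).
- apply: (cvg_comp (fun z => e * z) (fun z => v + z)); first by apply: gt0_cvgMrNy.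
  exact: cvg_addrl_Ny.
- apply: (cvg_comp (fun z => e * z) (fun z => v + z)); last exact: cvg_addrl.
  by apply: gt0_cvgMry.
- by move=> u; apply: cvgM; [exact: ch|exact: continuous_poisson].
- by move=> u; rewrite mulr_ge0// poisson_ge0.
Qed.

Let cauchy_ge0 (z : R) : 0 <= 2 / (1 + z ^+ 2).
Proof. by rewrite divr_ge0// addr_ge0 ?sqr_ge0. Qed.

Let continuous_cauchy : continuous (fun z : R => 2 / (1 + z ^+ 2)).
Proof. by move=> z; apply: cvgM; [exact: cvg_cst|exact: continuous_oneDsqrV]. Qed.

Lemma integrable_cauchy : mu.-integrable setT (EFin \o (fun z : R => 2 / (1 + z ^+ 2))).
Proof.
apply/integrableP; split.
  apply/measurable_EFinP; exact: continuous_measurable_fun.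
under eq_integral do rewrite /= ger0_norm//.
by rewrite integral_cauchy ltry.
Qed.

Lemma integrable_poisson e v : 0 < e ->
  mu.-integrable setT (EFin \o (fun u => poisson e (v - u))).
Proof.
move=> e0; apply/integrableP; split.
  by apply/measurable_EFinP; apply: continuous_measurable_fun; exact: continuous_poisson.
under eq_integral do rewrite /= ger0_norm ?poisson_ge0//.
have h := @poisson_subst (fun=> 1) e v e0 (fun _ => cvg_cst _) (fun=> ler01).
rewrite (_ : (\int[mu]_u (poisson e (v - u))%:E)%E = (2 * pi)%:E) ?ltry//.
rewrite -integral_cauchy; transitivity (\int[mu]_u (1 * poisson e (v - u))%:E)%E.
  by apply: eq_integral => u _; rewrite mul1r.
by rewrite h; apply: eq_integral => u _; rewrite mul1r.
Qed.

Lemma integrable_mul_poisson h e v C : 0 < e -> continuous h -> (forall u, `|h u| <= C) ->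
  mu.-integrable setT (EFin \o (fun u => h u * poisson e (v - u))).
Proof.
move=> e0 ch hC; apply: (integrable_dom _ _ _ (RintegrableZ C measurableT (integrable_poisson v e0))) => //.
  apply: continuous_measurable_fun => u; apply: cvgM; [exact: ch|exact: continuous_poisson].
by move=> u _; rewrite normrM (ger0_norm (poisson_ge0 _ e0)) ler_wpM2r// poisson_ge0.
Qed.

(** The substitution [u = v + e * z] moves the dependence on [e] from the kernel to the bounded
    function [h], so that dominated convergence applies. *)
Lemma poisson_lim_ge0 h C v : continuous h -> (forall u, 0 <= h u) -> (forall u, h u <= C) ->
  (fun n => \int[mu]_(u in setT) (h u * poisson n.+1%:R^-1 (v - u))) @ \oo -->
  2 * pi * h v.
Proof.
move=> ch h0 hC.
have -> : 2 * pi * h v = \int[mu]_(z in setT) (h v * (2 / (1 + z ^+ 2))).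
  rewrite RintegralZl//; last exact: integrable_cauchy.
  by rewrite /Rintegral integral_cauchy /= mulrC.
rewrite (_ : (fun n => _) = fun n : nat => \int[mu]_(z in setT)
    (h (v + n.+1%:R^-1 * z) * (2 / (1 + z ^+ 2)))); last first.
  by apply/funext => n; rewrite /Rintegral poisson_subst.
apply: (@Rdominated_convergence _ _ _ _ (fun z => C * (2 / (1 + z ^+ 2)))) => //.
- move=> n; apply: continuous_measurable_fun => z; apply: cvgM; last exact: continuous_cauchy.
  apply: (cvg_comp _ h _ (ch (v + n.+1%:R^-1 * z))).
  by apply: cvgD; [exact: cvg_cst|apply: cvgM; [exact: cvg_cst|exact: cvg_id]].
- move=> z _; apply: cvgMl; apply: (cvg_comp _ h _ (ch v)).
  have : (fun n => v + n.+1%:R^-1 * z) @ \oo --> v + 0 * z.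
    by apply: cvgD; [exact: cvg_cst|apply: cvgMl; exact: cvg_harmonic].
  by rewrite mul0r addr0; apply.
- move=> n z _; rewrite normrM !ger0_norm//; exact: ler_wpM2r.
- by apply: RintegrableZ => //; exact: integrable_cauchy.
Qed.

(** Adding the constant [C] makes the function nonnegative; the limit for the constant is then
    subtracted. *)
Lemma poisson_lim k C v : continuous k -> (forall u, `|k u| <= C) ->
  (fun n => \int[mu]_(u in setT) (k u * poisson n.+1%:R^-1 (v - u))) @ \oo -->
  2 * pi * k v.
Proof.
move=> ck kC.
have k1 u : 0 <= k u + C by have := kC u; rewrite ler_norml => /andP[? _]; rewrite -lerBlDr sub0r.
have C0 : 0 <= C by exact: le_trans (kC 0).
have k2 u : k u + C <= 2 * C.
  by have := kC u; rewrite ler_norml => /andP[_ ?]; lra.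
have ckC : continuous (fun u => k u + C) by move=> u; apply: cvgD; [exact: ck|exact: cvg_cst].
have h1 := @poisson_lim_ge0 (fun u => k u + C) (2 * C) v ckC k1 k2.
have cc : continuous (fun _ : R => C) by move=> ?; exact: cvg_cst.
have h2 := @poisson_lim_ge0 (fun=> C) C v cc (fun=> C0) (fun=> lexx _).
have -> : 2 * pi * k v = 2 * pi * (k v + C) - 2 * pi * C by rewrite -mulrBr addrK.
rewrite (_ : (fun n => _) = (fun n => \int[mu]_u ((k u + C) * poisson n.+1%:R^-1 (v - u))) -
   (fun n => \int[mu]_u (C * poisson n.+1%:R^-1 (v - u)))); first exact: cvgB h1 h2.
apply/funext => n; rewrite !fctE -RintegralB//.
- by apply: eq_Rintegral => u _; rewrite -mulrBl addrK.
- by apply: (@integrable_mul_poisson _ _ _ (2 * C)) => // u; rewrite ger0_norm.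
- by apply: (@integrable_mul_poisson _ _ _ C) => // u; rewrite ger0_norm.
Qed.

End Poisson.

(** * Fubini for a damped Fourier transform *)

Section FourierFubini.
Variable R : realType.
Notation mu := (@lebesgue_measure R).
Variables (k : R -> R) (c C : R).
Hypotheses (c0 : 0 < c) (ck : continuous k)
  (kC : forall u, `|k u| <= C * expR (- (c * `|u|))).
(** [q] stands for both [cos (t * (v - u))] and [sin (t * u)]; Fubini sees only a measurable
    function bounded by 1. *)
Variable q : R * R -> R.
Hypotheses (mq : measurable_fun setT q) (q1 : forall z, `|q z| <= 1).
Variable e : R.
Hypothesis e0 : 0 < e.

Let f (z : R * R) : \bar R := (expR (- (e * `|z.1|)) * (k z.2 * q z))%:E.

Let mf : measurable_fun setT f.
Proof.
apply/measurable_EFinP; apply: measurable_funM.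
  apply: (measurableT_comp (f := fun t : R => expR (- (e * `|t|)))) => //.
  by apply: continuous_measurable_fun; exact: continuous_exp_abs.
apply: measurable_funM => //.
apply: (measurableT_comp (f := k)) => //.
exact: continuous_measurable_fun.
Qed.

Lemma integrable_k : mu.-integrable setT (EFin \o k).
Proof.
apply: (integrable_dom _ _ _ (RintegrableZ C measurableT (integrable_exp_abs c0))) => //.
exact: continuous_measurable_fun.
Qed.

Lemma integrable_kq t : mu.-integrable setT (EFin \o (fun u => k u * q (t, u))).
Proof.
apply: (integrable_dom _ _ _ (Rintegrable_norm integrable_k)) => //.
  apply: measurable_funM; first exact: continuous_measurable_fun.
  by apply: (measurableT_comp (f := q)) => //; exact: measurable_pair1.
by move=> u _; rewrite normrM ler_piMr.
Qed.

Lemma integrable_eq u :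
  mu.-integrable setT (EFin \o (fun t => expR (- (e * `|t|)) * q (t, u))).
Proof.
apply: (integrable_dom _ _ _ (integrable_exp_abs e0)) => //.
  apply: measurable_funM; first by apply: continuous_measurable_fun; exact: continuous_exp_abs.
  by apply: (measurableT_comp (f := q)) => //; exact: measurable_pair2.
by move=> t _; rewrite normrM ger0_norm ?expR_ge0// ler_piMr ?expR_ge0.
Qed.

Let imf : (mu \x mu)%E.-integrable setT f.
Proof.
apply: (@integrable12ltyP _ _ _ _ R mu mu f mf).2.
pose J := \int[mu]_(u in setT) `|k u|.
apply: (@le_lt_trans _ _ (\int[mu]_t (J * expR (- (e * `|t|)))%:E)%E).
  apply: ge0_le_integral => //.
  - by move=> t _; exact: integral_ge0.
  - apply: (@measurable_fun_fubini_tonelli_F _ _ _ _ R mu (abse \o f)); first exact: measurableT_comp.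
    by move=> z; exact: abse_ge0.
  - apply/measurable_EFinP; apply: continuous_measurable_fun => t.
    by apply: cvgM; [exact: cvg_cst|exact: continuous_exp_abs].
  move=> t _; rewrite EFinM /J /Rintegral.
  have /integrableP[_ ik] := integrable_k.
  rewrite fineK; last first.
    by rewrite ge0_fin_numE// integral_ge0.
  have mk : measurable_fun setT (fun u => (`|k u|)%:E).
    apply/measurable_EFinP; apply: measurableT_comp => //.
    exact: continuous_measurable_fun.
  rewrite muleC -(@ge0_integralZl _ _ R mu _ measurableT _ mk) ?lee_fin ?expR_ge0//.
   apply: ge0_le_integral => //.
  - apply: measurableT_comp => //; exact: (measurableT_comp (f := f)).
  - exact: measurable_funeM.
  move=> u _; rewrite /f /= -EFinM lee_fin normrM ger0_norm ?expR_ge0//.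
  by rewrite ler_wpM2l ?expR_ge0// normrM ler_piMr.
under eq_integral do rewrite EFinM.
have /integrableP[_ ie] := integrable_exp_abs e0.
have J0 : 0 <= J by exact: Rintegral_ge0.
rewrite ge0_integralZl//.
- apply: lte_mul_pinfty; rewrite ?lee_fin//.
  by under eq_integral do rewrite -[_%:E]gee0_abs ?lee_fin ?expR_ge0//.
- by apply/measurable_EFinP; apply: continuous_measurable_fun; exact: continuous_exp_abs.
Qed.

Let innerE t : (\int[mu]_u f (t, u))%E =
  (expR (- (e * `|t|)) * \int[mu]_(u in setT) (k u * q (t, u)))%:E.
Proof.
rewrite /Rintegral EFinM fineK; last exact: integrable_fin_num (integrable_kq t).
by rewrite -(integralZl measurableT (integrable_kq t)).
Qed.

Lemma integrable_fourier :
  mu.-integrable setT (EFin \o (fun t => expR (- (e * `|t|)) * \int[mu]_(u in setT) (k u * q (t, u)))).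
Proof.
have := @integrable_fubini_F _ _ _ _ R mu mu f imf.
by apply: eq_integrable => // t _; exact: innerE.
Qed.

Lemma fourier_swap :
  \int[mu]_(t in setT) (expR (- (e * `|t|)) * \int[mu]_(u in setT) (k u * q (t, u))) =
  \int[mu]_(u in setT) (k u * \int[mu]_(t in setT) (expR (- (e * `|t|)) * q (t, u))).
Proof.
have h := @Fubini _ _ _ _ R mu mu f imf.
rewrite /Rintegral; congr fine.
under eq_integral do rewrite -innerE.
rewrite h; apply: eq_integral => u _.
rewrite EFinM fineK; last exact: integrable_fin_num (integrable_eq u).
rewrite -(integralZl measurableT (integrable_eq u)).
by apply: eq_integral => t _; rewrite /f -EFinM mulrCA.
Qed.

End FourierFubini.

Section FiniteSums.
Variable R : realType.
Notation mu := (@lebesgue_measure R).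

Lemma Rintegrable_sum D (I : Type) (r : seq I) (f : I -> R -> R) : measurable D ->
  (forall i, mu.-integrable D (EFin \o f i)) ->
  mu.-integrable D (EFin \o (fun u => \sum_(i <- r) f i u)).
Proof.
move=> mD fi; elim: r => [|i r IH].
  by under eq_fun do rewrite big_nil; exact: integrable0.
by under eq_fun do rewrite big_cons; exact: RintegrableD.
Qed.

Lemma Rintegral_sum D (I : Type) (r : seq I) (f : I -> R -> R) : measurable D ->
  (forall i, mu.-integrable D (EFin \o f i)) ->
  \int[mu]_(u in D) (\sum_(i <- r) f i u) = \sum_(i <- r) \int[mu]_(u in D) f i u.
Proof.
move=> mD fi; elim: r => [|i r IH].
  rewrite big_nil; under eq_Rintegral do rewrite big_nil.
  by rewrite /Rintegral integral0.
rewrite big_cons -IH -RintegralD//; last exact: Rintegrable_sum.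
by under eq_Rintegral do rewrite big_cons.
Qed.

Lemma cvgr_sum (I : Type) (r : seq I) (f : I -> nat -> R) (l : I -> R) :
  (forall i, f i @ \oo --> l i) ->
  (fun n => \sum_(i <- r) f i n) @ \oo --> \sum_(i <- r) l i.
Proof.
move=> fl; elim: r => [|i r IH].
  by rewrite big_nil; under eq_fun do rewrite big_nil; exact: cvg_cst.
by rewrite big_cons; under eq_fun do rewrite big_cons; exact: cvgD.
Qed.

Lemma cvgr_le_ereal (u : nat -> R) (l : R) (x : \bar R) : u @ \oo --> l ->
  (forall n, ((u n)%:E <= x)%E) -> (l%:E <= x)%E.
Proof.
move=> ul; case: x => [x| |] h; [|exact: leey|by have := h 0%N].
rewrite lee_fin -(cvg_lim _ ul)//; apply: limr_le.
  by apply/cvg_ex; exists l.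
by apply: nearW => n; rewrite -lee_fin.
Qed.

End FiniteSums.

(** * The quadratic minorant and its Fourier inversion *)

Section FourierLower.
Variable R : realType.
Notation mu := (@lebesgue_measure R).

(** The real part of [exp (i * t * v) * k^ t], where [k^] is the Fourier transform of [k]. *)
Definition cosint (k : R -> R) (v t : R) := \int[mu]_(u in setT) (k u * cos (t * (v - u))).

Let q v (z : R * R) : R := cos (z.1 * (v - z.2)).

Let mq v : measurable_fun setT (q v).
Proof.
apply: (measurableT_comp (f := cos)).
  by apply: continuous_measurable_fun; exact: continuous_cos.
apply: measurable_funM; first exact: measurable_fst.
by apply: measurable_funB => //; exact: measurable_snd.
Qed.

Let q1 v z : `|q v z| <= 1. Proof. exact: cos_abs_le1. Qed.

Let qs (z : R * R) : R := sin (z.1 * z.2).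

Let mqs : measurable_fun setT qs.
Proof.
apply: (measurableT_comp (f := sin)).
  by apply: continuous_measurable_fun; exact: continuous_sin.
by apply: measurable_funM; [exact: measurable_fst|exact: measurable_snd].
Qed.

Let qs1 z : `|qs z| <= 1. Proof. exact: sin_abs_le1. Qed.

Section Kernel.
Variables (k : R -> R) (c C : R).
Hypotheses (c0 : 0 < c) (ck : continuous k)
  (kC : forall u, `|k u| <= C * expR (- (c * `|u|))).

Lemma integrable_cosint e v : 0 < e ->
  mu.-integrable setT (EFin \o (fun t => expR (- (e * `|t|)) * cosint k v t)).
Proof. by move=> e0; exact: (integrable_fourier c0 ck kC (mq v) (q1 v) e0). Qed.

Lemma cosint_poisson e v : 0 < e ->
  \int[mu]_(t in setT) (expR (- (e * `|t|)) * cosint k v t) =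
  \int[mu]_(u in setT) (k u * poisson e (v - u)).
Proof.
move=> e0; rewrite (fourier_swap c0 ck kC (mq v) (q1 v) e0).
by apply: eq_Rintegral => u _; congr (_ * _); exact: (Rintegral_exp_abs_cos (v - u) e0).
Qed.

Lemma cosint_lim v :
  (fun n => \int[mu]_(t in setT) (expR (- (n.+1%:R^-1 * `|t|)) * cosint k v t)) @ \oo -->
  2 * pi * k v.
Proof.
have C0 : 0 <= C.
  by have := le_trans (normr_ge0 _) (kC 0); rewrite normr0 mulr0 oppr0 expR0 mulr1.
under eq_fun do rewrite cosint_poisson//.
apply: (@poisson_lim _ _ C) => // u; apply: le_trans (kC u) _.
by rewrite ler_piMr// -expR0 ler_expR oppr_le0 mulr_ge0// ltW.
Qed.

Lemma cosintE v t : cosint k v t =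
  cos (t * v) * \int[mu]_(u in setT) (k u * cos (t * u)) +
  sin (t * v) * \int[mu]_(u in setT) (k u * sin (t * u)).
Proof.
have ic : mu.-integrable setT (EFin \o (fun u => k u * cos (t * u))).
  have := integrable_kq c0 ck kC (mq 0) (q1 0) t; apply: eq_integrable => // u _.
  by rewrite /q /= sub0r mulrN cosN.
have is_ : mu.-integrable setT (EFin \o (fun u => k u * sin (t * u))).
  exact: (integrable_kq c0 ck kC mqs qs1 t).
rewrite -!RintegralZl// -RintegralD//; try exact: RintegrableZ.
by apply: eq_Rintegral => u _; rewrite mulrBr cosB; ring.
Qed.

(** Fubini makes the transform damped by [exp (- |t|)] measurable; multiplying by [exp |t|] recovers
    the transform itself. *)
Lemma measurable_fourier :
  measurable_fun setT (fun t : R => \int[mu]_(u in setT) (k u * cos (t * u))) /\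
  measurable_fun setT (fun t : R => \int[mu]_(u in setT) (k u * sin (t * u))).
Proof.
have me : measurable_fun setT (fun t : R => expR (1 * `|t|)).
  have := @continuous_exp_abs R (-1); under eq_fun do rewrite mulNr opprK.
  by move=> h; exact: continuous_measurable_fun.
have un (g : R -> R) : mu.-integrable setT (EFin \o (fun t => expR (- (1 * `|t|)) * g t)) ->
    measurable_fun setT g.
  move=> /measurable_int /measurable_EFinP mg.
  have -> : g = (fun t => expR (1 * `|t|) * (expR (- (1 * `|t|)) * g t)).
    by apply/funext => t; rewrite mulrA -expRD subrr expR0 mul1r.
  exact: measurable_funM.
split; apply: un.
  have := integrable_fourier c0 ck kC (mq 0) (q1 0) ltr01; apply: eq_integrable => // t _.
  congr (_ * _)%:E; apply: eq_Rintegral => u _.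
  by rewrite /q /= sub0r mulrN cosN.
exact: (integrable_fourier c0 ck kC mqs qs1 ltr01).
Qed.

End Kernel.

(** Its Fourier transform is [1 / (1/4 + t ^ 2)], which is [1 / |s| ^ 2] on the critical line. The
    term [|P|^2 / |s|^2] is thus inverted by the same limit as the term in [k]. *)
Let k2 (u : R) := expR (- (2^-1 * `|u|)).

Let half_gt0 : 0 < (2^-1 : R). Proof. by rewrite invr_gt0. Qed.

Let k2C u : `|k2 u| <= 1 * expR (- (2^-1 * `|u|)).
Proof. by rewrite mul1r ger0_norm// expR_ge0. Qed.

Let ck2 : continuous k2. Proof. exact: continuous_exp_abs. Qed.

Lemma cosint_exp_abs v t : cosint k2 v t = cos (t * v) / (4^-1 + t ^+ 2).
Proof.
rewrite (cosintE half_gt0 ck2 k2C).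
have -> : \int[mu]_(u in setT) (k2 u * sin (t * u)) = 0.
  have is_ := integrable_kq half_gt0 ck2 k2C mqs qs1 t.
  rewrite Rintegral_split//; last first.
    move=> u; apply: cvgM; first exact: ck2.
    apply: (continuous_comp (f := fun u : R => t * u) (g := sin)).
      by apply: cvgMr; exact: cvg_id.
    exact: continuous_sin.
  rewrite -RintegralD//.
  - under eq_Rintegral do rewrite /k2 normrN mulrN sinN mulrN subrr.
    by rewrite /Rintegral integral0.
  - exact: RintegrableS is_.
  - have i2 : mu.-integrable `[0, +oo[ (EFin \o (fun u => -1 * (k2 u * sin (t * u)))).
      by apply: RintegrableZ => //; exact: RintegrableS is_.
    apply: eq_integrable i2 => // u _.
    by rewrite /k2 /= normrN mulrN sinN mulrN mulN1r.
under eq_Rintegral do rewrite mulrC (mulrC t) mulrC.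
rewrite Rintegral_exp_abs_cos// mulr0 addr0; congr (_ * _).
have -> : (2^-1 : R) ^+ 2 = 4^-1 by field.
by rewrite divff// mul1r.
Qed.

Variables (k : R -> R) (c C : R).
Hypotheses (c0 : 0 < c) (ck : continuous k)
  (kC : forall u, `|k u| <= C * expR (- (c * `|u|))).

Let X t := (4^-1 + t ^+ 2) * ((\int[mu]_(u in setT) (k u * cos (t * u))) ^+ 2 +
     (\int[mu]_(u in setT) (k u * sin (t * u))) ^+ 2).

Variables (n : nat) (b v : 'I_n -> R).

(** The expansion of [2 Re (k^ * P) - |P|^2 / |s|^2] for [P t = \sum_j b j * exp (i * t * v j)].
    Completing the square shows that it stays below [X]. *)
Let T t := 2 * (\sum_j b j * cosint k (v j) t) -
  \sum_j \sum_l b j * b l * cosint k2 (v j - v l) t.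

Let T_le t : T t <= X t.
Proof.
set a := 4^-1 + t ^+ 2; have a0 : 0 < a by rewrite ltr_wpDr ?sqr_ge0 ?invr_gt0.
set Cc := \int[mu]_(u in setT) (k u * cos (t * u)).
set S := \int[mu]_(u in setT) (k u * sin (t * u)).
pose p := \sum_j b j * cos (t * v j); pose r := \sum_j b j * sin (t * v j).
have e1 : \sum_j b j * cosint k (v j) t = Cc * p + S * r.
  rewrite /p /r !mulr_sumr -big_split; apply: eq_bigr => j _ /=.
  by rewrite (cosintE c0 ck kC) /Cc /S; ring.
have e2 : \sum_j \sum_l b j * b l * cosint k2 (v j - v l) t = (p ^+ 2 + r ^+ 2) / a.
  rewrite !expr2 {1}/p {1}/r !mulr_suml -big_split mulr_suml; apply: eq_bigr => j _ /=.
  rewrite /p /r !mulr_sumr -big_split mulr_suml; apply: eq_bigr => l _ /=.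
  by rewrite cosint_exp_abs mulrBr cosB /a; ring.
rewrite /T /X e1 e2 -/a -/Cc -/S -subr_ge0.
have -> : a * (Cc ^+ 2 + S ^+ 2) - (2 * (Cc * p + S * r) - (p ^+ 2 + r ^+ 2) / a) =
   ((a * Cc - p) ^+ 2 + (a * S - r) ^+ 2) / a by field; rewrite gt_eqF.
by rewrite divr_ge0 ?(ltW a0)// addr_ge0// sqr_ge0.
Qed.

Lemma fourier_lower :
  ((2 * pi * (2 * (\sum_j b j * k (v j)) -
      \sum_j \sum_l b j * b l * expR (- (2^-1 * `|v j - v l|))))%:E <=
   \int[mu]_t (X t)%:E)%E.
Proof.
have X0 t : 0 <= X t by rewrite mulr_ge0 ?addr_ge0 ?sqr_ge0 ?invr_ge0.
(* [T] is not known to be integrable; the damping factor makes each of its terms so. *)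
pose W m t := expR (- (m.+1%:R^-1 * `|t|)) * T t.
pose W' m t := 2 * (\sum_j b j * (expR (- (m.+1%:R^-1 * `|t|)) * cosint k (v j) t)) -
  \sum_j \sum_l b j * b l * (expR (- (m.+1%:R^-1 * `|t|)) * cosint k2 (v j - v l) t).
have WE m t : W m t = W' m t.
  rewrite /W /W' /T mulrBr mulrCA; congr (_ - _).
    by congr (_ * _); rewrite mulr_sumr; apply: eq_bigr => j _; rewrite mulrCA.
  rewrite mulr_sumr; apply: eq_bigr => j _; rewrite mulr_sumr; apply: eq_bigr => l _; rewrite mulrCA.
  by [].
have e0 m : 0 < (m.+1%:R^-1 : R) by rewrite invr_gt0.
have i1 m j : mu.-integrable setT
    (EFin \o (fun t => b j * (expR (- (m.+1%:R^-1 * `|t|)) * cosint k (v j) t))).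
  by apply: RintegrableZ => //; exact: (integrable_cosint c0 ck kC).
have i2 m j l : mu.-integrable setT
    (EFin \o (fun t => b j * b l * (expR (- (m.+1%:R^-1 * `|t|)) * cosint k2 (v j - v l) t))).
  by apply: RintegrableZ => //; exact: (integrable_cosint half_gt0 ck2 k2C).
have i3 m j : mu.-integrable setT
    (EFin \o (fun t => \sum_l b j * b l * (expR (- (m.+1%:R^-1 * `|t|)) * cosint k2 (v j - v l) t))).
  exact: Rintegrable_sum.
have iW m : mu.-integrable setT (EFin \o W m).
  rewrite (_ : W m = W' m); last exact/funext/WE.
  by apply: RintegrableB => //; [apply: RintegrableZ => //|]; exact: Rintegrable_sum.
apply: (@cvgr_le_ereal _ (fun m => \int[mu]_(t in setT) W m t)).
  rewrite (_ : (fun m => _) = fun m =>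
    2 * (\sum_j b j * \int[mu]_(t in setT) (expR (- (m.+1%:R^-1 * `|t|)) * cosint k (v j) t)) -
    \sum_j \sum_l b j * b l *
      \int[mu]_(t in setT) (expR (- (m.+1%:R^-1 * `|t|)) * cosint k2 (v j - v l) t)); last first.
    apply/funext => m; under eq_Rintegral do rewrite WE.
    rewrite RintegralB//; [|by apply: RintegrableZ => //; exact: Rintegrable_sum|exact: Rintegrable_sum].
    rewrite RintegralZl//; last exact: Rintegrable_sum.
    congr (_ * _ - _).
      rewrite Rintegral_sum//; apply: eq_bigr => j _; rewrite RintegralZl//.
      exact: (integrable_cosint c0 ck kC).
    rewrite Rintegral_sum//; apply: eq_bigr => j _; rewrite Rintegral_sum//.
    apply: eq_bigr => l _; rewrite RintegralZl//.
    exact: (integrable_cosint half_gt0 ck2 k2C).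
  rewrite mulrBr; apply: cvgB.
    rewrite mulrCA; apply: cvgMr.
    rewrite mulr_sumr; apply: cvgr_sum => j.
    by rewrite mulrCA; apply: cvgMr; exact: (cosint_lim c0 ck kC).
  rewrite mulr_sumr; apply: cvgr_sum => j; rewrite mulr_sumr; apply: cvgr_sum => l.
  by rewrite mulrCA; apply: cvgMr; exact: (cosint_lim half_gt0 ck2 k2C).
move=> m; rewrite /Rintegral fineK; last exact: integrable_fin_num (iW m).
have mW : measurable_fun setT (W m) by have /measurable_int /measurable_EFinP := iW m.
(* The integral of [X] may be infinite and [W m] may be negative, so the two are compared through
   the positive part of [W m]. *)
have mmax : measurable_fun setT (fun t => Num.max (W m t) 0).
  by apply: measurable_maxr => //; exact: measurable_cst.
have imax : mu.-integrable setT (EFin \o (fun t => Num.max (W m t) 0)).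
  apply: (integrable_dom _ _ _ (Rintegrable_norm (iW m))) => // t _.
  by case: (leP (W m t) 0) => //; rewrite normr0.
apply: (@le_trans _ _ (\int[mu]_t (Num.max (W m t) 0)%:E)%E).
  apply: le_integral => //; first exact: iW.
  by move=> t _; rewrite lee_fin le_max lexx.
have [mc ms] := measurable_fourier c0 ck kC.
apply: ge0_le_integral => //.
- by move=> t _; rewrite lee_fin le_max lexx orbT.
- exact/measurable_EFinP.
- apply/measurable_EFinP; apply: measurable_funM.
    apply: continuous_measurable_fun => t; apply: cvgD; first exact: cvg_cst.
    by apply: cvgM; exact: cvg_id.
  by apply: measurable_funD; apply: measurable_funX.
move=> t _; rewrite lee_fin ge_max X0 andbT.
case: (leP 0 (T t)) => [T0|/ltW T0].
  apply: le_trans (T_le t); apply: ler_piMl => //; rewrite -[leRHS]expR0 ler_expR oppr_le0.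
by apply: le_trans (X0 t); rewrite mulr_ge0_le0// expR_ge0.
Qed.

End FourierLower.

(** * Uniqueness of the continuation *)

Section Analytic.
Variable R : realType.
Implicit Types (u v a : nat -> R[i]^o) (l m : R[i]^o) (d g : R[i] -> R[i]) (z w h : R[i]).

Lemma cvgc0P u l : (u @ \oo --> l) <-> ((fun n => normc (l - u n)) @ \oo --> (0 : R)).
Proof.
rewrite cvgcP; split=> [h|h e e0].
  by apply/cvgr0Pnorm_lt => e /h; apply: filterS => n; rewrite ger0_norm ?normc_ge0.
by move/cvgr0Pnorm_lt: h => /(_ _ e0); apply: filterS => n; rewrite ger0_norm ?normc_ge0.
Qed.

Lemma cvgc_bound u l (B : nat -> R) : (forall n, normc (l - u n) <= B n) ->
  B @ \oo --> (0 : R) -> u @ \oo --> l.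
Proof.
move=> uB B0; apply/cvgc0P; apply: (squeeze_cvgr _ (cvg_cst (0 : R)) B0).
by apply: nearW => n; rewrite normc_ge0 uB.
Qed.

Lemma cvgcD u v l m : u @ \oo --> l -> v @ \oo --> m ->
  ((fun n => u n + v n) : nat -> R[i]^o) @ \oo --> (l + m : R[i]^o).
Proof.
move=> /cvgc0P ul /cvgc0P vm.
apply: (cvgc_bound (B := fun n => normc (l - u n) + normc (m - v n))) => [n|].
  by apply: le_trans (normcD _ _); rewrite opprD addrACA.
by rewrite -[X in _ --> X]addr0; exact: cvgD.
Qed.

Lemma cvgcZ c u l : u @ \oo --> l ->
  ((fun n => c * u n) : nat -> R[i]^o) @ \oo --> (c * l : R[i]^o).
Proof.
move=> /cvgc0P ul.
apply: (cvgc_bound (B := fun n => normc c * normc (l - u n))) => [n|].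
  by rewrite -normcM mulrBr.
by rewrite -[X in _ --> X](mulr0 (normc c)); exact: cvgMr.
Qed.

Lemma cvgcS u l : ((fun n => u n.+1) : nat -> R[i]^o) @ \oo --> l -> u @ \oo --> l.
Proof. by move=> h; rewrite -cvg_shiftS. Qed.

Lemma cvgcS' u l : u @ \oo --> l -> ((fun n => u n.+1) : nat -> R[i]^o) @ \oo --> l.
Proof. by move=> h; have := h; rewrite -cvg_shiftS. Qed.

Lemma eq_cvgc u v l : u @ \oo --> l -> (forall n, u n = v n) -> v @ \oo --> l.
Proof. by move=> ul /funext <-. Qed.

Lemma seriesE (f : nat -> R[i]^o) n : series f n = \sum_(k < n) f k.
Proof. by rewrite /series /= big_mkord. Qed.

Lemma analyticP g z : analytic_at g z <->
  exists a : nat -> R[i], exists2 r : R, 0 < r & forall w, normc (w - z) < r ->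
    ((fun n => \sum_(k < n) a k * (w - z) ^+ k) : nat -> R[i]^o) @ \oo --> (g w : R[i]^o).
Proof.
have sE (a : nat -> R[i]^o) w : series (fun k => a k * (w - z) ^+ k) =
    (fun n => \sum_(k < n) a k * (w - z) ^+ k) by apply/funext => n; exact: seriesE.
split=> [[a /nearcP[r r0 h]]|[a [r r0 h]]].
  by exists a; exists r; [exact: r0|move=> w /h; rewrite sE].
by exists a; apply/nearcP; exists r; [exact: r0|move=> w /h; rewrite sE].
Qed.

Lemma analytic_ext g d z (r : R) : 0 < r ->
  (forall w, normc (w - z) < r -> g w = d w) -> analytic_at g z -> analytic_at d z.
Proof.
move=> r0 gd /analyticP[a [r' r'0 h]]; apply/analyticP; exists a, (Num.min r r').
  by rewrite lt_min r0.
by move=> w; rewrite lt_min => /andP[w1 w2]; rewrite -gd//; exact: h.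
Qed.

Lemma analyticD g d z : analytic_at g z -> analytic_at d z ->
  analytic_at (fun w => g w + d w) z.
Proof.
move=> /analyticP[a [r r0 ha]] /analyticP[b [r' r'0 hb]]; apply/analyticP.
exists (fun k => a k + b k), (Num.min r r'); first by rewrite lt_min r0.
move=> w; rewrite lt_min => /andP[/ha ga /hb gb].
apply: (eq_cvgc (cvgcD ga gb)) => n.
by rewrite -big_split; apply: eq_bigr => k _; rewrite mulrDl.
Qed.

Lemma analyticZ c g z : analytic_at g z -> analytic_at (fun w => c * g w) z.
Proof.
move=> /analyticP[a [r r0 ha]]; apply/analyticP.
exists (fun k => c * a k); exists r; [exact: r0|move=> w /ha ga].
apply: (eq_cvgc (@cvgcZ c _ _ ga)) => n.
by rewrite mulr_sumr; apply: eq_bigr => k _; rewrite mulrA.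
Qed.

Lemma analyticB g d z : analytic_at g z -> analytic_at d z ->
  analytic_at (fun w => g w - d w) z.
Proof.
move=> ag ad; apply: (analytic_ext ltr01 _ (analyticD ag (@analyticZ (-1) _ _ ad))).
by move=> w _; rewrite mulN1r.
Qed.

Lemma analytic_mulX g z : analytic_at g z -> analytic_at (fun w => w * g w) z.
Proof.
move=> /analyticP[a [r r0 ha]]; apply/analyticP.
exists (fun k => z * a k + (if k is k'.+1 then a k' else 0)); exists r; [exact: r0|move=> w /ha ga].
apply: cvgcS.
have -> : w * g w = z * g w + (w - z) * g w by ring.
apply: (eq_cvgc (cvgcD (@cvgcZ z _ _ (cvgcS' ga)) (@cvgcZ (w - z) _ _ ga))) => n.
under [RHS]eq_bigr do rewrite mulrDl -mulrA; rewrite big_split -mulr_sumr /=; congr (_ + _).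
rewrite big_ord_recl mul0r add0r mulr_sumr; apply: eq_bigr => k _.
by rewrite lift0 exprS; ring.
Qed.

Lemma normc_gt0 z : (0 < normc z) = (z != 0).
Proof. by rewrite lt_neqAle normc_ge0 andbT eq_sym normc_eq0. Qed.

Lemma analytic_inv z0 z : z != z0 -> analytic_at (fun w => (w - z0)^-1) z.
Proof.
rewrite -subr_eq0 => zz0; have n0 : 0 < normc (z - z0) by rewrite normc_gt0.
apply/analyticP; exists (fun k => (- 1) ^+ k / (z - z0) ^+ k.+1), (normc (z - z0)); [exact: n0|move=> w wz].
set q := - ((w - z) / (z - z0)).
have nq : normc q < 1 by rewrite normcN normcM ComplexField.Normc.normcV ltr_pdivrMr// mul1r.
have wz0 : w - z0 != 0.
  apply: contraTneq wz => h; rewrite -leNgt.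
  have -> : w - z = (w - z0) - (z - z0) by ring.
  by rewrite h sub0r normcN.
apply: (cvgc_bound (B := fun n => normc (w - z0)^-1 * normc q ^+ n)) => [n|].
  rewrite -normcX -normcM (_ : _ - _ = (w - z0)^-1 * q ^+ n)//.
  elim: n => [|n IH]; first by rewrite big_ord0 expr0 mulr1 subr0.
  rewrite big_ord_recr /= opprD addrA IH /q !exprS (exprNn (_ / _)) expr_div_n.
  have := expf_neq0 n zz0; move: ((z - z0) ^+ n) ((w - z) ^+ n) ((-1) ^+ n) => A B D A0.
  have -> : w - z0 = (w - z) + (z - z0) by ring.
  have : (w - z) + (z - z0) != 0 by rewrite (_ : _ + _ = w - z0)//; ring.
  move: (w - z) (z - z0) zz0 => p r r0 pr0.
  by field; rewrite A0 pr0 r0.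
rewrite -[X in _ --> X](mulr0 (normc (w - z0)^-1)); apply: cvgMr.
by apply: cvg_expr; rewrite ger0_norm ?normc_ge0.
Qed.

End Analytic.

Section IdentityTheorem.
Variable R : realType.
Implicit Types (d g : R[i] -> R[i]) (z w h : R[i]).

(* The lowest nonzero coefficient [a m] would satisfy [|a m| = O(|h|)] along zeros [z + h]. *)
Lemma analytic_zeros d z : analytic_at d z ->
  (forall e : R, 0 < e -> exists w, [/\ w != z, normc (w - z) < e & d w = 0]) ->
  exists2 r : R, 0 < r & forall w, normc (w - z) < r -> d w = 0.
Proof.
move=> /analyticP[a [r r0 ha]] hz.
suff a0 k : a k = 0.
  exists r; [exact: r0|move=> w /ha].
  rewrite (_ : (fun n => _) = fun=> 0); last first.
    by apply/funext => n; rewrite big1// => k _; rewrite a0 mul0r.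
  move=> h; apply/esym; apply: (cvg_unique _ (cvg_cst _) h).
  exact: norm_hausdorff.
apply: contrapT => ak; have : exists k, a k != 0 by exists k; apply/eqP.
move=> /ex_minnP[m am mmin] {k ak}.
have a0 k : (k < m)%N -> a k = 0.
  by move=> km; apply/eqP; apply: contraTT km => /mmin; rewrite -leqNgt.
pose rho := r / 2; have rho0 : 0 < rho by rewrite divr_gt0.
(* At distance [rho] two consecutive late partial sums are both within 1 of the limit, so their
   difference is at most 2; the earlier terms are bounded by their sum [M]. *)
have [B B0 hB] : exists2 B : R, 0 <= B & forall k, normc (a k) * rho ^+ k <= B.
  have /ha/cvgc0P hl : normc ((z + Complex rho 0) - z) < r.
    by rewrite addrC addKr normc_real gtr0_norm// ltr_pdivrMr// mulr_natr mulr2n ltrDl.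
  move/cvgr0Pnorm_lt: hl => /(_ 1 ltr01)[N _ hN].
  pose M := \sum_(k < N.+1) normc (a k) * rho ^+ k.
  have M0 : 0 <= M by apply: sumr_ge0 => k _; rewrite mulr_ge0 ?normc_ge0// exprn_ge0// ltW.
  exists (M + 2) => [|k]; first by rewrite addr_ge0.
  case: (ltnP k N) => kN.
    apply: (@le_trans _ _ M); last by rewrite lerDl.
    have kN' : (k < N.+1)%N by rewrite ltnW.
    rewrite /M (bigD1 (Ordinal kN')) //= lerDl; apply: sumr_ge0 => j _.
    by rewrite mulr_ge0 ?normc_ge0// exprn_ge0// ltW.
  apply: (@le_trans _ _ 2); last by rewrite lerDr.
  have h1 := hN k kN; have h2 := hN k.+1 (leqW kN).
  move: h1 h2; rewrite /= !ger0_norm ?normc_ge0//.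
  rewrite big_ord_recr /= addrAC subrr add0r.
  set S := \sum_(i < k) _; set T := a k * _ => h1 h2.
  have -> : normc (a k) * rho ^+ k = normc T.
    by rewrite /T normcM normcX normc_real gtr0_norm.
  have -> : T = (d (z + Complex rho 0) - S) - (d (z + Complex rho 0) - (S + T)) by ring.
  apply: le_trans (normcD _ _) _; rewrite normcN.
  by move: h1 h2; lra.
pose K := 2 * B / rho ^+ m.+1.
have K0 : 0 <= K by rewrite divr_ge0 ?mulr_ge0// exprn_ge0// ltW.
have main h : h != 0 -> normc h < rho / 2 -> d (z + h) = 0 -> normc (a m) <= K * normc h.
  move=> h0 hr dh.
  have nh : 0 < normc h by rewrite normc_gt0.
  have /ha/cvgc0P : normc ((z + h) - z) < r.
    by rewrite addrC addKr; apply: lt_trans hr _; rewrite /rho; lra.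
  rewrite dh addrC addKr => hl.
  pose q := normc h / rho.
  have q0 : 0 <= q by rewrite divr_ge0 ?normc_ge0// ltW.
  have q2 : q <= 2^-1 by rewrite ler_pdivrMr//; lra.
  (* Terms decay like [q ^ k] with [q <= 1/2]; the subtracted [2 * q ^ (n + m.+1)] leaves room for
     the next term in the induction. *)
  have tail n : normc (\sum_(k < n + m.+1) a k * h ^+ k - a m * h ^+ m) <= B * (2 * q ^+ m.+1 - 2 * q ^+ (n + m.+1)).
    elim: n => [|n IH].
      rewrite add0n big_ord_recr /= addrK big1 ?ComplexField.Normc.normc0.
        by rewrite subrr mulr0.
      by move=> i _; rewrite a0 ?mul0r.
    rewrite addSn big_ord_recr /= addrAC; apply: le_trans (normcD _ _) _.
    have h1 : normc (a (n + m.+1)%N * h ^+ (n + m.+1)) <= B * q ^+ (n + m.+1).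
      rewrite normcM normcX /q expr_div_n mulrA ler_pdivlMr ?exprn_gt0//.
      rewrite mulrAC; apply: ler_wpM2r; [by rewrite exprn_ge0 ?normc_ge0|exact: hB].
    apply: le_trans (lerD IH h1) _; rewrite -mulrDr; apply: ler_wpM2l => //.
    rewrite (exprS q (n + m.+1)).
    have Q0 : 0 <= q ^+ (n + m.+1) by exact: exprn_ge0.
    have := ler_wpM2r Q0 q2; lra.
  have bnd : normc (a m * h ^+ m) <= 2 * B * q ^+ m.+1.
    apply/ler_addgt0Pr => e e0; move/cvgr0Pnorm_lt: hl => /(_ _ e0)[N _ hN].
    have := hN (N + m.+1)%N (leq_addr _ _); rewrite /= ger0_norm ?normc_ge0// sub0r normcN => h1.
    have h2 := tail N.
    set S := \sum_(k < _) _ in h1 h2.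
    have -> : a m * h ^+ m = S - (S - a m * h ^+ m) by ring.
    apply: le_trans (normcD _ _) _; rewrite normcN.
    have : 0 <= B * (2 * q ^+ (N + m.+1)) by rewrite !mulr_ge0// exprn_ge0.
    by move: h1 h2; rewrite mulrBr; lra.
  move: bnd; rewrite normcM normcX /q expr_div_n exprS /K.
  have := exprn_gt0 m nh; move: (normc h ^+ m) => H H0.
  have := exprn_gt0 m.+1 rho0; move: (rho ^+ m.+1) => P P0.
  rewrite (_ : 2 * B * (normc h * H / P) = 2 * B / P * normc h * H); last by ring.
  by rewrite ler_pM2r.
have am0 : 0 < normc (a m) by rewrite normc_gt0.
(* For [|h| < e] one has [K * |h| < |a m|], against [main]; the [+ 1] keeps the quotient meaningful
   when [K = 0]. *)
pose e := Num.min (rho / 2) (normc (a m) / (K + 1)).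
have e0 : 0 < e by rewrite lt_min !divr_gt0// ltr_wpDl.
have [w [wz wze dw]] := hz e e0.
have : normc (a m) <= K * normc (w - z).
  apply: main; rewrite ?subr_eq0//.
    by apply: lt_le_trans wze _; rewrite ge_min lexx.
  by rewrite addrC subrK.
apply/negP; rewrite -ltNge.
have h1 : normc (w - z) < normc (a m) / (K + 1).
  by apply: lt_le_trans wze _; rewrite ge_min lexx orbT.
move: h1; rewrite ltr_pdivlMr ?ltr_wpDl// => h1.
by have := normc_ge0 (w - z); nra.
Qed.

(** The infimum of the abscissas to the right of which [d] vanishes on the line is a limit of zeros.
    Hence [d] vanishes on a disc around it, and an infimum above [x0] could be lowered. *)
Lemma identity_line d (x0 y : R) :
  (forall x, x0 <= x -> analytic_at d (Complex x y)) ->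
  (forall z, 1 < Rez z -> d z = 0) -> d (Complex x0 y) = 0.
Proof.
move=> an d1.
pose E := [set x | x0 <= x /\ forall x', x <= x' -> d (Complex x' y) = 0].
have E0 : E !=set0.
  exists (Num.max x0 2); split=> [|x']; first by rewrite le_max lexx.
  by rewrite ge_max => /andP[_ h]; apply: d1 => /=; lra.
have Elb : has_lbound E by exists x0 => x [].
have hiE : has_inf E by [].
pose m := inf E.
have x0m : x0 <= m by apply: lb_le_inf => // x [].
have above x : m < x -> d (Complex x y) = 0.
  move=> mx; have [e [_ he] ex] := inf_lt E0 mx.
  by apply: he; exact: ltW.
have [||r r0 hr] := @analytic_zeros d (Complex m y).
- exact: an.
- move=> e e0; exists (Complex (m + e / 2) y); split.
  + by rewrite eq_complex /= eqxx andbT -subr_eq0 addrC addKr gt_eqF// divr_gt0.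
  + have -> : Complex (m + e / 2) y - Complex m y = Complex (e / 2) 0.
      by apply: complexP => /=; ring.
    rewrite normc_real gtr0_norm ?divr_gt0//; lra.
  + by apply: above; rewrite ltrDl divr_gt0.
have near x : `|x - m| < r -> d (Complex x y) = 0.
  move=> xm; apply: hr.
  have -> : Complex x y - Complex m y = Complex (x - m) 0 by apply: complexP => /=; ring.
  by rewrite normc_real.
case: (ltP x0 m) => [x0m'|mx0]; last first.
  have -> : x0 = m by apply/eqP; rewrite eq_le x0m mx0.
  by apply: near; rewrite subrr normr0.
pose m' := Num.max x0 (m - r / 2).
have : E m'.
  split=> [|x' m'x']; first by rewrite le_max lexx.
  case: (ltP m x') => [/above//|x'm]; apply: near.
  rewrite ler0_norm ?subr_le0// opprB.
  by move: m'x'; rewrite ge_max => /andP[_ h]; lra.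
move=> /(ge_inf Elb); rewrite -/m leNgt; case/negP.
by rewrite gt_max x0m' /=; lra.
Qed.

(* The pole at [1] is avoided by approaching real points vertically. *)
Lemma continuation_unique (F : fieldExtType rat) (s1 s2 : R) g1 g2 z :
  dedekind_continuation F s1 g1 -> dedekind_continuation F s2 g2 ->
  s1 < Rez z -> s2 < Rez z -> z != 1 -> g1 z = g2 z.
Proof.
move=> [an1 e1] [an2 e2] s1z s2z z1.
pose d w := g1 w - g2 w.
have an w : s1 < Rez w -> s2 < Rez w -> w != 1 -> analytic_at d w.
  by move=> w1 w2 w3; apply: analyticB; [exact: an1|exact: an2].
have d1 w : 1 < Rez w -> d w = 0 by move=> w1; rewrite /d e1// e2// subrr.
have ne1 (x y : R) : y != 0 -> Complex x y != 1.
  by apply: contra => /eqP[_ ->].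
have line (y : R) : y != 0 -> d (Complex (Rez z) y) = 0.
  move=> y0; apply: identity_line => // x xz; apply: an; rewrite /= ?ne1//.
    exact: lt_le_trans xz.
  exact: lt_le_trans xz.
suff : d z = 0 by rewrite /d => /eqP; rewrite subr_eq0 => /eqP.
have [y0|y0] := eqVneq (Imz z) 0; last first.
  by have := line _ y0; case: z y0 {s1z s2z z1 line}.
have zE : z = Complex (Rez z) 0 by apply: complexP.
have [||r r0 hr] := @analytic_zeros d z; first exact: an.
  move=> e e0; exists (Complex (Rez z) (e / 2)); split.
  - by rewrite zE eq_complex /= eqxx /= gt_eqF// divr_gt0.
  - rewrite {2}zE; have -> : Complex (Rez z) (e / 2) - Complex (Rez z) 0 = Complex 0 (e / 2).
      by apply: complexP => /=; ring.
    rewrite /= expr0n /= add0r sqrtr_sqr gtr0_norm ?divr_gt0//; lra.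
  - by apply: line; rewrite gt_eqF// divr_gt0.
by apply: hr; rewrite subrr ComplexField.Normc.normc0.
Qed.

End IdentityTheorem.

(** * The zeta function as a Laplace transform *)

Section Laplace.
Variable R : realType.
Notation mu := (@lebesgue_measure R).
Notation halfline := (`[0%R, +oo[%classic : set R).
Implicit Types (G K : R -> R) (z w : R[i]).

Lemma ler_eq (x y : R) : x = y -> x <= y. Proof. by move=> ->. Qed.

Lemma mem_halfline (u : R) : halfline u -> 0 <= u.
Proof. by rewrite /= in_itv /= andbT. Qed.

Lemma exprn_le_expR (x : R) n : 0 <= x -> x ^+ n / n`!%:R <= expR x.
Proof.
case: n => [|n] x0; first by rewrite expr0 fact0 divr1 -[leLHS]expR0 ler_expR.
by apply: le_trans (expR_ge1Dxn n x0); rewrite lerDr.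
Qed.

Definition laplace G z : R[i] :=
  cint halfline (fun u => Complex (G u) 0 * cexp (- z * Complex u 0)).

Lemma cmeasurableM (D : set R) (f g : R -> R[i]) : cmeasurable D f -> cmeasurable D g ->
  cmeasurable D (fun u => f u * g u).
Proof.
move=> [fr fi] [gr gi]; split.
  by under eq_fun do rewrite cReM; apply: measurable_funB; apply: measurable_funM.
by under eq_fun do rewrite cImM; apply: measurable_funD; apply: measurable_funM.
Qed.

Lemma cmeasurable_cexp (D : set R) z : measurable D ->
  cmeasurable D (fun u : R => cexp (- z * Complex u 0)).
Proof.
move=> mD; have [cr ci] := cderive_continuous (cderive_cexp z).
by split; apply: measurable_funTS; exact: continuous_measurable_fun.
Qed.

Lemma cmeasurable_real (D : set R) G : measurable_fun D G ->
  cmeasurable D (fun u => Complex (G u) 0).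
Proof. by move=> mG; split => //; exact: measurable_cst. Qed.

Lemma Re_expo z (u : R) : Rez (- z * Complex u 0) = - (Rez z * u).
Proof. by rewrite cReM cReN /= mulr0 subr0 mulNr. Qed.

Lemma cintegrable_laplace G (A a : R) z : measurable_fun halfline G ->
  (forall u, 0 <= u -> `|G u| <= A * expR (a * u)) -> a < Rez z ->
  cintegrable halfline (fun u => Complex (G u) 0 * cexp (- z * Complex u 0)).
Proof.
move=> mG GA az.
apply: (@cintegrable_dom _ _ _ (fun u => A * expR (- ((Rez z - a) * u)))).
- exact: measurable_itv.
- by apply: cmeasurableM; [exact: cmeasurable_real|exact: cmeasurable_cexp].
- move=> u /mem_halfline u0.
  rewrite normcM normc_real normc_cexp Re_expo.
  apply: le_trans (ler_wpM2r (expR_ge0 _) (GA u u0)) _.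
  by rewrite -mulrA -expRD; apply: ler_eq; congr (_ * expR _); ring.
- by apply: RintegrableZ => //; apply: integrable_expRN; rewrite subr_gt0.
Qed.

Lemma cexp_shift z w (u : R) :
  cexp (- w * Complex u 0) = cexp (- z * Complex u 0) * cexp (- (w - z) * Complex u 0).
Proof. by rewrite -cexpD; congr cexp; ring. Qed.

(** Expanding [exp (- (w - z) * u)] in powers of [w - z] under the integral yields as coefficients
    the transforms of [K u * (- u) ^ k / k!]. *)
Lemma analytic_laplace K (C c : R) z : measurable_fun halfline K ->
  (forall u, 0 <= u -> `|K u| <= C * expR (c * u)) -> c < Rez z ->
  analytic_at (laplace K) z.
Proof.
move=> mK KC cz.
have C0 : 0 <= C by have := le_trans (normr_ge0 _) (KC 0 (lexx _)); rewrite mulr0 expR0 mulr1.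
(* The Taylor remainder costs [exp (4 * r * u) * exp (r * u)]; out of [Rez z - c = 10 * r] there
   remains the decay [exp (- 5 * r * u)]. *)
have [r rE] : exists r, r = (Rez z - c) / 10 by eexists.
have r0 : 0 < r by rewrite rE divr_gt0 ?subr_gt0.
pose G k u := K u * ((- u) ^+ k / k`!%:R).
have mG k : measurable_fun halfline (G k).
  apply: measurable_funM => //; apply: measurable_funM => //.
  by apply: measurable_funX; apply: measurable_funTS; exact: oppr_measurable.
have fact0' k : 0 < (k`!%:R : R) by rewrite ltr0n fact_gt0.
have GC k u : 0 <= u -> `|G k u| <= C / r ^+ k * expR ((c + r) * u).
  move=> u0; rewrite normrM mulrDl expRD.
  have -> : C / r ^+ k * (expR (c * u) * expR (r * u)) = (C * expR (c * u)) * (expR (r * u) / r ^+ k) by ring.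
  apply: ler_pM; rewrite ?normr_ge0//; first exact: KC.
  rewrite ler_pdivlMr ?exprn_gt0//.
  have -> : `|(- u) ^+ k / k`!%:R| = u ^+ k / k`!%:R.
    by rewrite normrM normrX normrN (ger0_norm u0) ger0_norm// invr_ge0 ltW.
  have -> : u ^+ k / k`!%:R * r ^+ k = (r * u) ^+ k / k`!%:R.
    by rewrite exprMn mulrAC (mulrC (r ^+ k)).
  by apply: exprn_le_expR; rewrite mulr_ge0// ltW.
have cr_z : c + r < Rez z by rewrite rE; lra.
have iG k := cintegrable_laplace (mG k) (GC k) cr_z.
apply/analyticP; exists (fun k => laplace (G k) z); exists r; [exact: r0|move=> w wz].
set h := w - z in wz *.
have wc : c < Rez w.
  have := le_lt_trans (Re_le_normc _) wz; rewrite cReD cReN ltr_norml => /andP[+ _].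
  by move: r0; rewrite rE; lra.
have iK := cintegrable_laplace mK KC wc.
have ih k : cintegrable halfline (fun u => h ^+ k * (Complex (G k u) 0 * cexp (- z * Complex u 0))).
  exact: cintegrableZ.
pose J := \int[mu]_(u in halfline) expR (- (5 * r * u)).
have iE : mu.-integrable halfline (EFin \o (fun u => expR (- (5 * r * u)))).
  by apply: integrable_expRN; rewrite mulr_gt0.
apply: (cvgc_bound (B := fun n => (4 * C * J) * 2^-1 ^+ n)); last first.
  rewrite -[X in _ --> X](mulr0 (4 * C * J)); apply: cvgMr.
  by apply: cvg_expr; rewrite ger0_norm ?invr_ge0// invf_lt1// ltr1n.
move=> n.
have -> : \sum_(k < n) laplace (G k) z * h ^+ k =
    cint halfline (fun u => \sum_(k < n) h ^+ k * (Complex (G k u) 0 * cexp (- z * Complex u 0))).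
  rewrite (@cint_sum _ _ _ _ (fun (k : 'I_n) u => h ^+ k * (Complex (G k u) 0 * cexp (- z * Complex u 0))))//.
  by apply: eq_bigr => k _; rewrite cintZ// mulrC.
rewrite -cintB//; last first.
  exact: (@cintegrable_sum _ _ _ _ (fun (k : 'I_n) u => h ^+ k * (Complex (G k u) 0 * cexp (- z * Complex u 0)))).
apply: (le_trans (@normc_cint_le _ _ _ (fun u => (2 * C * 2^-1 ^+ n) * expR (- (5 * r * u))) _ _ _ _)).
- by [].
- apply: cintegrableB => //.
  exact: (@cintegrable_sum _ _ _ _ (fun (k : 'I_n) u => h ^+ k * (Complex (G k u) 0 * cexp (- z * Complex u 0)))).
- move=> u /mem_halfline u0.
  have -> : Complex (K u) 0 * cexp (- w * Complex u 0) -
      \sum_(k < n) h ^+ k * (Complex (G k u) 0 * cexp (- z * Complex u 0)) =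
    Complex (K u) 0 * cexp (- z * Complex u 0) *
      (cexp (- h * Complex u 0) - \sum_(k < n) (- h * Complex u 0) ^+ k / k`!%:R).
    rewrite mulrBr (cexp_shift z w) mulrA; congr (_ - _).
    rewrite mulr_sumr; apply: eq_bigr => k _.
    have -> : Complex (G k u) 0 = Complex (K u) 0 * (- Complex u 0) ^+ k / k`!%:R.
      have -> : - Complex u 0 = ((- u)%:C)%C by apply: complexP; rewrite /= ?oppr0.
      rewrite natrcV -[X in X * _ * _]/((K u)%:C)%C -[X in _ = _ * X]/((k`!%:R^-1)%:C)%C.
      by rewrite -rmorphXn -!rmorphM /G mulrA.
    have -> : (- h * Complex u 0) ^+ k = h ^+ k * (- Complex u 0) ^+ k.
      by rewrite -exprMn mulNr mulrN.
    move: (cexp _) (h ^+ k) (_ ^+ k) (Complex (K u) 0) (_^-1) => e1 e2 e3 e4 e5.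
    ring.
  rewrite !normcM normc_real normc_cexp Re_expo.
  have h1 := cexp_taylor (- h * Complex u 0) n.
  have nh : normc (- h * Complex u 0) = normc h * u.
    by rewrite normcM normcN normc_real ger0_norm.
  rewrite nh in h1.
  (* As [|h| < r], replacing [2 * |h|] by [4 * r] gains the factor [2 ^ - n] that sends the
     remainder to 0. *)
  have h2 : (2 * (normc h * u)) ^+ n / n`!%:R <= 2^-1 ^+ n * expR (4 * r * u).
    apply: (@le_trans _ _ (2^-1 ^+ n * ((4 * r * u) ^+ n / n`!%:R))).
      rewrite [leRHS]mulrA -exprMn ler_wpM2r ?invr_ge0 ?(ltW (fact0' n))//.
      apply: lerXn2r; rewrite ?nnegrE ?mulr_ge0 ?normc_ge0 ?invr_ge0 ?(ltW r0)//.
      by have := ler_wpM2r u0 (ltW wz); lra.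
    apply: ler_wpM2l; first by rewrite exprn_ge0 ?invr_ge0.
    by apply: exprn_le_expR; rewrite !mulr_ge0 ?(ltW r0).
  have h3 : expR (normc h * u) <= expR (r * u) by rewrite ler_expR ler_wpM2r// ltW.
  have h4 := KC u u0.
  apply: (@le_trans _ _ (C * expR (c * u) * expR (- (Rez z * u)) *
      (2 * (2^-1 ^+ n * expR (4 * r * u) * expR (r * u))))).
    apply: ler_pM; rewrite ?mulr_ge0 ?expR_ge0 ?normc_ge0//.
      by apply: ler_wpM2r; rewrite ?expR_ge0.
    apply: le_trans h1 _; apply: ler_wpM2l => //.
    apply: ler_pM; [|exact: expR_ge0|exact: h2|exact: h3].
    by rewrite divr_ge0 ?exprn_ge0// !mulr_ge0 ?normc_ge0.
  have -> : - (5 * r * u) = c * u + (- (Rez z * u)) + 4 * r * u + r * u by rewrite rE; field.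
  by rewrite !expRD; apply: ler_eq; ring.
- exact: RintegrableZ.
by rewrite RintegralZl// -/J; apply: ler_eq; ring.
Qed.

End Laplace.

(** * From an unordered Dirichlet sum to a Laplace transform *)

Section DirichletSum.
Variable R : realType.
Notation mu := (@lebesgue_measure R).
Notation halfline := (`[0%R, +oo[%classic : set R).

Definition ramp (n : nat) (u : R) : R := Num.max 0 (u - ln n%:R).

Lemma ramp_ge0 n u : 0 <= ramp n u.
Proof. by rewrite le_max lexx. Qed.

Lemma continuous_ramp n : continuous (ramp n).
Proof.
move=> u; have c1 : {for u, continuous (fun u : R => u - ln n%:R)}.
  by apply: cvgB; [exact: cvg_id|exact: cvg_cst].
have -> : ramp n = fun u => 2^-1 * ((u - ln n%:R) + `|u - ln n%:R|).
  apply/funext => v; rewrite /ramp; case: (leP 0 (v - ln n%:R)) => h.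
    by rewrite ger0_norm//; field.
  by rewrite ltr0_norm// subrr mulr0.
by apply: cvgMr; apply: cvgD; [exact: c1|exact: cvg_norm c1].
Qed.

Lemma ramp_eq0 n u : u <= ln n%:R -> ramp n u = 0.
Proof. by move=> h; apply/max_idPl; rewrite subr_le0. Qed.

Lemma ramp_le n u : (0 < n)%N -> 0 <= u -> ramp n u <= u.
Proof.
move=> n0 u0; rewrite ge_max u0 /= lerBlDr lerDl; apply: ln_ge0.
by rewrite ler1n.
Qed.

Lemma laplace_ramp n (s : R[i]) : (0 < n)%N -> 0 < Rez s ->
  laplace (ramp n) s = natcpow n (- s) / s ^+ 2.
Proof.
move=> n0 s0; have sN0 : s != 0 by apply: contraTneq s0 => ->; rewrite ltxx.
pose a : R := ln n%:R; have a0 : 0 <= a by apply: ln_ge0; rewrite ler1n.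
have -> : natcpow n (- s) / s ^+ 2 = cint `[a, +oo[ (affexp (- Complex a 0) 1 s).
  rewrite cint_affexp// natcpowE (_ : Complex (ln _) 0 * - s = - s * Complex a 0); last exact: mulrC.
  by move: (cexp _) => E; move: (Complex a 0) => z; field.
have restr (h : R -> R) (h' : R -> R) : (forall u, a <= u -> h u = h' u) ->
    (forall u, u < a -> h u = 0) ->
    \int[mu]_(u in halfline) h u = \int[mu]_(u in `[a, +oo[) h' u.
  move=> hh h0; rewrite Rintegral_mkcond [RHS]Rintegral_mkcond; apply: eq_Rintegral => u _.
  rewrite !patchE; case: ifPn => [|]; rewrite !(inE, notin_setE) /= !in_itv /= !andbT.
    move=> u0; case: ifPn => [|]; rewrite !(inE, notin_setE) /= in_itv /= andbT; first exact: hh.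
    by move=> /negP; rewrite -ltNge => /h0.
  move=> /negP; rewrite -ltNge => u0; case: ifPn => //; rewrite inE /= in_itv /= andbT => au.
  by have := le_lt_trans (le_trans a0 au) u0; rewrite ltxx.
have r1 u : a <= u -> ramp n u = u - a by move=> au; apply/max_idPr; rewrite subr_ge0.
have r0 u : u < a -> ramp n u = 0 by move=> /ltW; exact: ramp_eq0.
have E u : affexp (- Complex a 0) 1 s u = Complex (u - a) 0 * cexp (- s * Complex u 0).
  rewrite /affexp mul1r; congr (_ * _); apply: complexP => /=; ring.
rewrite /laplace /cint; congr Complex; apply: restr => u ua; rewrite ?E.
- by rewrite r1.
- by rewrite r0// cReM /= !mul0r subr0.
- by rewrite r1.
- by rewrite r0// cImM /= !mul0r addr0.
Qed.

(** In the application [T] is the type of nonzero ideals, [nu] the norm, and [J M] the finite set of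
    ideals of norm below [M]. *)
Variables (T : choiceType) (nu : T -> nat) (J : nat -> {fset T}).
Hypotheses (nu_gt0 : forall I, (0 < nu I)%N) (JP : forall M I, (I \in J M) = (nu I < M)%N).

Definition rampsum (S : {fset T}) (u : R) : R := \sum_(I <- S) ramp (nu I) u.

Definition count_log (u : R) : R := rampsum (J (Num.truncn (expR u)).+2) u.

Lemma rampsum_ge0 S u : 0 <= rampsum S u.
Proof. by apply: sumr_ge0 => I _; exact: ramp_ge0. Qed.

Lemma continuous_rampsum S : continuous (rampsum S).
Proof.
move=> u; rewrite /rampsum; elim: (enum_fset S) => [|I r IH].
  by under eq_fun do rewrite big_nil; exact: cvg_cst.
under eq_fun do rewrite big_cons.
by apply: cvgD; [exact: continuous_ramp|exact: IH].
Qed.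

Lemma rampsum_subset S S' u : (S `<=` S')%fset -> rampsum S u <= rampsum S' u.
Proof.
move=> SS'; rewrite /rampsum (big_fsetID _ (mem S) S') /=.
rewrite (_ : [fset x in S' | x \in S]%fset = S); last first.
  by apply/fsetP => x; rewrite !inE /= andbC; case: (boolP (x \in S)) => //= /(fsubsetP SS').
by rewrite lerDl; apply: sumr_ge0 => I _; exact: ramp_ge0.
Qed.

(* Only the indices with [nu I < exp u] contribute at [u]. *)
Lemma rampsum_trunc S S' u :
  (forall I, ln (nu I)%:R < u -> (I \in S) = (I \in S')) -> rampsum S u = rampsum S' u.
Proof.
have half (S1 : {fset T}) :
    rampsum S1 u = rampsum [fset I in S1 | ln (nu I)%:R < u]%fset u.
  rewrite /rampsum big_fset /= (bigID (fun I => ln (nu I)%:R < u)) /=.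
  rewrite [X in _ + X]big1 ?addr0// => I; rewrite -leNgt; exact: ramp_eq0.
move=> h; rewrite half (half S'); congr rampsum; apply/fsetP => I; rewrite !inE.
by case: (boolP (ln (nu I)%:R < u)) => [/h ->|]; rewrite ?andbF.
Qed.

Lemma count_logE M u : (expR u <= M%:R) -> count_log u = rampsum (J M) u.
Proof.
move=> uM; apply: rampsum_trunc => I Iu; rewrite !JP.
have nI : (nu I)%:R < expR u.
  by rewrite -ltr_expR lnK ?posrE ?ltr0n// in Iu.
have h1 := lt_le_trans nI uM; rewrite ltr_nat in h1; rewrite h1.
have := lt_trans nI (truncnS_gt (expR u)); rewrite ltr_nat => h2.
by rewrite ltnW// ltnS ltnW.
Qed.

Lemma continuous_count_log : continuous count_log.
Proof.
move=> u; pose M := (Num.truncn (expR (u + 1))).+1.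
have h v : v < u + 1 -> rampsum (J M) v = count_log v.
  move=> vu; rewrite (@count_logE M)//; apply: ltW.
  by apply: le_lt_trans (truncnS_gt (expR (u + 1))); rewrite ler_expR ltW.
have := @continuous_rampsum (J M) u; rewrite /continuous_at (h u) ?ltrDl// => hc.
apply: cvg_trans hc; apply: near_eq_cvg.
near=> v; apply: h; near: v.
by apply: lt_nbhsl; rewrite ltrDl.
Unshelve. all: end_near. Qed.

Lemma count_log_ge0 u : 0 <= count_log u.
Proof. exact: rampsum_ge0. Qed.

Lemma count_log_neg u : u <= 0 -> count_log u = 0.
Proof.
move=> u0; rewrite /count_log /rampsum big1// => I _; apply: ramp_eq0.
by apply: le_trans u0 _; apply: ln_ge0; rewrite ler1n.
Qed.

Variables (B : R).
Hypothesis count_logB : forall u, 0 <= u -> count_log u <= B * expR u.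

Let B0 : 0 <= B.
Proof. by have := le_trans (count_log_ge0 0) (count_logB (lexx _)); rewrite expR0 mulr1. Qed.

Lemma rampsum_diff S M u : (J M `<=` S)%fset -> (0 < M)%N -> 0 <= u ->
  0 <= count_log u - rampsum S u /\ (u <= ln M%:R -> count_log u = rampsum S u).
Proof.
move=> JS M0 u0; split; last first.
  move=> uM; rewrite (@count_logE M); last by rewrite -[leRHS]lnK ?posrE ?ltr0n// ler_expR.
  apply: rampsum_trunc => I /lt_le_trans/(_ uM) h.
  have hI : I \in J M by rewrite JP -(ltr_nat R) -ltr_ln ?posrE ?ltr0n.
  by rewrite hI (fsubsetP JS).
(* [M'] exceeds [exp u] and all values of [nu] on [S], so that [J M'] computes [count_log u] and
   contains [S]. *)
pose M' := maxn (Num.truncn (expR u)).+1 (\max_(I <- S) (nu I).+1).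
rewrite subr_ge0 (@count_logE M').
  apply: rampsum_subset; apply/fsubsetP => I IS; rewrite JP /M' leq_max; apply/orP; right.
  by rewrite (big_rem I) //= leq_max leqnn.
apply: le_trans (ltW (truncnS_gt (expR u))) _.
by rewrite ler_nat leq_max leqnn.
Qed.

Lemma normc_laplace_le (G : R -> R) (A a : R) (s : R[i]) : measurable_fun halfline G -> 0 <= A ->
  (forall u, 0 <= u -> `|G u| <= A * expR (a * u)) -> a < Rez s ->
  normc (laplace G s) <= 2 * (A * \int[mu]_(u in halfline) expR (- ((Rez s - a) * u))).
Proof.
move=> mG A0 GA as_.
have ie : mu.-integrable halfline (EFin \o (fun u => expR (- ((Rez s - a) * u)))).
  by apply: integrable_expRN; rewrite subr_gt0.
rewrite -RintegralZl//; apply: normc_cint_le => //.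
- exact: cintegrable_laplace GA as_.
- move=> u /mem_halfline u0; rewrite normcM normc_real normc_cexp Re_expo.
  apply: le_trans (ler_wpM2r (expR_ge0 _) (GA u u0)) _.
  by rewrite -mulrA -expRD; apply: ler_eq; congr (_ * expR _); ring.
- exact: RintegrableZ.
Qed.

Lemma mrampsum S : measurable_fun halfline (rampsum S).
Proof. by apply: measurable_funTS; apply: continuous_measurable_fun; exact: continuous_rampsum. Qed.

Lemma mcount_log : measurable_fun halfline count_log.
Proof. by apply: measurable_funTS; apply: continuous_measurable_fun; exact: continuous_count_log. Qed.

Lemma laplaceB (G H : R -> R) (A a A' : R) (s : R[i]) : measurable_fun halfline G -> measurable_fun halfline H ->
  (forall u, 0 <= u -> `|G u| <= A * expR (a * u)) ->
  (forall u, 0 <= u -> `|H u| <= A' * expR (a * u)) -> a < Rez s ->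
  laplace (fun u => G u - H u) s = laplace G s - laplace H s.
Proof.
move=> mG mH GA HA as_.
rewrite /laplace -cintB//; [|exact: cintegrable_laplace GA as_|exact: cintegrable_laplace HA as_].
apply: eq_cint => u _; rewrite -mulrBl; congr (_ * _).
by apply: complexP; rewrite /= ?subrr.
Qed.

Lemma laplace_rampsum S (s : R[i]) : 1 < Rez s ->
  laplace (rampsum S) s = \sum_(I <- S) natcpow (nu I) (- s) / s ^+ 2.
Proof.
move=> s1; have s0 : 0 < Rez s by apply: lt_trans s1.
rewrite (eq_bigr (fun I => laplace (ramp (nu I)) s)); last by move=> I _; rewrite laplace_ramp.
rewrite /laplace -cint_sum//; last first.
  move=> I; apply: (@cintegrable_laplace _ _ 1 1) => //.
    by apply: measurable_funTS; apply: continuous_measurable_fun; exact: continuous_ramp.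
  move=> u u0; rewrite mul1r mul1r ger0_norm ?ramp_ge0//.
  by apply: le_trans (ramp_le _ u0) _ => //; apply: le_trans (expR_ge1Dx _); rewrite lerDr.
apply: eq_cint => u _; rewrite -mulr_suml; congr (_ * _).
apply: complexP; first by rewrite cRe_sum.
by rewrite cIm_sum big1.
Qed.

(** If [S] contains [J M], the part of [count_log] missing from [S] lives beyond [ln M], where
    [exp u <= M ^ - dl * exp ((1 + dl) * u)]. Its transform is therefore small uniformly in [S],
    which is convergence of the unordered sum. *)
Lemma dirichlet_sum (s : R[i]) : 1 < Rez s ->
  summability.sum (fun I : T => natcpow (nu I) (- s) : R[i]^o) = s ^+ 2 * laplace count_log s.
Proof.
move=> s1.
have FT := @summability.totally_filter T.
suff cv : summability.partial_sum (fun I : T => natcpow (nu I) (- s) : R[i]^o) @ @summability.totally T -->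
    (s ^+ 2 * laplace count_log s : R[i]^o).
  have h := @cvg_lim _ (@norm_hausdorff _ _) _ _ FT _ _ cv.
  by rewrite /summability.sum h.
have s0 : 0 < Rez s by apply: lt_trans s1.
have sN0 : s != 0 by apply: contraTneq s0 => ->; rewrite ltxx.
(* Half of the room to the right of 1 buys the gain [M ^ - dl], the other half the convergence of
   the integral. *)
pose dl := (Rez s - 1) / 2; have dl0 : 0 < dl by rewrite divr_gt0 ?subr_gt0.
pose c0 := \int[mu]_(u in halfline) expR (- ((Rez s - (1 + dl)) * u)).
have c00 : 0 <= c0 by apply: Rintegral_ge0 => u _; exact: expR_ge0.
apply: (@cvgcP R _ _ FT _ _).2 => e e0.
pose K := normc s ^+ 2 * (2 * (B * c0)).
have K0 : 0 <= K by rewrite !mulr_ge0 ?exprn_ge0 ?normc_ge0.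
have [M M0 hM] : exists2 M : nat, (0 < M)%N & K * expR (- (dl * ln M%:R)) < e.
  pose y := ln ((K + 1) / e) / dl.
  exists (Num.truncn (expR y)).+1 => //.
  set M := (_).+1.
  have h1 : y < ln M%:R.
    by rewrite -ltr_expR lnK ?posrE ?ltr0n//; exact: truncnS_gt.
  have h2 : expR (- (dl * ln M%:R)) <= e / (K + 1).
    have -> : e / (K + 1) = expR (- (dl * y)).
      rewrite /y [dl * _]mulrC divfK ?gt_eqF// expRN lnK ?invf_div// posrE divr_gt0//.
      by rewrite ltr_wpDl.
    by rewrite ler_expR lerN2 ler_pM2l// ltW.
  apply: le_lt_trans (ler_wpM2l K0 h2) _.
  by rewrite mulrA ltr_pdivrMr ?ltr_wpDl// mulrC ltr_pM2l// ltrDl.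
exists (J M) => // S /= JS.
rewrite (_ : summability.partial_sum _ S = \sum_(I <- S) natcpow (nu I) (- s)); last first.
  exact: (esym (@big_seq_fsetE _ 0 +%R _ S xpredT (fun I => natcpow (nu I) (- s)))).
have -> : \sum_(I <- S) natcpow (nu I) (- s) = s ^+ 2 * laplace (rampsum S) s.
  rewrite laplace_rampsum// mulr_sumr; apply: eq_bigr => I _.
  by rewrite mulrC divfK ?expf_neq0.
have cB u : 0 <= u -> `|count_log u| <= B * expR (1 * u).
  by move=> u0; rewrite mul1r ger0_norm ?count_log_ge0// count_logB.
have rB u : 0 <= u -> `|rampsum S u| <= B * expR (1 * u).
  move=> u0; rewrite mul1r ger0_norm ?rampsum_ge0//; apply: le_trans (count_logB u0).
  by rewrite -subr_ge0; have [] := rampsum_diff JS M0 u0.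
rewrite -mulrBr -(laplaceB mcount_log (@mrampsum S) cB rB s1) normcM normcX.
have dB u : 0 <= u -> `|count_log u - rampsum S u| <= (B * expR (- (dl * ln M%:R))) * expR ((1 + dl) * u).
  move=> u0; have [h1 h2] := rampsum_diff JS M0 u0.
  rewrite ger0_norm//; case: (leP u (ln M%:R)) => uM.
    by rewrite h2// subrr !mulr_ge0 ?expR_ge0.
  apply: (@le_trans _ _ (B * expR u)).
    by apply: le_trans (count_logB u0); rewrite gerBl rampsum_ge0.
  rewrite -mulrA -expRD; apply: ler_wpM2l => //; rewrite ler_expR.
  have : 0 <= dl * (u - ln M%:R) by rewrite mulr_ge0 ?subr_ge0 ?(ltW uM) ?(ltW dl0).
  by lra.
have md : measurable_fun halfline (fun u => count_log u - rampsum S u).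
  by apply: measurable_funB; [exact: mcount_log|exact: mrampsum].
have sdl : 1 + dl < Rez s by rewrite /dl; lra.
have A0 : 0 <= B * expR (- (dl * ln M%:R)) by rewrite mulr_ge0 ?expR_ge0.
apply: le_lt_trans (ler_wpM2l _ (normc_laplace_le md A0 dB sdl)) _.
  by rewrite exprn_ge0 ?normc_ge0.
rewrite -/c0; apply: le_lt_trans hM; apply: ler_eq; rewrite /K; ring.
Qed.

End DirichletSum.

(** * Numerical bounds for two logarithms *)

Section LogBounds.
Variable R : realType.

(** The difference vanishes at 1 and has derivative [(y - 1) ^ 2 / (y * (y + 1) ^ 2)]. *)
Lemma ln_ge_pade (x : R) : 1 <= x -> 2 * (x - 1) / (x + 1) <= ln x.
Proof.
move=> x1; pose f (y : R) : R := ln y - 2 * (y - 1) / (y + 1).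
have dV (y : R) : 0 < y -> is_derive y 1 (fun y : R => (y + 1)^-1) (- (y + 1) ^- 2).
  move=> y0; have d1 : is_derive y 1 (fun y : R => y + 1) 1 by derive_eq; ring.
  have y1 : y + 1 != 0 by rewrite gt_eqF// addr_gt0.
  have := @is_deriveV _ (fun y : R => y + 1) y 1 1 y1 d1.
  by rewrite /GRing.scale /= mulr1.
have df (y : R) : 0 < y -> is_derive y 1 f (y^-1 - (2 / (y + 1) - 2 * (y - 1) / (y + 1) ^+ 2)).
  move=> y0; have dl := is_derive1_ln y0.
  have d2 : is_derive y 1 (fun y : R => 2 * (y - 1)) 2 by derive_eq; ring.
  notypeclasses refine (is_derive_eq _ _).
    notypeclasses refine (is_deriveD_fun dl _); notypeclasses refine (is_deriveN_fun _).
    exact: (is_deriveM_fun d2 (dV y y0)).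
  rewrite /GRing.scale /=; ring.
have f1 : f 1 = 0 by rewrite /f ln1 subrr mulr0 mul0r subrr.
rewrite -subr_ge0 -/(f x) -f1.
apply: (@ger0_derive1_ndecr _ f 1 x) => //.
- by move=> y; rewrite in_itv /= => /andP[y1 _]; have [] := df y (lt_trans ltr01 y1).
- move=> y; rewrite in_itv /= => /andP[y1 _]; have y0 := lt_trans ltr01 y1.
  rewrite (is_derive_derive1 (df y y0)).
  have -> : y^-1 - (2 / (y + 1) - 2 * (y - 1) / (y + 1) ^+ 2) = (y - 1) ^+ 2 / (y * (y + 1) ^+ 2).
    by field; rewrite !gt_eqF// addr_gt0.
  by rewrite divr_ge0 ?sqr_ge0// mulr_ge0 ?sqr_ge0// ltW.
- apply: derivable_within_continuous => y; rewrite in_itv /= => /andP[y1 _].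
  by have [] := df y (lt_le_trans ltr01 y1).
Qed.

(** The rational bound is sharp only near 1, whence the factorizations [3/2 = 5/4 * 6/5] and
    [2 = 3/2 * 7/6 * 8/7]. *)
Lemma ln_bounds : (4040 / 10000 : R) <= ln (3 / 2) /\ (6912 / 10000 : R) <= ln 2.
Proof.
have p (x : R) : 0 < x -> x \is Num.pos by rewrite posrE.
have e1 : ln (3 / 2 : R) = ln (5 / 4) + ln (6 / 5).
  by rewrite -lnM ?posrE; [congr ln; field|lra|lra].
have e2 : ln (2 : R) = ln (3 / 2) + (ln (7 / 6) + ln (8 / 7)).
  by rewrite -!lnM ?posrE; [congr ln; field|lra|lra|lra|lra].
have h1 := @ln_ge_pade (5 / 4); have h2 := @ln_ge_pade (6 / 5).
have h3 := @ln_ge_pade (7 / 6); have h4 := @ln_ge_pade (8 / 7).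
have g1 : 1 <= 5 / 4 :> R by lra.
have g2 : 1 <= 6 / 5 :> R by lra.
have g3 : 1 <= 7 / 6 :> R by lra.
have g4 : 1 <= 8 / 7 :> R by lra.
move: (h1 g1) (h2 g2) (h3 g3) (h4 g4) e1 e2.
have -> : 2 * (5 / 4 - 1) / (5 / 4 + 1) = 2 / 9 :> R by field.
have -> : 2 * (6 / 5 - 1) / (6 / 5 + 1) = 2 / 11 :> R by field.
have -> : 2 * (7 / 6 - 1) / (7 / 6 + 1) = 2 / 13 :> R by field.
have -> : 2 * (8 / 7 - 1) / (8 / 7 + 1) = 2 / 15 :> R by field.
by move=> *; split; lra.
Qed.

End LogBounds.

(** * Continuation of zeta and the bound on the critical line *)

Section Continuation.
Variables (R : realType) (F : fieldExtType rat) (J : nat -> {fset nonzero_ideal F}).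
Notation mu := (@lebesgue_measure R).
Notation halfline := (`[0%R, +oo[%classic : set R).
Let nu (I : nonzero_ideal F) := ideal_norm (val I).
Hypotheses (nu_gt0 : forall I, (0 < nu I)%N) (JP : forall M I, (I \in J M) = (nu I < M)%N).
Variables (rho C : R).
Hypothesis remainder : forall u : R, 0 <= u ->
  `|count_log nu J u - rho * expR u| <= C * expR (4^-1 * u).

Let N (u : R) := count_log nu J u.
Let kap (u : R) := N u - rho * expR u.

Let C0 : 0 <= C.
Proof. by have := le_trans (normr_ge0 _) (remainder (lexx _)); rewrite mulr0 expR0 mulr1. Qed.

Let continuous_kap : continuous kap.
Proof.
move=> u; apply: cvgB; first exact: continuous_count_log.
by apply: cvgMr; exact: continuous_expR.
Qed.

Let mkap : measurable_fun halfline kap.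
Proof. by apply: measurable_funTS; exact: continuous_measurable_fun. Qed.

Let count_logB u : 0 <= u -> N u <= (C + `|rho|) * expR u.
Proof.
move=> u0; rewrite -(subrK (rho * expR u) (N u)) mulrDl; apply: lerD.
  apply: le_trans (ler_norm _) _; apply: le_trans (remainder u0) _.
  by apply: ler_wpM2l => //; rewrite ler_expR; lra.
by apply: ler_wpM2r; rewrite ?expR_ge0// ler_norm.
Qed.

Lemma laplace_exp (c b : R) (s : R[i]) : b < Rez s ->
  laplace (fun u => c * expR (b * u)) s = Complex c 0 / (s - Complex b 0).
Proof.
move=> bs; have sb : 0 < Rez (s - Complex b 0) by rewrite cReD cReN /= subr_gt0.
have := cint_affexp (Complex c 0) 0 0 sb.
rewrite !mul0r !addr0 mulr0 cexp0 mulr1 => <-.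
apply: eq_cint => u _; rewrite /affexp mul0r addr0.
have -> : - (s - Complex b 0) * Complex u 0 = Complex (b * u) 0 + - s * Complex u 0.
  have -> : Complex (b * u) 0 = Complex b 0 * Complex u 0 :> R[i] by apply: complexP => /=; ring.
  ring.
rewrite cexpD mulrA; congr (_ * _).
by apply: complexP; rewrite /= cos0 sin0; ring.
Qed.

(** The two factors [s] are kept apart so that [analytic_mulX] applies twice. *)
Definition zeta_cont (s : R[i]) : R[i] :=
  s * (s * (Complex rho 0 * (s - 1)^-1 + laplace kap s)).

Lemma zeta_cont_continuation : dedekind_continuation F (4^-1) zeta_cont.
Proof.
split=> [z z4 z1|z z1].
  apply: analytic_mulX; apply: analytic_mulX; apply: analyticD.
    by apply: analyticZ; exact: analytic_inv.
  exact: (analytic_laplace mkap remainder z4).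
have Nb u : 0 <= u -> `|N u| <= (C + `|rho|) * expR (1 * u).
  by move=> u0; rewrite mul1r ger0_norm ?count_log_ge0// count_logB.
have Hb u : 0 <= u -> `|rho * expR (1 * u)| <= `|rho| * expR (1 * u).
  by move=> _; rewrite normrM (ger0_norm (expR_ge0 _)).
have mH : measurable_fun halfline (fun u => rho * expR (1 * u)).
  apply: measurable_funTS; apply: continuous_measurable_fun.
  rewrite (_ : (fun u => _) = fun u => rho * expR u); last by apply/funext => u; rewrite mul1r.
  by move=> u; apply: cvgMr; exact: continuous_expR.
have kapE : laplace kap z = laplace N z - laplace (fun u => rho * expR (1 * u)) z.
  rewrite -(laplaceB (mcount_log nu_gt0 JP) mH Nb Hb z1); apply: eq_cint => u _.
  by rewrite /kap mul1r.
rewrite /zeta_cont kapE laplace_exp// (_ : Complex 1 0 = 1)// addrC subrK mulrA -expr2.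
by rewrite /dedekind_series (dirichlet_sum nu_gt0 JP count_logB z1).
Qed.

(** [zeta_cont] inhabits the set under [xget], so the default 0 is not taken; uniqueness of the
    continuation identifies the chosen value. *)
Lemma dedekind_zetaE (s : R[i]) : 4^-1 < Rez s -> s != 1 -> dedekind_zeta F s = zeta_cont s.
Proof.
move=> s4 s1; rewrite /dedekind_zeta; case: xgetP => [w _ [sg [g [sgs gc gs]]]|].
  by rewrite -gs; apply: (continuation_unique gc zeta_cont_continuation).
by move=> /(_ (zeta_cont s)) []; exists 4^-1, zeta_cont; split => //; exact: zeta_cont_continuation.
Qed.

Let k (u : R) := kap u * expR (- (2^-1 * u)).

Let ck : continuous k.
Proof.
move=> u; apply: cvgM; first exact: continuous_kap.
exact: continuous_expRN_lin.
Qed.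

Let kap_neg u : u <= 0 -> kap u = - (rho * expR u).
Proof. by move=> u0; rewrite /kap /N (count_log_neg J nu_gt0 u0) sub0r. Qed.

(** To the right the exponents add up to [1/4 - 1/2]; to the left [kap u] is [- rho * exp u], and
    [k u] decays like [exp (u / 2)]. *)
Let kC u : `|k u| <= (C + `|rho|) * expR (- (4^-1 * `|u|)).
Proof.
rewrite normrM (ger0_norm (expR_ge0 _)); case: (leP 0 u) => u0.
  apply: le_trans (ler_wpM2r (expR_ge0 _) (remainder u0)) _.
  rewrite -mulrA -expRD (ger0_norm u0).
  have -> : 4^-1 * u - 2^-1 * u = - (4^-1 * u) by field.
  by apply: ler_wpM2r; rewrite ?expR_ge0// lerDl.
rewrite kap_neg ?(ltW u0)// normrN normrM (ger0_norm (expR_ge0 _)) -mulrA -expRD (ltr0_norm u0).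
apply: ler_pM; rewrite ?expR_ge0// ?lerDr// ler_expR; lra.
Qed.

Let q4 : 0 < (4^-1 : R). Proof. by rewrite invr_gt0. Qed.

Let integrable_kmul (h : R -> R) : continuous h -> (forall u, `|h u| <= 1) ->
  mu.-integrable setT (EFin \o (fun u => k u * h u)).
Proof.
move=> ch h1; apply: (integrable_dom _ _ _ (RintegrableZ (C + `|rho|) measurableT (integrable_exp_abs q4))) => //.
  by apply: continuous_measurable_fun => u; apply: cvgM; [exact: ck|exact: ch].
move=> u _; rewrite normrM; apply: le_trans (kC u).
by rewrite ler_piMr.
Qed.

Let continuous_cost (t : R) : continuous (fun u => cos (t * u)).
Proof.
move=> u; apply: (continuous_comp (f := fun u : R => t * u) (g := cos)).
  by apply: cvgMr; exact: cvg_id.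
exact: continuous_cos.
Qed.

Let continuous_sint (t : R) : continuous (fun u => sin (t * u)).
Proof.
move=> u; apply: (continuous_comp (f := fun u : R => t * u) (g := sin)).
  by apply: cvgMr; exact: cvg_id.
exact: continuous_sin.
Qed.

(** Since [kap u = - rho * exp u] for [u <= 0], the polar term [rho / (s - 1)] is exactly the
    integral of [kap u * exp (- s * u)] over the negative half-line when [Rez s < 1]. It joins the
    Laplace transform into a single Fourier integral. *)
Lemma zeta_fourier (t : R) :
  normc (zeta_cont (Complex 2^-1 t) / Complex 2^-1 t) ^+ 2 =
  (4^-1 + t ^+ 2) * ((\int[mu]_(u in setT) (k u * cos (t * u))) ^+ 2 +
     (\int[mu]_(u in setT) (k u * sin (t * u))) ^+ 2).
Proof.
set s := Complex 2^-1 t.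
have s0 : s != 0 by rewrite eq_complex /= negb_and invr_eq0 pnatr_eq0.
have -> : zeta_cont s / s = s * (Complex rho 0 * (s - 1)^-1 + laplace kap s).
  by rewrite /zeta_cont mulrC mulKf.
have s'0 : 0 < Rez (1 - s) by rewrite cReD cReN /= subr_gt0 invf_lt1// ltr1n.
have E1 : Complex rho 0 * (s - 1)^-1 = laplace (fun u => - rho * expR (0 * u)) (1 - s).
  rewrite (laplace_exp _ s'0) (_ : Complex 0 0 = 0)// subr0 -opprB invrN mulrN.
  by rewrite (_ : Complex (- rho) 0 = - Complex rho 0) ?mulNr//; apply: complexP; rewrite /= ?oppr0.
rewrite E1 normcM exprMn !sqr_normcE; congr (_ * _).
  by rewrite /s /=; congr (_ + _); field.
congr (_ + _).
  congr (_ ^+ 2); rewrite Rintegral_split; last 2 first.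
  - by move=> u; apply: cvgM; [exact: ck|exact: continuous_cost].
  - by apply: integrable_kmul => // u; exact: cos_abs_le1.
  rewrite cReD addrC; congr (_ + _); apply: eq_Rintegral => u /set_mem /mem_halfline u0.
    by rewrite /s /= /k !mulNr !(mul0r, mulr0, subr0, addr0, add0r, oppr0) cosN mulrA.
  rewrite /k kap_neg ?oppr_le0// /s cReM /= !mul0r subr0 expR0 mulr1.
  have -> : - (1 - 2^-1) * u - - (0 - t) * 0 = - (2^-1 * u) by field.
  have -> : - (1 - 2^-1) * 0 + - (0 - t) * u = t * u by ring.
  have -> : - (2^-1 * u) = - u + - (2^-1 * - u) by field.
  by rewrite expRD (mulrN t) cosN; ring.
have cs : continuous (fun u => k u * sin (t * u)).
  by move=> u; apply: cvgM; [exact: ck|exact: continuous_sint].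
have is_ : mu.-integrable setT (EFin \o (fun u => k u * sin (t * u))).
  by apply: integrable_kmul => // u; exact: sin_abs_le1.
rewrite -[RHS]sqrrN -mulN1r -RintegralZl//; congr (_ ^+ 2); rewrite Rintegral_split; last 2 first.
- by move=> u; apply: cvgMr; exact: cs.
- exact: RintegrableZ.
rewrite cImD addrC; congr (_ + _); apply: eq_Rintegral => u /set_mem /mem_halfline u0.
  by rewrite /s /= /k !mulNr !(mul0r, mulr0, subr0, addr0, add0r, oppr0, mul1r) sinN mulrN mulrN mulrA.
rewrite /k kap_neg ?oppr_le0// /s cImM /=.
have -> : - (1 - 2^-1) * u - - (0 - t) * 0 = - (2^-1 * u) by field.
have -> : - (1 - 2^-1) * 0 + - (0 - t) * u = t * u by ring.
have -> : - (2^-1 * u) = - u + - (2^-1 * - u) by field.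
by rewrite expRD (mulrN t) sinN mul0r expR0; ring.
Qed.

Hypothesis unit_ideal : exists I, nu I = 1%N.

Let N_ge u : 0 <= u -> u <= N u.
Proof.
move=> u0; have [I1 nI1] := unit_ideal; rewrite /N /count_log /rampsum.
have I1J : I1 \in J (Num.truncn (expR u)).+2 by rewrite JP nI1.
rewrite (big_rem I1) //= nI1 /ramp ln1 subr0.
apply: (@le_trans _ _ (Num.max 0 u)); first by rewrite le_max lexx orbT.
by rewrite lerDl; apply: sumr_ge0 => I _; rewrite le_max lexx.
Qed.

(** The product is the exponential of the smaller argument: in terms of the points [exp v] the
    quadratic form has the matrix of their minima, and no square root remains. *)
Let half_abs (v w : R) : v <= w ->
  expR (v / 2) * expR (w / 2) * expR (- (2^-1 * `|v - w|)) = expR v /\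
  expR (w / 2) * expR (v / 2) * expR (- (2^-1 * `|w - v|)) = expR v.
Proof.
move=> vw; rewrite (distrC w) (mulrC (expR (w / 2))) ler0_norm ?subr_le0// -!expRD.
by split; congr expR; field.
Qed.

(* The test function has knots at [ln 1], [ln (3/2)], [ln 2] and weights [b j], optimized
   subject to [\sum_j b j * x j = 0], which removes the unknown residue [rho]. *)
Lemma zeta_integral_gt :
  ((pi / 2)%:E < \int[mu]_(t in [set: R])
     (normc (dedekind_zeta F (Complex (2^-1) t) / Complex (2^-1) t) ^+ 2)%:E)%E.
Proof.
pose b : seq R := [:: - (82 / 100); 24 / 100; 23 / 100].
pose x : seq R := [:: 0; ln (3 / 2); ln 2].
(* The factor [exp (x_j / 2)] undoes the one in [k], so that the linear part becomes
   [\sum_j b_j * kap (x_j)]. *)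
have := @fourier_lower R k (4^-1) (C + `|rho|) q4 ck kC 3
  (fun j => b`_j * expR (x`_j / 2)) (fun j => x`_j).
have h2 : (4^-1 : R) < 2^-1 by lra.
rewrite (_ : (\int[mu]_t _)%E = (\int[mu]_(t in [set: R])
     (normc (dedekind_zeta F (Complex (2^-1) t) / Complex (2^-1) t) ^+ 2)%:E)%E); last first.
  apply: eq_integral => t _; rewrite dedekind_zetaE ?zeta_fourier//.
  by rewrite eq_complex /= negb_and; apply/orP; left; rewrite lt_eqF// invf_lt1// ltr1n.
apply: lt_le_trans; rewrite lte_fin.
have [l1 l2] := ln_bounds R.
have kE (p v : R) : p * expR (v / 2) * k v = p * kap v.
  rewrite -mulrA; congr (_ * _); rewrite /k mulrCA -expRD (_ : v / 2 - 2^-1 * v = 0) ?expR0 ?mulr1//; by field.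
have sum3 (f : 'I_3 -> R) : \sum_j f j = f ord0 + (f (lift ord0 ord0) + f (lift ord0 (lift ord0 ord0))).
  by rewrite !big_ord_recl big_ord0 addr0.
rewrite !sum3 /=.
have x1 : 0 <= ln (3 / 2 : R) by lra.
have x12 : ln (3 / 2 : R) <= ln 2 by rewrite ler_ln ?posrE; lra.
have e1 : expR (ln (3 / 2)) = 3 / 2 :> R by rewrite lnK// posrE; lra.
have e2 : expR (ln 2) = 2 :> R by rewrite lnK// posrE.
have n1 := N_ge x1; have n2 := N_ge (le_trans x1 x12).
have k0 : kap 0 = - rho by rewrite kap_neg// expR0 mulr1.
have k1 : kap (ln (3 / 2)) = N (ln (3 / 2)) - rho * (3 / 2) by rewrite /kap e1.
have k2 : kap (ln 2) = N (ln 2) - rho * 2 by rewrite /kap e2.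
have [a00 _] := half_abs (lexx (0 : R)); have [a01 a10] := half_abs x1.
have [a02 a20] := half_abs (le_trans x1 x12); have [a11 _] := half_abs (lexx (ln (3 / 2 : R))).
have [a12 a21] := half_abs x12; have [a22 _] := half_abs (lexx (ln (2 : R))).
rewrite expR0 in a00 a01 a10 a02 a20; rewrite e1 in a11 a12 a21; rewrite e2 in a22.
have red (p q e f g m : R) : e * f * g = m -> p * e * (q * f) * g = p * q * m.
  by move=> <-; ring.
rewrite !kE (red _ _ _ _ _ _ a00) (red _ _ _ _ _ _ a01) (red _ _ _ _ _ _ a02).
rewrite (red _ _ _ _ _ _ a10) (red _ _ _ _ _ _ a11) (red _ _ _ _ _ _ a12).
rewrite (red _ _ _ _ _ _ a20) (red _ _ _ _ _ _ a21) (red _ _ _ _ _ _ a22).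
(* The bracket has to exceed [1/4]. With [N u] replaced by its lower bound [u] it is about 0.254,
   and about 0.2525 with the rational bounds for the logarithms. *)
rewrite (_ : pi / 2 = 2 * pi * 4^-1); last by field.
rewrite ltr_pM2l ?mulr_gt0 ?pi_gt0// k0 k1 k2.
move: n1 n2 l1 l2; move: (N _) (N _) => N1 N2; move: (ln _) (ln _) => L1 L2.
by move=> *; lra.
Qed.

End Continuation.

(** * The remainder term *)

Section LogSums.
Variable R : realType.
Notation ramp := (@ramp R).

Lemma ramp_dilate d m (u : R) : (0 < d)%N -> (0 < m)%N ->
  ramp (d * m) u = ramp m (u - ln d%:R).
Proof.
by move=> d0 m0; rewrite /ramp natrM lnM ?posrE ?ltr0n// opprD addrA.
Qed.

Definition logsum (M : nat) (w : R) : R := \sum_(1 <= m < M) ramp m w.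

(** As long as [exp w <= M], the slope of [logsum] is the integer part of [exp w]. For [w >= 0] this
    is therefore 1 plus an integral of the fractional part of [exp]: at most [1 + w], and
    nondecreasing, as Abel summation requires. *)
Definition logerr (M : nat) (w : R) : R := expR w - logsum M w.

Lemma logsum_neg M w : w <= 0 -> logsum M w = 0.
Proof.
move=> w0; rewrite /logsum big_nat big1// => m /andP[m1 _]; apply: ramp_eq0.
by apply: le_trans w0 _; apply: ln_ge0; rewrite ler1n.
Qed.

Lemma logsum_widen M M' w : expR w <= M%:R -> (M <= M')%N -> logsum M' w = logsum M w.
Proof.
move=> wM MM'; have M0 : (0 < M)%N by rewrite -(ltr_nat R) (lt_le_trans (expR_gt0 w)).
rewrite /logsum (big_cat_nat M0 MM') /= [X in _ + X]big_nat [X in _ + X]big1 ?addr0// => m.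
move=> /andP[Mm _]; apply: ramp_eq0.
by rewrite -ler_expR lnK ?posrE ?ltr0n ?(leq_trans M0)// (le_trans wM)// ler_nat.
Qed.

Lemma logsum_piece M n w : (0 < n)%N -> (n < M)%N -> ln n%:R <= w -> w <= ln n.+1%:R ->
  logsum M w = n%:R * w - \sum_(1 <= m < n.+1) ln m%:R.
Proof.
move=> n0 nM nw wn; rewrite (@logsum_widen n.+1)//; last by rewrite -[leRHS]lnK ?posrE// ler_expR.
rewrite /logsum (eq_big_nat _ _ (F2 := fun m => w - ln m%:R)).
  by rewrite big_split /= sumrN sumr_const_nat subn1 /= mulr_natl.
move=> m /andP[m1 mn]; apply/max_idPr; rewrite subr_ge0 (le_trans _ nw)//.
by rewrite ler_ln ?posrE ?ltr0n// ler_nat.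
Qed.

Lemma expR_sub_bounds (v w : R) : v <= w ->
  expR v * (w - v) <= expR w - expR v /\ expR w - expR v <= expR w * (w - v).
Proof.
move=> vw; split.
  have := expR_ge1Dx (w - v); rewrite -(ler_pM2l (expR_gt0 v)) -expRD (_ : v + (w - v) = w); last by ring.
  lra.
have := expR_ge1Dx (v - w); rewrite -(ler_pM2l (expR_gt0 w)) -expRD (_ : w + (v - w) = v); last by ring.
lra.
Qed.

Lemma logerr_piece M n v w : (0 < n)%N -> (n < M)%N -> ln n%:R <= v -> v <= w -> w <= ln n.+1%:R ->
  0 <= logerr M w - logerr M v <= w - v.
Proof.
move=> n0 nM nv vw wn.
rewrite /logerr (logsum_piece n0 nM nv (le_trans vw wn)) (logsum_piece n0 nM (le_trans nv vw) wn).
have [h1 h2] := expR_sub_bounds vw.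
have e1 : n%:R <= expR v by rewrite -[leLHS]lnK ?posrE ?ltr0n// ler_expR.
have e2 : expR w <= n.+1%:R by rewrite -[leRHS]lnK ?posrE ?ltr0n// ler_expR.
have vw0 : 0 <= w - v by rewrite subr_ge0.
have h3 := ler_wpM2r vw0 e1; have h4 := ler_wpM2r vw0 e2.
rewrite -natr1 in h4.
move: (\sum_(_ <= _ < _) _) => S; apply/andP; split; lra.
Qed.

(** Induction over the intervals between logarithms of consecutive integers, on each of which
    [logsum] is affine. *)
Lemma logerr_incr M v w : (0 < M)%N -> 0 <= v -> v <= w -> w <= ln M%:R ->
  0 <= logerr M w - logerr M v <= w - v.
Proof.
move=> M0 v0 vw wM.
suff main n : (0 < n)%N -> (n < M)%N -> forall v w, 0 <= v -> v <= w -> w <= ln n.+1%:R ->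
    0 <= logerr M w - logerr M v <= w - v.
  case: M M0 wM main => // -[|M] _ wM main; last by apply: (main M.+1).
  have w0 : w = 0 by apply/eqP; rewrite eq_le (le_trans v0 vw) -[leRHS](@ln1 R) wM.
  have v0' : v = 0 by apply/eqP; rewrite eq_le v0 -w0 vw.
  by rewrite w0 v0' !subrr lexx.
move=> {v w v0 vw wM}; elim: n => // -[|n] IH n0 nM v w v0 vw wn.
  by apply: (@logerr_piece _ 1) => //; rewrite ln1.
case: (leP (ln n.+2%:R) v) => vn; first exact: (@logerr_piece _ n.+2).
case: (leP w (ln n.+2%:R)) => wn'; first by apply: IH => //; exact: ltnW.
have /andP[h1 h2] := IH isT (ltnW nM) v _ v0 (ltW vn) (lexx _).
have /andP[h3 h4] := @logerr_piece _ n.+2 _ w isT nM (lexx _) (ltW wn') wn.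
move: h1 h2 h3 h4; move: (logerr _ _) (logerr _ _) (logerr _ _) => a b c *; apply/andP; split; lra.
Qed.

Lemma logerr_mono M v w : v <= w -> expR w <= M%:R -> logerr M v <= logerr M w.
Proof.
move=> vw wM; have M0 : (0 < M)%N by rewrite -(ltr_nat R) (lt_le_trans (expR_gt0 w)).
have wM' : w <= ln M%:R by rewrite -ler_expR lnK// posrE ltr0n.
case: (leP 0 v) => v0.
  by have /andP[h _] := logerr_incr M0 v0 vw wM'; rewrite -subr_ge0.
have neg x : x <= 0 -> logerr M x = expR x by move=> x0; rewrite /logerr logsum_neg// subr0.
case: (leP w 0) => w0; first by rewrite !neg ?(ltW v0)// ler_expR.
have /andP[h _] := logerr_incr M0 (lexx 0) (ltW w0) wM'.
apply: (@le_trans _ _ (logerr M 0)); last by rewrite -subr_ge0.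
by rewrite !neg ?(ltW v0)// ler_expR ltW.
Qed.

Lemma logerr_ge0 M w : expR w <= M%:R -> 0 <= logerr M w.
Proof.
move=> wM; case: (leP w 0) => w0; first by rewrite /logerr logsum_neg// subr0 expR_ge0.
apply: (@le_trans _ _ (logerr M 0)); last exact: logerr_mono (ltW w0) wM.
by rewrite /logerr logsum_neg// subr0 expR_ge0.
Qed.

Lemma logerr_le M w : 0 <= w -> expR w <= M%:R -> logerr M w <= 1 + w.
Proof.
move=> w0 wM; have M0 : (0 < M)%N by rewrite -(ltr_nat R) (lt_le_trans (expR_gt0 w)).
have wM' : w <= ln M%:R by rewrite -ler_expR lnK// posrE ltr0n.
have /andP[_] := logerr_incr M0 (lexx 0) w0 wM'.
rewrite subr0 [logerr M 0]/logerr logsum_neg// subr0 expR0; lra.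
Qed.

Lemma abel_bound (psi a : nat -> R) (B : R) m n : (m <= n)%N ->
  (forall k, (m <= k)%N -> `|\sum_(m <= d < k) psi d| <= B) ->
  (forall d, (m <= d)%N -> a d.+1 <= a d) -> (forall d, (m <= d)%N -> 0 <= a d) ->
  `|\sum_(m <= d < n) psi d * a d| <= B * a m.
Proof.
move=> mn PB ad a0.
(* With the boundary term kept, one more index adds a partial sum times [a n - a n.+1], and these
   differences telescope. *)
have main : `|\sum_(m <= d < n) psi d * a d - (\sum_(m <= d < n) psi d) * a n| <= B * (a m - a n).
  elim: n mn => [|n IH]; first by rewrite leqn0 => /eqP ->; rewrite !big_geq// mul0r !subrr mulr0 normr0.
  rewrite leq_eqVlt => /predU1P[<-|]; first by rewrite !big_geq// mul0r !subrr mulr0 normr0.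
  rewrite ltnS => mn; have := IH mn; have := PB n.+1 (leqW mn).
  rewrite !big_nat_recr//=; set S := \sum_(m <= d < n) psi d * a d; set P := \sum_(m <= d < n) psi d => hP hS.
  have -> : S + psi n * a n - (P + psi n) * a n.+1 = (S - P * a n) + (P + psi n) * (a n - a n.+1) by ring.
  apply: le_trans (ler_normD _ _) _.
  have h0 : 0 <= a n - a n.+1 by rewrite subr_ge0 ad.
  rewrite normrM (ger0_norm h0); have := ler_wpM2r h0 hP; lra.
have h := PB n mn.
rewrite -(subrK ((\sum_(m <= d < n) psi d) * a n) (\sum_(m <= d < n) psi d * a d)).
apply: le_trans (ler_normD _ _) _; rewrite normrM (ger0_norm (a0 n mn)).
by have := ler_wpM2r (a0 n mn) h; lra.
Qed.

Lemma sum_multiples (f : nat -> R) d K : (0 < d)%N ->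
  \sum_(0 <= n < d * K | (d %| n)%N) f n = \sum_(0 <= m < K) f (d * m)%N.
Proof.
move=> d0; elim: K => [|K IH]; first by rewrite muln0 !big_geq.
rewrite big_nat_recr//= -IH mulnS addnC (@big_cat_nat _ _ _ (d * K)%N) ?leq_addr//=; congr (_ + _).
rewrite big_mkcond big_ltn; last by rewrite -[X in (X < _)%N]addn0 ltn_add2l.
rewrite dvdn_mulr// big_nat big1; first by rewrite /= addr0.
move=> n /andP[n1 n2].
case: ifP => // /dvdnP[q nq]; move: n1 n2; rewrite nq.
by rewrite (mulnC d) -mulSnr !ltn_pmul2r// ltnS => h1 /(leq_trans h1); rewrite ltnn.
Qed.

End LogSums.

Section Remainder.
Variable R : realType.
Notation ramp := (@ramp R).

Lemma sum_multiples_supp (f : nat -> R) d M : (0 < d)%N ->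
  (forall n, (M <= n)%N -> f n = 0) ->
  \sum_(1 <= n < M | (d %| n)%N) f n = \sum_(1 <= m < M) f (d * m)%N.
Proof.
move=> d0 f0; case: (posnP M) => [->|M0]; first by rewrite !big_geq.
pose g n := if n == 0%N then 0 else f n.
have -> : \sum_(1 <= n < M | (d %| n)%N) f n = \sum_(0 <= n < M | (d %| n)%N) g n.
  rewrite [RHS]big_mkcond big_ltn//= {1}/g eqxx dvdn0 add0r -big_mkcond.
  by rewrite [LHS]big_nat_cond [RHS]big_nat_cond; apply: eq_bigr => -[].
have -> : \sum_(1 <= m < M) f (d * m)%N = \sum_(0 <= m < M) g (d * m)%N.
  rewrite [RHS]big_ltn// /g muln0 eqxx add0r; apply: eq_big_nat => -[//|m] _.
  by rewrite muln_eq0 gtn_eqF.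
rewrite -sum_multiples// (@big_cat_nat _ _ _ M _ (d * M)%N)//=; last by rewrite leq_pmull.
rewrite [X in _ + X]big_nat_cond [X in _ + X]big1 ?addr0// => n /andP[/andP[Mn _] _].
by rewrite /g; case: eqP => // _; exact: f0.
Qed.

(** Writing [n = d * m] turns [ramp n u] into [ramp m (u - ln d)]. The same cut-off [M] serves both
    sides because ramps beyond [exp u] vanish. *)
Lemma dirichlet_exchange (c : nat -> R) M (u : R) : expR u <= M%:R ->
  \sum_(1 <= n < M) (\sum_(1 <= d < n.+1 | (d %| n)%N) c d) * ramp n u =
  \sum_(1 <= d < M) c d * logsum M (u - ln d%:R).
Proof.
move=> uM; have M0 : (0 < M)%N by rewrite -(ltr_nat R) (lt_le_trans (expR_gt0 u)).
transitivity (\sum_(1 <= n < M) \sum_(1 <= d < M | (d %| n)%N) c d * ramp n u).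
  apply: eq_big_nat => n /andP[n0 nM]; rewrite -mulr_suml; congr (_ * _).
  rewrite [RHS](@big_cat_nat _ _ _ n.+1)//= [X in _ = _ + X]big_nat_cond [X in _ = _ + X]big1 ?addr0//.
  by move=> d /andP[/andP[nd _] /(dvdn_leq n0)]; rewrite leqNgt nd.
rewrite (exchange_big_dep_nat xpredT)//=; apply: eq_big_nat => d /andP[d0 dM].
rewrite -mulr_sumr; congr (_ * _).
rewrite sum_multiples_supp//.
  by rewrite /logsum; apply: eq_big_nat => m /andP[m0 _]; rewrite ramp_dilate.
move=> n Mn; apply: ramp_eq0.
rewrite -ler_expR lnK ?posrE ?ltr0n ?(leq_trans M0)//.
by apply: le_trans uM _; rewrite ler_nat.
Qed.

(** By Abel summation the intervals of center [s m] and radius [2 * B / m] meet pairwise; [rho] is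
    the supremum of their left ends. The 2 comes from writing a tail as a difference of two partial
    sums. *)
Lemma residue_exists (psi : nat -> R) (B : R) :
  (forall k, `|\sum_(1 <= d < k) psi d| <= B) ->
  exists rho : R, forall M, (0 < M)%N -> `|\sum_(1 <= d < M) psi d / d%:R - rho| <= 2 * B / M%:R.
Proof.
move=> hB; have B0 : 0 <= B by exact: le_trans (hB 0%N).
have tail m k : (0 < m)%N -> `|\sum_(m <= d < k) psi d| <= 2 * B.
  move=> m0; case: (leqP m k) => mk; last by rewrite big_geq ?normr0 ?mulr_ge0// ltnW.
  have -> : \sum_(m <= d < k) psi d = \sum_(1 <= d < k) psi d - \sum_(1 <= d < m) psi d.
    by rewrite [in RHS](big_cat_nat m0 mk) /= addrAC subrr add0r.
  by apply: le_trans (ler_normB _ _) _; have := hB k; have := hB m; lra.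
pose s M := \sum_(1 <= d < M) psi d / d%:R.
have cau m n : (0 < m)%N -> (m <= n)%N -> `|s n - s m| <= 2 * B / m%:R.
  move=> m0 mn; rewrite /s [X in X - _](big_cat_nat m0 mn) /= addrAC subrr add0r.
  apply: (@abel_bound _ psi (fun d => d%:R^-1)) => // [k _|d md].
    exact: tail.
  by rewrite lef_pV2 ?posrE ?ltr0n// ?ler_nat// (leq_trans m0).
have hs m n : (0 < m)%N -> (0 < n)%N -> s m - 2 * B / m%:R <= s n + 2 * B / n%:R.
  move=> m0 n0; case: (leqP m n) => mn.
    have := cau m n m0 mn; rewrite ler_norml => /andP[h _].
    have : 0 <= 2 * B / n%:R by rewrite divr_ge0 ?mulr_ge0.
    lra.
  have := cau n m n0 (ltnW mn); rewrite ler_norml => /andP[_ h].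
  have : 0 <= 2 * B / m%:R by rewrite divr_ge0 ?mulr_ge0.
  lra.
pose E := [set x | exists2 m, (0 < m)%N & x = s m - 2 * B / m%:R].
have E0 : E !=set0 by exists (s 1%N - 2 * B / 1%:R), 1%N.
have hE n : (0 < n)%N -> ubound E (s n + 2 * B / n%:R).
  by move=> n0 _ [m m0 ->]; exact: hs.
exists (sup E) => M M0; rewrite -/(s M).
have h1 : s M - 2 * B / M%:R <= sup E.
  by apply: ub_le_sup; [exists (s 1%N + 2 * B / 1%:R); exact: hE|exists M].
have h2 : sup E <= s M + 2 * B / M%:R by apply: ge_sup => //; exact: hE.
by rewrite ler_norml; apply/andP; split; lra.
Qed.

Variables (c : nat -> R) (eps B : R).
Hypotheses (c2 : forall d, c (2 * d)%N = eps * c d) (eps1 : `|eps| <= 1).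
Let psi d := if odd d then c d else 0.
Hypothesis hB : forall k, `|\sum_(1 <= d < k) psi d| <= B.

Let B0 : 0 <= B. Proof. exact: le_trans (hB 0%N). Qed.

Let T (f : nat -> R) M u := \sum_(1 <= d < M) f d * logsum M (u - ln d%:R).

(** Odd [d] give the sum for [psi]; an even [d = 2 * d'] shifts [u] by [ln 2] and contributes a
    factor [eps]. *)
Let T_rec M u : expR u <= M%:R -> T c M u = T psi M u + eps * T c M (u - ln 2).
Proof.
move=> uM; have M0 : (0 < M)%N by rewrite -(ltr_nat R) (lt_le_trans (expR_gt0 u)).
rewrite /T (bigID (fun d => odd d)) /=; congr (_ + _).
  rewrite big_mkcond; apply: eq_bigr => d _; rewrite /psi; case: ifP => //; by rewrite mul0r.
under eq_bigl do rewrite -dvdn2.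
pose f d := c d * logsum M (u - ln d%:R).
rewrite (@sum_multiples_supp f)//; last first.
  move=> n Mn; rewrite /f logsum_neg ?mulr0// subr_le0.
  rewrite -ler_expR lnK ?posrE ?ltr0n ?(leq_trans M0)//.
  by apply: le_trans uM _; rewrite ler_nat.
rewrite mulr_sumr; apply: eq_big_nat => d /andP[d0 _].
by rewrite /f c2 natrM lnM ?posrE ?ltr0n// opprD addrA mulrA.
Qed.

(** For [psi] alone the error is at most [B * (3 + u) <= 4 * B * exp (u / 4)]. Descending by [ln 2]
    until the argument is at most 0 adds a geometric series of ratio [q = 2 ^ (- 1/4)]. *)
Lemma remainder_exists : exists rho C : R, forall u M, 0 <= u -> expR u <= M%:R ->
  `|\sum_(1 <= n < M) (\sum_(1 <= d < n.+1 | (d %| n)%N) c d) * ramp n u - rho * expR u|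
     <= C * expR (4^-1 * u).
Proof.
have [rho1 hr] := residue_exists hB.
have eps2 : 1 - eps / 2 != 0.
  have := ler_norm eps; move: eps1 => ? ?; rewrite gt_eqF//; lra.
(* The Euler factor at 2: [rho] is the fixed point of the recursion for the main term. *)
pose rho := rho1 / (1 - eps / 2).
have rhoE : rho = rho1 + eps * (rho / 2) by rewrite -[X in _ = X + _](divfK eps2) -/rho; field.
pose q : R := expR (- (4^-1 * ln 2)).
have ln20 : 0 < ln (2 : R) by rewrite ln_gt0// ltr1n.
have q1 : q < 1 by rewrite -[ltRHS]expR0 ltr_expR oppr_lt0 mulr_gt0// invr_gt0.
have q0 : 0 < q by exact: expR_gt0.
(* The inequality [4 * B + C * q <= C] closes the induction, and [|rho| <= C] starts it where the
   argument is at most 0. *)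
pose C := `|rho| + 4 * B / (1 - q).
have C1 : 4 * B + C * q <= C.
  have -> : 4 * B = (4 * B / (1 - q)) * (1 - q) by rewrite divfK// gt_eqF// subr_gt0.
  rewrite /C; have : 0 <= `|rho| * (1 - q) by rewrite mulr_ge0// subr_ge0 ltW.
  lra.
have C0 : `|rho| <= C by rewrite lerDl divr_ge0 ?mulr_ge0// subr_ge0 ltW.
have T1 u M : 0 <= u -> expR u <= M%:R -> `|T psi M u - rho1 * expR u| <= 4 * B * expR (4^-1 * u).
  move=> u0 uM; have M0 : (0 < M)%N by rewrite -(ltr_nat R) (lt_le_trans (expR_gt0 u)).
  have dpos d : (1 <= d)%N -> 0 < (d%:R : R) by rewrite ltr0n.
  have -> : T psi M u = expR u * (\sum_(1 <= d < M) psi d / d%:R) -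
      \sum_(1 <= d < M) psi d * logerr M (u - ln d%:R).
    rewrite mulr_sumr -sumrB; apply: eq_big_nat => d /andP[/dpos d0 _].
    by rewrite /logerr expRD expRN lnK ?posrE//; ring.
  rewrite (_ : _ - _ - _ = expR u * (\sum_(1 <= d < M) psi d / d%:R - rho1) -
      \sum_(1 <= d < M) psi d * logerr M (u - ln d%:R)); last by ring.
  have dle d : (1 <= d)%N -> expR (u - ln d%:R) <= M%:R.
    move=> d1; apply: le_trans uM; rewrite ler_expR gerBl; apply: ln_ge0.
    by rewrite ler1n.
  have h1 : `|\sum_(1 <= d < M) psi d * logerr M (u - ln d%:R)| <= B * (1 + u).
    apply: (@le_trans _ _ (B * logerr M (u - ln 1%:R))).
      apply: (@abel_bound _ psi (fun d => logerr M (u - ln d%:R))) => // [d d1|d d1].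
        apply: logerr_mono; last exact: dle.
        by rewrite lerD2l lerN2 ler_ln ?posrE ?ltr0n// ler_nat.
      by apply: logerr_ge0; exact: dle.
    by apply: ler_wpM2l => //; rewrite ln1 subr0; exact: logerr_le.
  have h2 : `|expR u * (\sum_(1 <= d < M) psi d / d%:R - rho1)| <= 2 * B.
    rewrite normrM (ger0_norm (expR_ge0 _)).
    apply: le_trans (ler_pM (expR_ge0 _) (normr_ge0 _) uM (hr M M0)) _.
    by rewrite mulrC divfK// gt_eqF// ltr0n.
  apply: le_trans (ler_normB _ _) _.
  have b0 : 0 <= B := B0; have := ler_wpM2l b0 (expR_ge1Dx (4^-1 * u)); lra.
exists rho, C => u M _ uM; rewrite dirichlet_exchange// -/(T c M u).
have main n v : v <= n%:R * ln 2 -> expR v <= M%:R ->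
    `|T c M v - rho * expR v| <= C * expR (4^-1 * v).
  elim: n v => [|n IH] v vn vM.
    have v0 : v <= 0 by rewrite mul0r in vn.
    rewrite /T big_nat big1 ?sub0r.
      rewrite normrN normrM (ger0_norm (expR_ge0 _)); apply: ler_pM; rewrite ?expR_ge0//.
      by rewrite ler_expR; lra.
    move=> d /andP[d1 _]; rewrite logsum_neg ?mulr0// subr_le0; apply: le_trans v0 _.
    by apply: ln_ge0; rewrite ler1n.
  case: (leP v 0) => v0.
    by apply: IH => //; apply: le_trans v0 _; rewrite mulr_ge0// ltW.
  rewrite T_rec//.
  have vn' : v - ln 2 <= n%:R * ln 2 by move: vn; rewrite -natr1; lra.
  have vM' : expR (v - ln 2) <= M%:R by apply: le_trans vM; rewrite ler_expR gerBl ltW.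
  have h := IH _ vn' vM'; have h1 := T1 _ _ (ltW v0) vM.
  have e1 : expR (v - ln 2) = expR v / 2 by rewrite expRD expRN lnK ?posrE.
  have e2 : expR (4^-1 * (v - ln 2)) = expR (4^-1 * v) * q by rewrite -expRD mulrBr.
  rewrite e1 e2 in h.
  have -> : T psi M v + eps * T c M (v - ln 2) - rho * expR v =
     (T psi M v - rho1 * expR v) + eps * (T c M (v - ln 2) - rho * (expR v / 2)).
    by rewrite [in LHS]rhoE; ring.
  apply: le_trans (ler_normD _ _) _; rewrite normrM.
  have h2 : `|eps| * `|T c M (v - ln 2) - rho * (expR v / 2)| <= C * (expR (4^-1 * v) * q).
    by rewrite -[leRHS]mul1r; apply: ler_pM.
  have h3 := ler_wpM2r (expR_ge0 (4^-1 * v)) C1.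
  apply: le_trans (lerD h1 h2) _; apply: le_trans h3; apply: ler_eq; ring.
apply: (main (Num.truncn (u / ln 2)).+1) => //.
by rewrite -ler_pdivrMr//; apply: ltW; exact: truncnS_gt.
Qed.

End Remainder.

(** * Quadratic rings of integers and their ideals *)

Section QuadraticField.
Variable F : fieldExtType rat.
Hypothesis hF : quadratic_field F.
Implicit Types (w z : F) (a b : rat).

Lemma exists_irrational : exists w : F, w \notin 1%VS.
Proof.
apply: contrapT => h; have : (fullv <= (1%VS : {vspace F}))%VS.
  apply/subvP => w _; apply: contrapT => hw; apply: h; exists w; exact/negP.
move=> /dimvS; rewrite dimv1; have := hF; rewrite /quadratic_field => ->.
by [].
Qed.

Section Coordinates.
Variable w : F.
Hypothesis w1 : w \notin 1%VS.

Lemma coord_exists z : exists a b, z = a%:A + b *: w.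
Proof.
have full : (1%VS + <[w]>)%VS = fullv :> {vspace F}.
  apply/eqP; rewrite eqEdim subvf /=; have := hF; rewrite /quadratic_field => ->.
  have w0 : w != 0 by apply: contraNneq w1 => ->; exact: mem0v.
  rewrite dimv_disjoint_sum; first by rewrite dimv1 dim_vline w0.
  apply/eqP; rewrite -subv0; apply/subvP => x; rewrite memv_cap => /andP[x1 /vlineP[b xb]].
  rewrite memv0; apply: contraNT w1 => x0.
  have b0 : b != 0 by apply: contraNneq x0 => b0; rewrite xb b0 scale0r.
  have -> : w = b^-1 *: x by rewrite xb scalerA mulVf// scale1r.
  exact: memvZ.
have : z \in (1%VS + <[w]>)%VS by rewrite full memvf.
by move=> /memv_addP[_ /vlineP[a ->] [_ /vlineP[b ->] ->]]; exists a, b.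
Qed.

Lemma coord_inj a b a' b' : a%:A + b *: w = a'%:A + b' *: w -> a = a' /\ b = b'.
Proof.
move=> h; have e : (b - b') *: w = (a' - a)%:A.
  rewrite !scalerBl; move: h; move: (a%:A) (b *: w) (a'%:A) (b' *: w) => A B A' B' h.
  by rewrite (_ : B - B' = (A + B) - A - B'); [rewrite h; ring|ring].
have bb : b = b'.
  apply/eqP; rewrite -subr_eq0; apply: contraNT w1 => bb.
  have -> : w = (b - b')^-1 *: (a' - a)%:A by rewrite -e scalerA mulVf// scale1r.
  by apply: memvZ; apply: memvZ; exact: memv_line.
split=> //; move: e; rewrite bb subrr scale0r => /esym/eqP.
by rewrite scaler_eq0 oner_eq0 orbF subr_eq0 => /eqP ->.
Qed.

Variables (t n : rat).
Hypothesis wE : w * w = t *: w - n%:A.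

(** Used with [K = F] for the conjugation and with [K = algC] for an embedding. *)
Lemma quad_morphism (K : fieldType) (iota : {rmorphism rat -> K}) (theta : K) :
  theta * theta = iota t * theta - iota n ->
  exists phi : {rmorphism F -> K}, phi w = theta /\ forall a, phi a%:A = iota a.
Proof.
move=> thE.
have /choice[c hc] : forall z, exists ab : rat * rat, z = ab.1%:A + ab.2 *: w.
  by move=> z; have [a [b e]] := coord_exists z; exists (a, b).
pose phi z := iota (c z).1 + iota (c z).2 * theta.
have phiE a b : phi (a%:A + b *: w) = iota a + iota b * theta.
  by rewrite /phi; have [<- <-] := coord_inj (hc (a%:A + b *: w)).
have phiB : zmod_morphism phi.
  move=> x y; rewrite (hc x) (hc y) opprD addrACA -!scalerBl !phiE !rmorphB; ring.
have phiM : monoid_morphism phi.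
  split=> [|x y]; first by rewrite -[1 in LHS]scale1r -[1%:A]addr0 -(scale0r w) phiE rmorph1 rmorph0 mul0r addr0.
  rewrite (hc x) (hc y) !phiE.
  move: (c x).1 (c x).2 (c y).1 (c y).2 => a b a' b'.
  have -> : (a%:A + b *: w) * (a'%:A + b' *: w) =
      (a * a' - b * b' * n)%:A + (a * b' + b * a' + b * b' * t) *: w.
    have jE r z : r *: z = in_alg F r * z by rewrite mulr_algl.
    have wE' : w * w = in_alg F t * w - in_alg F n by rewrite wE !jE mulr1.
    rewrite !jE !mulr1 !(rmorphB, rmorphD, rmorphM) /= -!/(in_alg F _).
    move: (in_alg F a) (in_alg F b) (in_alg F a') (in_alg F b') wE' => A B A' B' wE'.
    rewrite (_ : (A + B * w) * (A' + B' * w) = A * A' + (A * B' + B * A') * w + B * B' * (w * w)); last by ring.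
    rewrite wE'; ring.
  rewrite phiE !(rmorphB, rmorphD, rmorphM) /=.
  rewrite [RHS](_ : _ = iota a * iota a' + (iota a * iota b' + iota b * iota a') * theta
     + iota b * iota b' * (theta * theta)); last by ring.
  rewrite thE; ring.
pose phi' : {rmorphism F -> K} := HB.pack phi (GRing.isZmodMorphism.Build F K phi phiB)
  (GRing.isMonoidMorphism.Build F K phi phiM).
exists phi'; split.
  by have := phiE 0 1; rewrite scale0r add0r scale1r rmorph0 rmorph1 add0r mul1r.
by move=> a; have := phiE a 0; rewrite scale0r addr0 rmorph0 mul0r addr0.
Qed.

End Coordinates.

(** The integral equation is transported to [algC], where a rational algebraic integer is known to
    be an integer. *)
Lemma integral_rat a : integralOver (intr : int -> F) a%:A -> a \is a Num.int.
Proof.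
move=> [p pm /rootP pa].
have pa' : (map_poly (intr : int -> rat) p).[a] = 0.
  apply: (fmorph_inj (in_alg F)); rewrite rmorph0 -horner_map /= -map_poly_comp.
  rewrite -[RHS]pa; congr _.[_]; apply: eq_map_poly => i; exact: (rmorph_int (in_alg F)).
have Ca : ratr a \in Crat by exact: Crat_rat.
have : (ratr a : algC) \in Aint.
  apply: (@root_monic_Aint (map_poly intr p)).
  - apply/rootP; have := congr1 (ratr : rat -> algC) pa'; rewrite rmorph0 => <-.
    rewrite -horner_map /= -map_poly_comp; congr _.[_]; apply: eq_map_poly => i /=.
    by rewrite ratr_int.
  - exact: monic_map.
  - by apply/polyOverP => i; rewrite coef_map /=; exact: intr_int.
move=> /(Cint_rat_Aint Ca) /intrP[m]; rewrite -(ratr_int algC m) => /fmorph_inj ->.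
exact: intr_int.
Qed.

End QuadraticField.

(** * An integral basis of minimal discriminant *)

Section IntegralBasis.
Variable F : fieldExtType rat.
Hypothesis hF : quadratic_field F.

Definition quad_gen (w : F) (t n : int) := w \notin 1%VS /\ w * w = t%:~R * w - n%:~R.

Lemma intrF (m : int) : (m%:~R : rat)%:A = m%:~R :> F.
Proof. exact: (rmorph_int (in_alg F)). Qed.

Let iaD (x y : rat) : in_alg F (x + y) = in_alg F x + in_alg F y. Proof. exact: rmorphD. Qed.
Let iaM (x y : rat) : in_alg F (x * y) = in_alg F x * in_alg F y. Proof. exact: rmorphM. Qed.
Let iaZ (m : int) : in_alg F m%:~R = m%:~R. Proof. exact: rmorph_int. Qed.

Lemma quad_gen_rat w t n : quad_gen w t n ->
  w * w = (t%:~R : rat) *: w - (n%:~R : rat)%:A.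
Proof. by move=> [_ ->]; rewrite -(mulr_algl (t%:~R) w) !intrF. Qed.

(** If [w0 ^ 2 = a + b * w0], then [m * w0] has trace [m * b] and norm [- m ^ 2 * a]; both are
    integers when [m] is the product of the denominators. *)
Lemma quad_gen_exists : exists w t n, quad_gen w t n.
Proof.
have [w0 w01] := exists_irrational hF.
have [a [b e]] := coord_exists hF w01 (w0 * w0).
pose m : int := denq a * denq b.
have m0 : (m%:~R : rat) != 0 by rewrite intr_eq0 mulf_neq0 ?denq_neq0.
have m0F : (m%:~R : F) != 0 by rewrite -intrF scaler_eq0 oner_eq0 orbF.
have da : (denq a)%:~R * a = (numq a)%:~R :> rat.
  by rewrite -{2}(divq_num_den a) mulrC divfK// intr_eq0 denq_neq0.
have db : (denq b)%:~R * b = (numq b)%:~R :> rat.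
  by rewrite -{2}(divq_num_den b) mulrC divfK// intr_eq0 denq_neq0.
exists (m%:~R * w0), (denq a * numq b), (- (denq a * denq b * denq b * numq a)); split.
  apply: contra w01 => h; have -> : w0 = (m%:~R : rat)^-1 *: (m%:~R * w0).
    by rewrite -intrF mulr_algl scalerA mulVf// scale1r.
  exact: memvZ.
have jE r (z : F) : r *: z = in_alg F r * z by rewrite mulr_algl.
rewrite (_ : m%:~R * w0 * (m%:~R * w0) = m%:~R * m%:~R * (w0 * w0)); last by ring.
have da' : (denq a)%:~R * in_alg F a = (numq a)%:~R.
  by rewrite -(rmorph_int (in_alg F)) -rmorphM da rmorph_int.
have db' : (denq b)%:~R * in_alg F b = (numq b)%:~R.
  by rewrite -(rmorph_int (in_alg F)) -rmorphM db rmorph_int.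
rewrite e !jE mulr1 /m; move: (in_alg F a) (in_alg F b) da' db' => x y da' db'.
by rewrite !(rmorphN, rmorphM) /= -da' -db'; ring.
Qed.

Lemma quad_gen_integral w t n : quad_gen w t n -> ring_of_integers F w.
Proof.
move=> [_ e]; exists (('X - t%:P) * 'X + n%:P).
  rewrite monicE lead_coefDl ?lead_coefMX ?lead_coefXsubC//.
  by rewrite size_mulX ?polyXsubC_eq0// size_XsubC (leq_ltn_trans (size_polyC_leq1 _)).
apply/rootP; rewrite rmorphD rmorphM rmorphB /= map_polyX !map_polyC /= !hornerE.
by rewrite mulrBl e; ring.
Qed.

Lemma int_integral (m : int) : ring_of_integers F m%:~R.
Proof.
exists ('X - m%:P); first exact: monicXsubC.
by apply/rootP; rewrite rmorphB /= map_polyX map_polyC /= !hornerE subrr.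
Qed.

(** The conjugate [a + b * (t - w)] is a root of the same monic integer polynomial, so the trace and
    the norm are rational and integral. *)
Lemma quad_trace_norm w t n a b : quad_gen w t n -> ring_of_integers F (a%:A + b *: w) ->
  2 * a + b * t%:~R \is a Num.int /\ a * a + a * b * t%:~R + b * b * n%:~R \is a Num.int.
Proof.
move=> g iz; have [w1 _] := g; have e := quad_gen_rat g.
have [phi [pw pa]] : exists phi : {rmorphism F -> F},
    phi w = t%:~R - w /\ forall a, phi a%:A = in_alg F a.
  apply: (quad_morphism hF w1 e); rewrite !(rmorph_int (in_alg F)).
  by have [_ e'] := g; rewrite (_ : _ * _ = t%:~R * t%:~R - 2 * t%:~R * w + w * w); [rewrite e'; ring|ring].
have jE r (z : F) : r *: z = in_alg F r * z by rewrite mulr_algl.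
have ip : ring_of_integers F (phi (a%:A + b *: w)).
  have [p pm /rootP pz] := iz; exists p => //; apply/rootP.
  have := congr1 phi pz; rewrite rmorph0 => <-; rewrite -horner_map /= -map_poly_comp.
  by congr _.[_]; apply: eq_map_poly => i /=; rewrite rmorph_int.
have pz : phi (a%:A + b *: w) = in_alg F a + in_alg F b * (t%:~R - w).
  by rewrite (jE b w) rmorphD rmorphM pw pa (pa b : phi (in_alg F b) = in_alg F b).
have zE : a%:A + b *: w = in_alg F a + in_alg F b * w by rewrite jE.
rewrite pz in ip; rewrite zE in iz.
split; apply: (integral_rat (F := F)); rewrite -/(in_alg F _).
  rewrite (mulr_natl a 2) mulr2n !(iaD, iaM) !iaZ.
  rewrite (_ : _ + _ = (in_alg F a + in_alg F b * w) + (in_alg F a + in_alg F b * (t%:~R - w))).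
    exact: (@integral_add _ _ (intr : {rmorphism int -> F})).
  ring.
rewrite !(iaD, iaM) !iaZ.
rewrite (_ : _ + _ = (in_alg F a + in_alg F b * w) * (in_alg F a + in_alg F b * (t%:~R - w))).
  exact: (@integral_mul _ _ (intr : {rmorphism int -> F})).
have [_ e'] := g; move: (in_alg F a) (in_alg F b) => A B.
rewrite [RHS](_ : _ = A * A + A * B * t%:~R + B * B * (t%:~R * w - w * w)); last by ring.
rewrite e'; ring.
Qed.

Lemma quad_gen_shift w t n a b : quad_gen w t n -> b != 0 ->
  2 * a + b * t%:~R \is a Num.int -> a * a + a * b * t%:~R + b * b * n%:~R \is a Num.int ->
  exists t' n' : int, quad_gen (a%:A + b *: w) t' n' /\
    ((t' ^+ 2 - 4 * n')%:~R = b ^+ 2 * (t ^+ 2 - 4 * n)%:~R :> rat).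
Proof.
move=> g b0 /intrP[t' ht] /intrP[n' hn]; exists t', n'; split; last first.
  by rewrite !(rmorphB, rmorphM, rmorphXn) /= -ht -hn; ring.
have [w1 e'] := g; split.
  apply: contra w1 => h; have -> : w = b^-1 *: ((a%:A + b *: w) - a%:A).
    by rewrite addrC addKr scalerA mulVf// scale1r.
  by apply: memvZ; apply: memvB => //; apply: memvZ; exact: memv_line.
have jE r (z : F) : r *: z = in_alg F r * z by rewrite mulr_algl.
rewrite -(iaZ t') -(iaZ n') -ht -hn (jE b w) -/(in_alg F a).
rewrite (mulr_natl a 2) mulr2n !(iaD, iaM) !iaZ.
move: (in_alg F a) (in_alg F b) => A B.
rewrite (_ : (A + B * w) * _ = A * A + 2 * A * B * w + B * B * (w * w)); last by ring.
rewrite e'; ring.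
Qed.

(* [w] is chosen with minimal discriminant. The last clause expresses maximality: otherwise
   [(w + b) / p] would be integral. *)
Lemma integral_basis : exists (w : F) (t n : int), [/\ quad_gen w t n,
  forall z, ring_of_integers F z <-> exists x y : int, z = x%:~R + y%:~R * w &
  forall p b : int, 1 < p -> (p ^+ 2 %| b ^+ 2 + t * b + n)%Z -> (p %| 2 * b + t)%Z -> False].
Proof.
pose P k := `[< exists w t n, quad_gen w t n /\ absz (t ^+ 2 - 4 * n)%R = k >].
have exP : exists k, P k.
  have [w [t [n g]]] := quad_gen_exists.
  by exists (absz (t ^+ 2 - 4 * n)%R); apply/asboolP; exists w; exists t; exists n; split.
case: (ex_minnP exP) => k /asboolP[w [t [n [g dk]]]] kmin; exists w, t, n.
have [w1 e'] := g.
(* A nonzero discriminant is what lets a factor [b ^ 2 < 1] decrease it strictly. *)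
have D0 : t ^+ 2 - 4 * n != 0.
  apply: contra w1 => /eqP D0; have : (2 * w - t%:~R) ^+ 2 = 0.
    rewrite (_ : _ ^+ 2 = 4 * (w * w - (t%:~R * w - n%:~R)) + (t ^+ 2 - 4 * n)%:~R).
      by rewrite e' subrr mulr0 add0r D0.
    by rewrite !(rmorphB, rmorphM, rmorphXn) /=; ring.
  move/eqP; rewrite sqrf_eq0 subr_eq0 => /eqP h.
  have -> : w = (t%:~R / 2 : rat)%:A.
    have two0 : (2 : F) != 0 by rewrite -[2]/(2%:~R) -intrF scaler_eq0 oner_eq0.
    have e2 : (2 : F) = in_alg F 2 by rewrite rmorph_nat.
    apply: (mulfI two0); rewrite h [in RHS]e2 -(iaZ t) -[(_)%:A]/(in_alg F _) -iaM.
    by congr (in_alg F _); field.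
  by apply: memvZ; exact: memv_line.
(* Such an [a + b * w] would generate with a discriminant [b ^ 2] times the minimal one. *)
have small (a b : rat) : b != 0 -> `|b| < 1 -> 2 * a + b * t%:~R \is a Num.int ->
    a * a + a * b * t%:~R + b * b * n%:~R \is a Num.int -> False.
  move=> b0 b1 h1 h2; have [t' [n' [g' e]]] := quad_gen_shift g b0 h1 h2.
  have : P (absz (t' ^+ 2 - 4 * n')%R).
    by apply/asboolP; exists (a%:A + b *: w); exists t'; exists n'; split.
  move=> /kmin.
  rewrite leqNgt => /negP; apply; rewrite -dk -ltz_nat !abszE -(ltr_int rat) !intr_norm e normrM.
  rewrite -[ltRHS]mul1r ltr_pM2r ?normr_gt0 ?intr_eq0//.
  by rewrite normrX expr_lt1.
split=> //.
- move=> z; split=> [iz|[x [y ->]]]; last first.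
    apply: (@integral_add _ _ (intr : {rmorphism int -> F})); first exact: int_integral.
    apply: (@integral_mul _ _ (intr : {rmorphism int -> F})); first exact: int_integral.
    exact: quad_gen_integral g.
  have [a [b ze]] := coord_exists hF w1 z.
  pose y := Num.floor b; pose b' := b - y%:~R.
  have iz' : ring_of_integers F (a%:A + b' *: w).
    have -> : a%:A + b' *: w = z + - (y%:~R * w).
      by rewrite ze /b' scalerBl -(mulr_algl (y%:~R)) intrF addrA.
    apply: (@integral_add _ _ (intr : {rmorphism int -> F})) => //.
    apply: (@integral_opp _ _ (intr : {rmorphism int -> F})).
    apply: (@integral_mul _ _ (intr : {rmorphism int -> F})); first exact: int_integral.
    exact: quad_gen_integral g.
  have [h1 h2] := quad_trace_norm g iz'.
  have b'0 : b' = 0.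
    apply/eqP; apply: contrapT => /negP b'0; apply: (small a b') => //.
    have := floor_itv b; rewrite -/y /b' => /andP[? ?].
    by rewrite ger0_norm ?subr_ge0// ltrBlDl -[X in _ < _ + X]/(1%:~R) -intrD.
  have : a \is a Num.int.
    by apply: (integral_rat (F := F)); move: iz'; rewrite b'0 scale0r addr0.
  move=> /intrP[x ax]; exists x, y; rewrite ze ax intrF; congr (_ + _).
  by rewrite -(subrK y%:~R b) -/b' b'0 add0r -(intrF y) mulr_algl.
- move=> p b p1 /dvdzP[n' hn'] /dvdzP[t' ht'].
  have p0 : (p%:~R : rat) != 0 by rewrite intr_eq0 gt_eqF// (lt_trans ltr01).
  apply: (small (b%:~R / p%:~R) (p%:~R)^-1); rewrite ?invr_eq0//.
  + by rewrite normfV invf_lt1 ?normr_gt0// -intr_norm (ltr_int rat 1) gtr0_norm// (lt_trans ltr01).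
  + have e2 : (2 * b + t)%:~R = t'%:~R * p%:~R :> rat by rewrite ht' rmorphM.
    have -> : 2 * (b%:~R / p%:~R) + (p%:~R)^-1 * t%:~R = t'%:~R :> rat; last exact: intr_int.
    by apply: (mulIf p0); rewrite -e2 rmorphD rmorphM /=; field.
  + have e2 : (b ^+ 2 + t * b + n)%:~R = n'%:~R * p%:~R ^+ 2 :> rat by rewrite hn' rmorphM rmorphXn.
    set x := (X in X \is a _); have -> : x = n'%:~R; last exact: intr_int.
    apply: (mulIf (expf_neq0 2 p0)); rewrite -e2 /x !rmorphD rmorphM rmorphXn /=; field.
    exact: p0.
Qed.

End IntegralBasis.

(** * Ideals of a quadratic ring in Hermite normal form *)

Section Ideals.
Variables (F : fieldExtType rat) (w : F) (t n : int).
Hypotheses (wgen : quad_gen w t n)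
  (OF : forall z, ring_of_integers F z <-> exists x y : int, z = x%:~R + y%:~R * w).

Let el (x y : int) : F := x%:~R + y%:~R * w.

(** The norm of [b + w], that is the minimal polynomial of [w] evaluated at [- b]. *)
Definition qf (b : int) : int := b ^+ 2 + t * b + n.

Let elD x y x' y' : el x y + el x' y' = el (x + x') (y + y').
Proof. by rewrite /el !rmorphD; ring. Qed.

Let elN x y : - el x y = el (- x) (- y).
Proof. by rewrite /el !mulrNz; ring. Qed.

Let elM x y x' y' : el x y * el x' y' = el (x * x' - n * (y * y')) (x * y' + y * x' + t * (y * y')).
Proof.
have [_ e] := wgen; rewrite /el !(rmorphD, rmorphN, rmorphM) /=.
rewrite [LHS](_ : _ = x%:~R * x'%:~R + (x%:~R * y'%:~R + y%:~R * x'%:~R) * w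
  + y%:~R * y'%:~R * (w * w)); last by ring.
by rewrite e; ring.
Qed.

Let el_inj x y x' y' : el x y = el x' y' -> x = x' /\ y = y'.
Proof.
have [w1 _] := wgen; rewrite /el -!intrF !mulr_algl => h.
by have [/intr_inj -> /intr_inj ->] := coord_inj w1 h.
Qed.

Let el_int x y : ring_of_integers F (el x y).
Proof. by apply/OF; exists x, y. Qed.

(* [(k, a, b)] encodes the ideal [k * (Z a + Z (b + w))]. *)
Definition quad_ideal (kab : nat * nat * nat) : set F :=
  [set z | exists x y : int, [/\ z = x%:~R + y%:~R * w, (kab.1.1%:Z %| y)%Z &
     ((kab.1.1 * kab.1.2)%:Z %| x - kab.2%:Z * y)%Z]].

Let mem_qi k a b x y : quad_ideal (k, a, b) (el x y) <->
  (k%:Z %| y)%Z /\ ((k * a)%:Z %| x - b%:Z * y)%Z.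
Proof.
split=> [[x' [y' [/el_inj[<- <-] h1 h2]]]|[h1 h2]] //; by exists x, y.
Qed.

(** The divisibility makes the lattice stable under multiplication by [w]; [b < a] selects one
    representative modulo [a]. *)
Definition quad_triple (kab : nat * nat * nat) :=
  [&& (0 < kab.1.1)%N, (0 < kab.1.2)%N, (kab.2 < kab.1.2)%N & (kab.1.2%:Z %| qf kab.2%:Z)%Z].

Lemma quad_ideal_ideal kab : quad_triple kab -> is_nonzero_ideal (quad_ideal kab).
Proof.
case: kab => [[k a] b] /and4P[/= k0 a0 ba /dvdzP[m hm]].
have zE x y : x%:~R + y%:~R * w = el x y by [].
split.
- by move=> z [x [y [-> _ _]]]; exact: el_int.
- by exists 0, 0; rewrite mul0r addr0 mulr0 subr0 !dvdz0.
- move=> _ _ [x [y [-> h1 h2]]] [x' [y' [-> h1' h2']]].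
  rewrite !zE elD mem_qi; split; first by rewrite rpredD.
  have -> : x + x' - b%:Z * (y + y') = (x - b%:Z * y) + (x' - b%:Z * y') by ring.
  exact: rpredD.
- move=> u _ /OF[x' [y' ->]] [x [y [-> /dvdzP[j hj] /dvdzP[i hi]]]].
  rewrite !zE elM mem_qi.
  have hx : x = i * (k * a)%:Z + b%:Z * y by rewrite -hi subrK.
  split.
    apply/dvdzP; exists (x' * j + y' * (i * a%:Z + b%:Z * j) + t * (y' * j)).
    by rewrite hx hj PoszM; ring.
  apply/dvdzP; exists (x' * i - y' * (j * m) - b%:Z * y' * i).
  have hn : n = m * a%:Z - b%:Z ^+ 2 - t * b%:Z by rewrite -hm /qf; ring.
  by rewrite hx hj PoszM hn; ring.
- exists (el (k * a)%:Z 0).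
    by rewrite mem_qi dvdz0 mulr0 subr0 dvdzz.
  apply: contraTneq a0 => h; have [e _] : (k * a)%:Z = 0 /\ (0 : int) = 0.
    by apply: el_inj; rewrite h /el mul0r addr0.
  by move/eqP: e; rewrite eqz_nat muln_eq0 (gtn_eqF k0) /= => /eqP ->.
Qed.

(** The ideal determines [k] as its least positive [w]-coordinate, [k * a] as its least positive
    integer, and then [b] modulo [a]. *)
Lemma quad_ideal_inj kab kab' : quad_triple kab -> quad_triple kab' ->
  quad_ideal kab = quad_ideal kab' -> kab = kab'.
Proof.
have half k a b k' a' b' : quad_ideal (k, a, b) = quad_ideal (k', a', b') ->
    (k' %| k)%N /\ (k' * a' %| k * a)%N.
  move=> e; split.
    have : quad_ideal (k, a, b) (el (b%:Z * k%:Z) k%:Z) by rewrite mem_qi dvdzz subrr dvdz0.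
    by rewrite e mem_qi => -[].
  have : quad_ideal (k, a, b) (el (k * a)%:Z 0) by rewrite mem_qi dvdz0 mulr0 subr0 dvdzz.
  by rewrite e mem_qi mulr0 subr0 => -[].
case: kab kab' => [[k a] b] [[k' a'] b'] /and4P[/= k0 a0 ba _] /and4P[/= k0' a0' ba' _] e.
have [h1 h2] := half _ _ _ _ _ _ e; have [h3 h4] := half _ _ _ _ _ _ (esym e).
have kk : k = k' by apply/eqP; rewrite eqn_dvd h1 h3.
subst k'; rewrite !dvdn_pmul2l// in h2 h4.
have aa : a = a' by apply/eqP; rewrite eqn_dvd h2 h4.
subst a'.
have : quad_ideal (k, a, b) (el (b%:Z * k%:Z) k%:Z) by rewrite mem_qi dvdzz subrr dvdz0.
rewrite e mem_qi -mulrBl mulrC PoszM dvdz_mul2l ?eqz_nat ?gtn_eqF// => -[_ h].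
have : (b = b' %[mod a])%N.
  by apply/eqP; rewrite -eqz_nat -!modz_nat eqz_mod_dvd.
by rewrite !modn_small// => ->.
Qed.

(** With [k] the least positive [w]-coordinate and [m] the least positive integer in [I], Euclidean
    division shows that they divide all others; multiplying by elements of the ring then forces [k]
    to divide everything and gives the condition on [b]. *)
Lemma ideal_quad I : is_nonzero_ideal I -> exists2 kab, quad_triple kab & I = quad_ideal kab.
Proof.
move=> [IO I0 ID IM [z0 Iz0 z00]].
have IN x y : I (el x y) -> I (el (- x) (- y)).
  move=> h; have := IM (el (- 1) 0) _ (el_int _ _) h; rewrite elM.
  by congr I; congr el; ring.
have IZ (i : int) x y : I (el x y) -> I (el (i * x) (i * y)).
  move=> h; have := IM (el i 0) _ (el_int _ _) h; rewrite elM.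
  by congr I; congr el; ring.
have IB x y x' y' : I (el x y) -> I (el x' y') -> I (el (x - x') (y - y')).
  by move=> h h'; rewrite -elD; apply: ID => //; exact: IN.
have Iw x y : I (el x y) -> I (el (- n * y) (x + t * y)).
  move=> h; have := IM (el 0 1) _ (el_int _ _) h; rewrite elM.
  by congr I; congr el; ring.
have [x0 [y0 z0E]] := (OF z0).1 (IO _ Iz0); rewrite -/(el x0 y0) in z0E.
rewrite z0E in Iz0 z00.
have exk : exists k, (0 < k)%N && `[< exists x, I (el x k%:Z) >].
  have pos x y : I (el x y) -> y != 0 -> exists k, (0 < k)%N && `[< exists x, I (el x k%:Z) >].
    move=> h y0'; exists `|y|%N; rewrite absz_gt0 y0' /=; apply/asboolP.
    case: (intP y) h => [|m|m] h; [by exists x|by exists x|].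
    by exists (- x); have := IN _ _ h; rewrite opprK abszN.
  have [y00|y00] := eqVneq y0 0; last exact: pos Iz0 y00.
  apply: (pos _ _ (Iw _ _ Iz0)); rewrite y00 mulr0 addr0.
  by apply: contra z00 => /eqP ->; rewrite y00 /el mul0r addr0.
(* The integer is the norm [N] of a nonzero element of [I], its product with its conjugate. *)
have exm : exists m, (0 < m)%N && `[< I (el m%:Z 0) >].
  pose N := x0 ^+ 2 + t * x0 * y0 + n * y0 ^+ 2.
  have IN0 : I (el N 0).
    have := IM (el (x0 + t * y0) (- y0)) _ (el_int _ _) Iz0; rewrite elM.
    by congr I; congr el; rewrite /N; ring.
  have N0 : N != 0.
    apply: contra z00 => /eqP N0.
    have e : el (x0 + t * y0) (- y0) * el x0 y0 = 0.
      transitivity (el N 0); last by rewrite N0 /el mul0r addr0.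
      by rewrite elM /N; congr el; ring.
    move/eqP: e; rewrite mulf_eq0 => /orP[/eqP h|//].
    have [h1 h2] : x0 + t * y0 = 0 /\ - y0 = 0 by apply: el_inj; rewrite h /el mul0r addr0.
    have y00 : y0 = 0 by rewrite -[y0]opprK h2 oppr0.
    by move: h1; rewrite y00 mulr0 addr0 => ->; rewrite /el mul0r addr0.
  exists `|N|%N; rewrite absz_gt0 N0 /=; apply/asboolP.
  case: (intP N) IN0 => [|m|m] h //.
  by have := IN _ _ h; rewrite opprK oppr0 abszN.
case: (ex_minnP exk) => k /andP[k0 /asboolP[B IB0]] kmin.
case: (ex_minnP exm) => m /andP[m0 /asboolP Im] mmin.
have kdiv x y : I (el x y) -> (k%:Z %| y)%Z.
  move=> h; rewrite dvdzE /=; apply/negPn/negP => nd.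
  have h' := IB _ _ _ _ h (IZ (y %/ k%:Z)%Z _ _ IB0).
  have e : y - (y %/ k%:Z)%Z * k%:Z = (y %% k%:Z)%Z by rewrite [in X in X - _](divz_eq y k%:Z) addrC addKr.
  rewrite e in h'.
  have ge0 : 0 <= (y %% k%:Z)%Z by rewrite modz_ge0// eqz_nat gtn_eqF.
  have lt : (y %% k%:Z)%Z < k%:Z by rewrite ltz_pmod// ltz_nat.
  case E : (y %% k%:Z)%Z ge0 lt h' => [q|q] // _; rewrite ltz_nat => qk h'.
  have q0 : (0 < q)%N.
    rewrite lt0n; apply: contra nd => /eqP q0.
    have : (k%:Z %| y)%Z by apply/dvdz_mod0P; rewrite E q0.
    by rewrite dvdzE.
  have : (0 < q)%N && `[< exists x, I (el x q%:Z) >].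
    by rewrite q0; apply/asboolP; exists (x - (y %/ k%:Z)%Z * B).
  by move=> /kmin; rewrite leqNgt qk.
have mdiv x : I (el x 0) -> (m%:Z %| x)%Z.
  move=> h; rewrite dvdzE /=; apply/negPn/negP => nd.
  have h' := IB _ _ _ _ h (IZ (x %/ m%:Z)%Z _ _ Im).
  rewrite mulr0 subr0 in h'.
  have e : x - (x %/ m%:Z)%Z * m%:Z = (x %% m%:Z)%Z by rewrite [in X in X - _](divz_eq x m%:Z) addrC addKr.
  rewrite e in h'.
  have ge0 : 0 <= (x %% m%:Z)%Z by rewrite modz_ge0// eqz_nat gtn_eqF.
  have lt : (x %% m%:Z)%Z < m%:Z by rewrite ltz_pmod// ltz_nat.
  case E : (x %% m%:Z)%Z ge0 lt h' => [q|q] // _; rewrite ltz_nat => qk h'.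
  have q0 : (0 < q)%N.
    rewrite lt0n; apply: contra nd => /eqP q0.
    have : (m%:Z %| x)%Z by apply/dvdz_mod0P; rewrite E q0.
    by rewrite dvdzE.
  have : (0 < q)%N && `[< I (el q%:Z 0) >] by rewrite q0; apply/asboolP.
  by move=> /mmin; rewrite leqNgt qk.
have /dvdzP[a' hma] : (k%:Z %| m%:Z)%Z.
  by have := kdiv _ _ (Iw _ _ Im); rewrite mulr0 addr0.
have [a aE] : exists a : nat, a' = a%:Z.
  case: a' hma => [a _|a hma]; first by exists a.
  by have : (0 : int) <= m%:Z by []; rewrite hma NegzE mulNr oppr_ge0 leNgt -PoszM ltz_nat muln_gt0 k0.
have mE : m = (k * a)%N by apply/eqP; rewrite -eqz_nat hma aE PoszM mulrC.
have a0 : (0 < a)%N by move: m0; rewrite mE muln_gt0 => /andP[].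
(* The product of [w] and [B + k * w] lies in [I] and has [w]-coordinate [B + t * k]. *)
have /dvdzP[b1 hB] : (k%:Z %| B)%Z.
  have h := kdiv _ _ (Iw _ _ IB0).
  by rewrite -(addrK (t * k%:Z) B) rpredB// dvdz_mull.
pose b := `|(b1 %% a%:Z)%Z|%N.
have bE : b%:Z = (b1 %% a%:Z)%Z by rewrite /b gez0_abs// modz_ge0// eqz_nat gtn_eqF.
have ba : (b < a)%N by rewrite -ltz_nat bE ltz_pmod// ltz_nat.
have Ib : I (el (k%:Z * b%:Z) k%:Z).
  have := IB _ _ _ _ IB0 (IZ (b1 %/ a%:Z)%Z _ _ Im); congr I; congr el; last by ring.
  rewrite hB bE mE PoszM {1}(divz_eq b1 a%:Z); ring.
(* The product of [k * (b + w)] and the conjugate of [b + w] is the integer [k * qf b]. *)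
have af : (a%:Z %| qf b%:Z)%Z.
  have : I (el (k%:Z * qf b%:Z) 0).
    have := IM (el (b%:Z + t) (- 1)) _ (el_int _ _) Ib; rewrite elM.
    by congr I; congr el; rewrite /qf; ring.
  by move=> /mdiv; rewrite mE PoszM dvdz_mul2l ?eqz_nat ?gtn_eqF.
exists (k, a, b); first by rewrite /quad_triple /= k0 a0 ba af.
apply/seteqP; split=> z.
  move=> Iz; have [x [y zE]] := (OF z).1 (IO _ Iz); rewrite zE -/(el x y) mem_qi.
  rewrite zE -/(el x y) in Iz; have ky := kdiv _ _ Iz; split=> //.
  have /dvdzP[j hj] := ky.
  have : I (el (x - b%:Z * y) 0).
    have := IB _ _ _ _ Iz (IZ j _ _ Ib); congr I; congr el; rewrite hj; ring.
  by move=> /mdiv; rewrite mE.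
move=> [x [y [-> /dvdzP[j hj] /dvdzP[i hi]]]].
have := ID _ _ (IZ j _ _ Ib) (IZ i _ _ Im); rewrite elD; congr I; rewrite -/(el x y); congr el.
  have -> : x = i * (k * a)%:Z + b%:Z * y by rewrite -hi subrK.
  by rewrite hj mE; ring.
by rewrite hj; ring.
Qed.

(** The elements [x + y * w] with [0 <= x < k * a] and [0 <= y < k] represent each coset once. *)
Lemma quad_ideal_norm k a b : quad_triple (k, a, b) -> ideal_norm (quad_ideal (k, a, b)) = (k * k * a)%N.
Proof.
move=> qt; have /and4P[/= k0 a0 ba hq] := qt.
set I := quad_ideal _.
pose f (p : 'I_(k * a) * 'I_k) : set F := [set el p.1%:Z p.2%:Z + y | y in I].
have [_ I0 ID IM _] := quad_ideal_ideal qt.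
have IN z : I z -> I (- z).
  by move=> h; have := IM (el (- 1) 0) z (el_int _ _) h; rewrite /el rmorphN mul0r addr0 mulN1r.
have cosetP z z' : [set z + y | y in I] = [set z' + y | y in I] <-> I (z - z').
  split=> [e|h].
    have : [set z + y | y in I] z by exists 0 => //; rewrite addr0.
    by rewrite e => -[y Iy <-]; rewrite addrC addKr.
  apply/seteqP; split=> _ [y Iy <-].
    by exists (z - z' + y); [exact: ID|ring].
  by exists (y - (z - z')); [apply: ID => //; exact: IN|ring].
have f_inj : injective f.
  move=> [x y] [x' y'] /cosetP; rewrite /= elN elD /I mem_qi => -[h1 h2].
  have yy : y = y'.
    apply: val_inj => /=; have : (y = y' %[mod k])%N.
      by apply/eqP; rewrite -eqz_nat -!modz_nat eqz_mod_dvd.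
    by rewrite !modn_small.
  rewrite yy subrr mulr0 subr0 in h2.
  have xx : x = x'.
    apply: val_inj => /=; have : (x = x' %[mod k * a])%N.
      by apply/eqP; rewrite -eqz_nat -!modz_nat eqz_mod_dvd.
    by rewrite !modn_small.
  by rewrite xx yy.
rewrite /ideal_norm.
have -> : [set [set x + y | y in I] | x in ring_of_integers F] =
    [set` [fset f p | p in [set: 'I_(k * a) * 'I_k]%SET]%fset].
  apply/seteqP; split=> [_ [z /OF[x [y ->]] <-]|S /imfsetP[p _ ->]]; last first.
    by exists (el p.1%:Z p.2%:Z) => //; exact: el_int.
  rewrite -/(el x y) /=.
  have kN0 : k%:Z != 0 by rewrite eqz_nat gtn_eqF.
  have kaN0 : (k * a)%:Z != 0 by rewrite eqz_nat gtn_eqF// muln_gt0 k0.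
  (* Reducing [y] subtracts a multiple of [k * (b + w)], which lowers [x] by [b * (y - y1)]; only
     then is [x] reduced. *)
  pose y1 := (y %% k%:Z)%Z; pose x1 := ((x - b%:Z * (y - y1)) %% (k * a)%:Z)%Z.
  have y1k : (`|y1| < k)%N by rewrite -ltz_nat gez0_abs ?modz_ge0// ltz_pmod// ltz_nat.
  have x1k : (`|x1| < k * a)%N.
    by rewrite -ltz_nat gez0_abs ?modz_ge0// ltz_pmod// ltz_nat muln_gt0 k0.
  apply/imfsetP; exists (Ordinal x1k, Ordinal y1k); first by rewrite inE.
  rewrite /f /= !gez0_abs ?modz_ge0//; apply/cosetP; rewrite elN elD /I mem_qi; split.
    by rewrite -eqz_mod_dvd /y1 modz_mod.
  rewrite (_ : _ - _ = (x - b%:Z * (y - y1)) - x1); last by ring.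
  by rewrite -eqz_mod_dvd /x1 modz_mod.
rewrite set_fsetK card_imfset//=.
by rewrite -cardE cardsT card_prod !card_ord; ring.
Qed.

End Ideals.

(** * Counting ideals by norm *)

Section Multiplicative.
Variable R : comNzRingType.
Implicit Types g h : nat -> R.

Definition multiplicative g := g 1%N = 1 /\
  forall m n, (0 < m)%N -> (0 < n)%N -> coprime m n -> g (m * n)%N = g m * g n.

Definition conv g h n := \sum_(d <- divisors n) g d * h (n %/ d)%N.

(** A divisor of [m * n] is the product of its gcds with [m] and with [n]. *)
Lemma perm_divisorsM m n : (0 < m)%N -> (0 < n)%N -> coprime m n ->
  perm_eq (divisors (m * n)) [seq (d * e)%N | d <- divisors m, e <- divisors n].
Proof.
move=> m0 n0 cmn; apply: uniq_perm; first exact: divisors_uniq.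
  apply: allpairs_uniq; [exact: divisors_uniq|exact: divisors_uniq|].
  move=> [d e] [d' e'] /allpairsP[[x y] /= [+ + [-> ->]]] /allpairsP[[x' y'] /= [+ + [-> ->]]] /=.
  rewrite -!dvdn_divisors// => xm yn xm' yn' e1.
  have key u v u' v' : (u %| m)%N -> (v %| n)%N -> (u' %| m)%N -> (v' %| n)%N ->
      (u * v = u' * v')%N -> (u %| u')%N.
    move=> um vn um' vn' uv; have : (u %| u' * v')%N by rewrite -uv dvdn_mulr.
    rewrite Gauss_dvdl//; apply: (coprime_dvdl um); exact: coprime_dvdr vn' cmn.
  have xx : x = x' by apply/eqP; rewrite eqn_dvd (key _ _ _ _ xm yn xm' yn' e1) (key _ _ _ _ xm' yn' xm yn (esym e1)).
  have x0 : (0 < x)%N by exact: dvdn_gt0 xm.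
  by subst x'; congr (_, _); move/eqP: e1; rewrite eqn_pmul2l// => /eqP.
move=> d; rewrite -dvdn_divisors ?muln_gt0 ?m0//; apply/idP/allpairsP => [dmn|[[x y] /= [+ + ->]]].
  exists (gcdn d m, gcdn d n); rewrite /= -!dvdn_divisors// !dvdn_gcdr; split=> //.
  apply/eqP; rewrite eqn_dvd; apply/andP; split.
    rewrite muln_gcdr !muln_gcdl !dvdn_gcd (dvdn_mull _ (dvdnn d)) (dvdn_mulr _ (dvdnn d)).
    by rewrite (dvdn_mull _ (dvdnn d)) dmn.
  rewrite Gauss_dvd ?dvdn_gcdl//.
  by apply: (coprime_dvdl (dvdn_gcdr d m)); exact: coprime_dvdr (dvdn_gcdr d n) cmn.
by rewrite -!dvdn_divisors// => ? ?; exact: dvdn_mul.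
Qed.

Lemma conv_multiplicative g h : multiplicative g -> multiplicative h -> multiplicative (conv g h).
Proof.
move=> [g1 gM] [h1 hM]; split.
  by rewrite /conv (_ : divisors 1 = [:: 1%N])// big_seq1 divn1 g1 h1 mulr1.
move=> m n m0 n0 cmn; rewrite /conv (perm_big _ (perm_divisorsM m0 n0 cmn)) /=.
rewrite big_allpairs_dep /= mulr_suml big_seq [RHS]big_seq; apply: eq_bigr => d.
rewrite -dvdn_divisors// => dm; rewrite mulr_sumr big_seq [RHS]big_seq; apply: eq_bigr => e.
rewrite -dvdn_divisors// => en.
have d0 := dvdn_gt0 m0 dm; have e0 := dvdn_gt0 n0 en.
have -> : (m * n %/ (d * e) = (m %/ d) * (n %/ e))%N.
  by rewrite -{1}(divnK dm) -{1}(divnK en) mulnACA (mulnC _ (d * e)%N) mulKn// muln_gt0 d0 e0.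
have cde : coprime d e by apply: (coprime_dvdl dm); exact: coprime_dvdr en cmn.
have cq : coprime (m %/ d) (n %/ e).
  by apply: (coprime_dvdl (dvdn_div dm)); exact: coprime_dvdr (dvdn_div en) cmn.
rewrite gM// hM ?divn_gt0 ?(dvdn_leq m0 dm) ?(dvdn_leq n0 en)//; ring.
Qed.

Lemma perm_divisors_pow p e : prime p ->
  perm_eq (divisors (p ^ e)) [seq (p ^ i)%N | i <- iota 0 e.+1].
Proof.
move=> pp; apply: uniq_perm; first exact: divisors_uniq.
  rewrite map_inj_uniq ?iota_uniq// => i j /eqP; rewrite eqn_exp2l ?prime_gt1//.
  by move/eqP.
move=> d; rewrite -dvdn_divisors ?expn_gt0 ?prime_gt0//; apply/(dvdn_pfactor _ _ pp)/mapP.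
  by move=> [i ie ->]; exists i => //; rewrite mem_iota add0n ltnS.
by move=> [j]; rewrite mem_iota add0n ltnS => ie ->; exists j.
Qed.

Lemma conv_prime_pow g h p e : prime p ->
  conv g h (p ^ e) = \sum_(i < e.+1) g (p ^ i)%N * h (p ^ (e - i))%N.
Proof.
move=> pp; rewrite /conv (perm_big _ (perm_divisors_pow e pp)) big_map.
rewrite -[iota 0 e.+1]/(index_iota 0 e.+1) big_mkord; apply: eq_bigr => i _.
by rewrite -expnB ?prime_gt0// leq_ord.
Qed.

(** Strong induction on [n], splitting off the full power of its least prime factor. *)
Lemma multiplicative_eq g h : multiplicative g -> multiplicative h ->
  (forall p e, prime p -> g (p ^ e)%N = h (p ^ e)%N) -> forall n, (0 < n)%N -> g n = h n.
Proof.
move=> [g1 gM] [h1 hM] gh n; have [m] := ubnP n; elim: m n => // m IH n nm n0.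
case: (ltnP 1 n) => [n1|]; last first.
  by rewrite leq_eqVlt ltnS leqNgt n0 orbF => /eqP ->; rewrite g1 h1.
pose p := pdiv n; have pp : prime p by exact: pdiv_prime.
have [k cpk nE] := pfactor_coprime pp n0.
have l0 : (0 < logn p n)%N by rewrite logn_gt0 mem_primes pp n0 pdiv_dvd.
have k0 : (0 < k)%N by move: n0; rewrite nE muln_gt0 => /andP[].
have kn : (k < n)%N.
  by rewrite [X in (_ < X)%N]nE -[X in (X < _)%N]muln1 ltn_pmul2l// -(expn0 p) ltn_exp2l ?prime_gt1.
have ck : coprime k (p ^ logn p n) by rewrite coprime_sym coprimeXl.
have pe0 : (0 < p ^ logn p n)%N by rewrite expn_gt0 prime_gt0.
rewrite nE gM// hM// gh// IH//; exact: leq_trans kn _.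
Qed.

Variable cp : nat -> R.

(** At 0 the product is empty, so the value there is 1. *)
Definition cmul n := \prod_(p <- primes n) cp p ^+ logn p n.

(** Over a common range of primes the products for [m], [n] and [m * n] can be compared factor by
    factor. *)
Lemma cmulE M n : (0 < n)%N -> (n <= M)%N -> cmul n = \prod_(0 <= p < M.+1 | prime p) cp p ^+ logn p n.
Proof.
move=> n0 nM; rewrite /cmul.
rewrite [RHS](bigID (fun p => p %| n)%N) /= [X in _ = _ * X]big1 ?mulr1; last first.
  by move=> p /andP[pp pn]; rewrite lognE pp n0 (negbTE pn) expr0.
rewrite -[RHS]big_filter; apply: perm_big; apply: uniq_perm; first exact: primes_uniq.
  by apply: filter_uniq; exact: iota_uniq.
move=> p; rewrite mem_primes mem_filter mem_index_iota n0 /=.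
by case: (boolP (prime p)) => //= pp; case: (boolP (p %| n)%N) => //= /(dvdn_leq n0) pn; rewrite ltnS (leq_trans pn).
Qed.

Lemma cmulM m n : (0 < m)%N -> (0 < n)%N -> cmul (m * n) = cmul m * cmul n.
Proof.
move=> m0 n0; have mn0 : (0 < m * n)%N by rewrite muln_gt0 m0.
rewrite (cmulE mn0 (leqnn _)) (@cmulE (m * n) m)// ?leq_pmulr// (@cmulE (m * n) n)// ?leq_pmull//.
by rewrite -big_split; apply: eq_bigr => p pp; rewrite lognM// exprD.
Qed.

Lemma cmul1 : cmul 1 = 1.
Proof. by rewrite /cmul big_nil. Qed.

Lemma cmul_prime p : prime p -> cmul p = cp p.
Proof. by move=> pp; rewrite /cmul primes_prime// big_seq1 logn_prime// eqxx expr1. Qed.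

Lemma cmulX m e : (0 < m)%N -> cmul (m ^ e) = cmul m ^+ e.
Proof.
move=> m0; elim: e => [|e IH]; first by rewrite cmul1.
by rewrite expnS cmulM ?expn_gt0 ?m0// IH exprS.
Qed.

Lemma cmul_multiplicative : multiplicative cmul.
Proof. by split=> [|m n m0 n0 _]; [exact: cmul1|exact: cmulM]. Qed.

End Multiplicative.

(** * Roots of the norm polynomial modulo prime powers *)

Section RootCount.
Variables (t n : int).
Hypothesis hmax : forall p b : int, 1 < p -> (p ^+ 2 %| qf t n b)%Z -> (p %| 2 * b + t)%Z -> False.
Local Notation f := (qf t n).

Let qf_sub x y : f x - f y = (x - y) * (x + y + t).
Proof. by rewrite /qf; ring. Qed.

Let qf_mod a x y : (a %| x - y)%Z -> (a %| f x)%Z = (a %| f y)%Z.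
Proof.
by move=> h; rewrite -[f x](subrK (f y)) rpredDl// qf_sub dvdz_mulr.
Qed.

Let PoszX (p k : nat) : (p ^ k)%N%:Z = p%:Z ^+ k.
Proof. by elim: k => // k IH; rewrite expnS exprS PoszM IH. Qed.

Definition good a b := (a%:Z %| f b%:Z)%Z.

Definition roots a := [seq b <- iota 0 a | good a b].

Let good_mod a b c : b = c %[mod a] -> good a b = good a c.
Proof.
by move=> /eqP h; apply: qf_mod; rewrite -eqz_mod_dvd !modz_nat eqz_nat.
Qed.

Let mem_roots a b : (b \in roots a) = (b < a)%N && good a b.
Proof. by rewrite mem_filter mem_iota /= andbC. Qed.

Let roots_uniq a : uniq (roots a).
Proof. by rewrite filter_uniq ?iota_uniq. Qed.

Lemma roots_int a (x : int) : (0 < a)%N -> exists2 b, (b < a)%N & (a%:Z %| b%:Z - x)%Z.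
Proof.
move=> a0; have aN0 : a%:Z != 0 by rewrite eqz_nat gtn_eqF.
have h0 : 0 <= (x %% a%:Z)%Z by rewrite modz_ge0.
exists `|(x %% a%:Z)%Z|%N; first by rewrite -ltz_nat gez0_abs// ltz_pmod// ltz_nat.
by rewrite gez0_abs// -eqz_mod_dvd modz_mod.
Qed.

Lemma size_roots1 : size (roots 1) = 1%N.
Proof. by rewrite /roots /= /good dvd1z. Qed.

Let goodM m1 m2 b : coprime m1 m2 -> good (m1 * m2) b = good m1 b && good m2 b.
Proof. by move=> c; rewrite /good !dvdzE /= Gauss_dvd. Qed.

Lemma size_rootsM m1 m2 : (0 < m1)%N -> (0 < m2)%N -> coprime m1 m2 ->
  size (roots (m1 * m2)) = (size (roots m1) * size (roots m2))%N.
Proof.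
move=> m10 m20 c; rewrite -(size_allpairs (fun x y => chinese m1 m2 x y %% (m1 * m2))%N).
have m0 : (0 < m1 * m2)%N by rewrite muln_gt0 m10.
have modl x y : (chinese m1 m2 x y %% (m1 * m2) = x %[mod m1])%N.
  by rewrite modn_dvdm ?dvdn_mulr// chinese_modl.
have modr x y : (chinese m1 m2 x y %% (m1 * m2) = y %[mod m2])%N.
  by rewrite modn_dvdm ?dvdn_mull// chinese_modr.
apply: perm_size; apply: uniq_perm => //.
  apply: allpairs_uniq => //.
  move=> [x y] [x' y'] /allpairsP[[x1 y1] /= [+ + [-> ->]]] /allpairsP[[x2 y2] /= [+ + [-> ->]]] /=.
  rewrite !mem_roots => /andP[h1 _] /andP[h2 _] /andP[h3 _] /andP[h4 _] e.
  have := modl x1 y1; rewrite e modl !modn_small// => ->.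
  by have := modr x1 y1; rewrite e modr !modn_small// => ->.
move=> b; rewrite mem_roots goodM//; apply/andP/allpairsP.
  move=> [bm /andP[g1 g2]]; exists (b %% m1, b %% m2)%N; rewrite /= !mem_roots !ltn_pmod//=; split.
  - by rewrite (good_mod (c := b)) ?modn_mod.
  - by rewrite (good_mod (c := b)) ?modn_mod.
  - by rewrite -chinese_mod// modn_small.
move=> [[x y] /= []]; rewrite !mem_roots => /andP[_ gx] /andP[_ gy] ->.
by rewrite ltn_pmod// (good_mod (modl x y)) (good_mod (modr x y)) gx gy.
Qed.

(** The roots are [x] and [- x - t], because [f y - f x = (y - x) * (y + x + t)]. As [p] does not
    divide [2 * x + t], it divides at most one of the two factors, and the roots are distinct. *)
Lemma size_roots_two p j x : prime p -> (p%:Z ^+ j.+1 %| f x)%Z -> ~~ (p%:Z %| 2 * x + t)%Z ->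
  size (roots (p ^ j.+1)) = 2.
Proof.
move=> pp fx nd; set q := (p ^ j.+1)%N.
have q0 : (0 < q)%N by rewrite expn_gt0 prime_gt0.
have qE : q%:Z = p%:Z ^+ j.+1 by rewrite /q PoszX.
have pq : (p%:Z %| q%:Z)%Z by rewrite qE exprS dvdz_mulr.
have [b bq bx] := roots_int x q0; have [c cq cx] := roots_int (- x - t) q0.
have fb : (q%:Z %| f b%:Z)%Z by rewrite (qf_mod bx) qE.
have bct : (q%:Z %| b%:Z + c%:Z + t)%Z.
  have -> : b%:Z + c%:Z + t = (b%:Z - x) + (c%:Z - (- x - t)) by ring.
  exact: rpredD.
have fc : (q%:Z %| f c%:Z)%Z.
  rewrite -[f c%:Z](subrK (f b%:Z)) rpredD// qf_sub dvdz_mull//.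
  by rewrite (_ : c%:Z + b%:Z + t = b%:Z + c%:Z + t)//; ring.
have nd' y : (p%:Z %| y - x)%Z -> (p%:Z %| y + x + t)%Z -> False.
  move=> h1 h2; move/negP: nd; apply.
  have -> : 2 * x + t = (y + x + t) - (y - x) by ring.
  exact: rpredB.
have bc : b != c.
  apply/eqP => bc; apply: (@nd' b%:Z); first exact: dvdz_trans pq bx.
  have -> : b%:Z + x + t = b%:Z - (- x - t) by ring.
  by rewrite bc; exact: dvdz_trans pq cx.
suff -> : size (roots q) = size [:: b; c] by [].
apply: perm_size; apply: uniq_perm => //; first by rewrite /= inE bc.
move=> y; rewrite mem_roots !inE; apply/andP/orP => [[yq]|[/eqP ->|/eqP ->]] //.
rewrite /good -[f y%:Z](subrK (f b%:Z)) rpredDr// qf_sub => h.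
have eqm z : (z < q)%N -> (q%:Z %| y%:Z - z%:Z)%Z -> y == z.
  move=> zq; rewrite -eqz_mod_dvd !modz_nat eqz_nat => /eqP.
  by rewrite !modn_small// => ->.
have [pb|pb] := boolP (p%:Z %| y%:Z - b%:Z)%Z; [left; apply: eqm => //|right; apply: eqm => //].
  have cop : coprimez q%:Z (y%:Z + b%:Z + t).
    rewrite qE coprimezE abszX /= coprimeXl// prime_coprime//; apply/negP => h2.
    apply: (@nd' y%:Z).
      have -> : y%:Z - x = (y%:Z - b%:Z) + (b%:Z - x) by ring.
      by apply: rpredD => //; exact: dvdz_trans pq bx.
    have -> : y%:Z + x + t = (y%:Z + b%:Z + t) - (b%:Z - x) by ring.
    by apply: rpredB => //; exact: dvdz_trans pq bx.
  by move: h; rewrite Gauss_dvdzl.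
have cop : coprimez q%:Z (y%:Z - b%:Z).
  by rewrite qE coprimezE abszX /= coprimeXl// prime_coprime.
move: h; rewrite Gauss_dvdzr// => h.
have -> : y%:Z - c%:Z = (y%:Z + b%:Z + t) - (b%:Z + c%:Z + t) by ring.
exact: rpredB.
Qed.

(** Newton's correction, with [u] an inverse modulo [p] of the derivative [2 * x + t]. *)
Lemma hensel p j x : prime p -> (p%:Z ^+ j.+1 %| f x)%Z -> ~~ (p%:Z %| 2 * x + t)%Z ->
  exists2 y, (p%:Z ^+ j.+2 %| f y)%Z & ~~ (p%:Z %| 2 * y + t)%Z.
Proof.
move=> pp /dvdzP[m hm] nd.
have /coprimezP[[u v] /= uv] : coprimez (2 * x + t) p%:Z.
  by rewrite coprimezE coprime_sym prime_coprime.
exists (x - p%:Z ^+ j.+1 * (u * m)).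
  rewrite (_ : f _ = f x - p%:Z ^+ j.+1 * (u * m) * (2 * x + t) + (p%:Z ^+ j.+1 * (u * m)) ^+ 2); last by rewrite /qf; ring.
  have vE : v * p%:Z = 1 - u * (2 * x + t) by move: uv; rewrite addrC => /(canRL (addrK _)).
  have h1 : (p%:Z ^+ j.+2 %| f x - p%:Z ^+ j.+1 * (u * m) * (2 * x + t))%Z.
    have -> : f x - p%:Z ^+ j.+1 * (u * m) * (2 * x + t) = p%:Z ^+ j.+2 * (m * v).
      rewrite hm; transitivity (p%:Z ^+ j.+1 * m * (v * p%:Z)); first by rewrite vE; ring.
      by rewrite (exprS _ j.+1); ring.
    exact: dvdz_mulr.
  apply: (rpredD h1).
  by rewrite exprMn -exprM dvdz_mulr// dvdz_exp2l//; lia.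
apply: contra nd => h.
have -> : 2 * x + t = (2 * (x - p%:Z ^+ j.+1 * (u * m)) + t) + p%:Z * (2 * (p%:Z ^+ j * (u * m))).
  by rewrite exprS; ring.
by rewrite rpredD// dvdz_mulr.
Qed.

Lemma size_roots_split p x : prime p -> (p%:Z %| f x)%Z -> ~~ (p%:Z %| 2 * x + t)%Z ->
  forall j, size (roots (p ^ j.+1)) = 2.
Proof.
move=> pp fx nd j.
have [y fy ny] : exists2 y, (p%:Z ^+ j.+1 %| f y)%Z & ~~ (p%:Z %| 2 * y + t)%Z.
  by elim: j => [|j [y fy ny]]; [exists x|exact: hensel fy ny].
exact: size_roots_two fy ny.
Qed.

(** Modulo [p] the difference [f y - f x] is [(y - x) ^ 2], so the root is unique; a root modulo
    [p ^ 2] would contradict the maximality [hmax]. *)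
Lemma size_roots_ram p x : prime p -> (p%:Z %| f x)%Z -> (p%:Z %| 2 * x + t)%Z ->
  size (roots p) = 1%N /\ forall j, size (roots (p ^ j.+2)) = 0.
Proof.
move=> pp fx ram; have p0 := prime_gt0 pp.
have all y : (p%:Z %| f y)%Z -> (p%:Z %| y - x)%Z.
  rewrite -[f y](subrK (f x)) rpredDr// qf_sub => h.
  have : (p%:Z %| (y - x) * (y + x + t))%Z by exact: h.
  rewrite dvdzE abszM Euclid_dvdM// => /orP[//|h2].
  have -> : y - x = (y + x + t) - (2 * x + t) by ring.
  exact: rpredB.
split.
  have [b bq bx] := roots_int x p0.
  suff -> : size (roots p) = size [:: b] by [].
  apply: perm_size; apply: uniq_perm => // y.
  rewrite mem_roots !inE; apply/andP/eqP => [[yp gy]|->]; last first.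
    by split=> //; rewrite /good (qf_mod bx).
  have : (p%:Z %| y%:Z - b%:Z)%Z.
    have -> : y%:Z - b%:Z = (y%:Z - x) - (b%:Z - x) by ring.
    by rewrite rpredB// all.
  by rewrite -eqz_mod_dvd !modz_nat eqz_nat => /eqP; rewrite !modn_small.
move=> j; apply/eqP; rewrite size_eq0; apply/eqP.
case E : (roots _) => [//|y s]; have : y \in roots (p ^ j.+2) by rewrite E mem_head.
rewrite mem_roots => /andP[_ gy].
have g2 : (p%:Z ^+ 2 %| f y%:Z)%Z.
  by apply: dvdz_trans gy; rewrite PoszX dvdz_exp2l.
case: (@hmax p%:Z y%:Z) => //; first by rewrite ltz_nat prime_gt1.
have g1 : (p%:Z %| f y%:Z)%Z by apply: dvdz_trans g2; rewrite expr2 dvdz_mulr.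
have -> : 2 * y%:Z + t = (2 * x + t) + (y%:Z - x) * 2 by ring.
by rewrite rpredD// dvdz_mulr// all.
Qed.

Lemma size_roots_inert p : (0 < p)%N -> (forall x, ~~ (p%:Z %| f x)%Z) ->
  forall j, size (roots (p ^ j.+1)) = 0.
Proof.
move=> p0 h j; apply/eqP; rewrite size_eq0; apply/eqP.
case E : (roots _) => [//|y s]; have : y \in roots (p ^ j.+1) by rewrite E mem_head.
rewrite mem_roots => /andP[_ gy]; have /negP[] := h y%:Z.
by apply: dvdz_trans gy; rewrite PoszX exprS dvdz_mulr.
Qed.

(** The inert, the ramified and the split primes, in this order. *)
Lemma size_roots_prime_pow p : prime p ->
  [\/ forall j, size (roots (p ^ j.+1)) = 0,
      size (roots p) = 1%N /\ (forall j, size (roots (p ^ j.+2)) = 0) |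
      forall j, size (roots (p ^ j.+1)) = 2].
Proof.
move=> pp; have [[x fx]|nx] := pselect (exists x, (p%:Z %| f x)%Z).
  have [ram|nram] := boolP (p%:Z %| 2 * x + t)%Z.
    by constructor 2; exact: size_roots_ram fx ram.
  by constructor 3; exact: size_roots_split fx nram.
by constructor 1; apply: size_roots_inert; [exact: prime_gt0|move=> x; apply/negP => h; apply: nx; exists x].
Qed.

Let disc : int := t ^+ 2 - 4 * n.

(** Since [(p + 1) / 2] inverts 2, every residue has the form [2 * x + t]: roots of [f] correspond
    to square roots of the discriminant. *)
Let half p z : prime p -> odd p -> exists x, (p%:Z %| 2 * x + t - z)%Z.
Proof.
move=> pp op; exists ((z - t) * (p.+1)./2%:Z).
have e : 2 * (p.+1)./2%:Z = p%:Z + 1.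
  by rewrite -PoszD -PoszM; congr Posz; rewrite mul2n addn1 halfK /= op subn0.
have -> : 2 * ((z - t) * (p.+1)./2%:Z) + t - z = p%:Z * (z - t).
  have -> : 2 * ((z - t) * (p.+1)./2%:Z) = (z - t) * (2 * (p.+1)./2%:Z) by ring.
  by rewrite e; ring.
by rewrite dvdz_mulr.
Qed.

Let dvd_disc p x : prime p -> odd p -> (p%:Z %| f x)%Z = (p%:Z %| (2 * x + t) ^+ 2 - disc)%Z.
Proof.
move=> pp op; have -> : (2 * x + t) ^+ 2 - disc = 4 * f x by rewrite /qf /disc; ring.
rewrite Gauss_dvdzr// coprimezE (_ : absz 4%R = (2 ^ 2)%N)// coprimeXr// prime_coprime// dvdn_prime2//.
by apply: contraTneq op => /= ->.
Qed.

Lemma size_roots_disc0 p : prime p -> odd p -> (p%:Z %| disc)%Z -> size (roots p) = 1%N.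
Proof.
move=> pp op pD; have [x hx] := half 0 pp op; rewrite subr0 in hx.
have fx : (p%:Z %| f x)%Z by rewrite dvd_disc// rpredB// expr2 dvdz_mulr.
by case: (size_roots_ram pp fx hx).
Qed.

Lemma size_roots_square p z : prime p -> odd p -> ~~ (p%:Z %| disc)%Z ->
  (p%:Z %| z ^+ 2 - disc)%Z -> size (roots p) = 2.
Proof.
move=> pp op pD pz; have [x hx] := half z pp op.
have nz : ~~ (p%:Z %| 2 * x + t)%Z.
  apply: contra pD => h.
  have -> : disc = (2 * x + t) ^+ 2 - ((2 * x + t - z) * (2 * x + t + z) + (z ^+ 2 - disc)) by ring.
  apply: rpredB; first by rewrite expr2 dvdz_mulr.
  by apply: rpredD => //; rewrite dvdz_mulr.
have fx : (p%:Z %| f x)%Z.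
  rewrite dvd_disc//.
  have -> : (2 * x + t) ^+ 2 - disc = (2 * x + t - z) * (2 * x + t + z) + (z ^+ 2 - disc) by ring.
  by rewrite rpredD// dvdz_mulr.
by have := size_roots_split pp fx nz 0; rewrite expn1.
Qed.

Lemma size_roots_nonsquare p : prime p -> odd p ->
  (forall z, ~~ (p%:Z %| z ^+ 2 - disc)%Z) -> size (roots p) = 0.
Proof.
move=> pp op h; have := @size_roots_inert p (prime_gt0 pp) _ 0; rewrite expn1; apply => x.
by rewrite dvd_disc.
Qed.

Definition root_char : nat -> int := cmul (fun p => (size (roots p))%:Z - 1).

Definition issq (d : nat) := has (fun k : nat => k * k == d)%N (iota 0 d.+1).

Lemma issqP d : reflect (exists k, d = k * k)%N (issq d).
Proof.
apply: (iffP hasP) => [[k _ /eqP <-]|[k ->]]; first by exists k.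
by exists k => //; rewrite mem_iota add0n ltnS /= ; case: k => // k; exact: leq_pmulr.
Qed.

Let gcd_sq m k k' : coprime m k' -> (m * k' = k * k)%N -> (gcdn k m * gcdn k m %| m)%N.
Proof.
move=> c e; have : (gcdn k m * gcdn k m %| m * k')%N by rewrite e dvdn_mul ?dvdn_gcdl.
rewrite Gauss_dvdl// coprimeMl; apply/andP; split.
  by apply: (coprime_dvdl (dvdn_gcdr k m)).
by apply: (coprime_dvdl (dvdn_gcdr k m)).
Qed.

(** If [m1 * m2 = k ^ 2], then [k] is the product of its gcds with [m1] and [m2]; the squares of
    these divide [m1] and [m2], and equal them by comparing products. *)
Lemma issqM m1 m2 : (0 < m1)%N -> (0 < m2)%N -> coprime m1 m2 ->
  issq (m1 * m2) = issq m1 && issq m2.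
Proof.
move=> m10 m20 c; apply/issqP/andP => [[k e]|[/issqP[k ->] /issqP[k' ->]]]; last first.
  by exists (k * k')%N; ring.
have kE : k = (gcdn k m1 * gcdn k m2)%N.
  apply/eqP; rewrite eqn_dvd; apply/andP; split.
    rewrite muln_gcdr !muln_gcdl !dvdn_gcd (dvdn_mull _ (dvdnn k)) (dvdn_mulr _ (dvdnn k)).
    by rewrite (dvdn_mull _ (dvdnn k)) e dvdn_mulr.
  rewrite Gauss_dvd ?dvdn_gcdl//.
  by apply: (coprime_dvdl (dvdn_gcdr k m1)); exact: coprime_dvdr (dvdn_gcdr k m2) c.
have d1 := gcd_sq c e.
have d2 : (gcdn k m2 * gcdn k m2 %| m2)%N by apply: (@gcd_sq _ _ m1); rewrite 1?coprime_sym// mulnC.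
have l1 := dvdn_leq m10 d1; have l2 := dvdn_leq m20 d2.
have pe : (m1 * m2 = (gcdn k m1 * gcdn k m1) * (gcdn k m2 * gcdn k m2))%N.
  by rewrite e {1 2}kE; ring.
have g1 : (0 < gcdn k m1 * gcdn k m1)%N by rewrite muln_gt0 gcdn_gt0 m10 orbT.
have g2 : (0 < gcdn k m2 * gcdn k m2)%N by rewrite muln_gt0 gcdn_gt0 m20 orbT.
split; apply/issqP.
  by exists (gcdn k m1); apply/eqP; rewrite eqn_leq l1 andbT -(leq_pmul2r g2) -pe leq_pmul2l.
by exists (gcdn k m2); apply/eqP; rewrite eqn_leq l2 andbT -(leq_pmul2l g1) -pe leq_pmul2r.
Qed.

Lemma issq_prime_pow p e : prime p -> issq (p ^ e) = ~~ odd e.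
Proof.
move=> pp; apply/issqP/idP => [[k e1]|oe]; last first.
  exists (p ^ e./2)%N; rewrite -expnD addnn -{1}(odd_double_half e) (negbTE oe).
  by [].
have : (k %| p ^ e)%N by rewrite e1 dvdn_mulr.
move=> /(dvdn_pfactor _ _ pp)[i _ kE]; move/eqP: e1.
by rewrite kE -expnD eqn_exp2l ?prime_gt1// => /eqP ->; rewrite addnn odd_double.
Qed.

Let sq (d : nat) : int := (issq d)%:Z.

(* On the powers of a prime both sides satisfy the same two-step recursion. *)
Lemma conv_square_roots m : (0 < m)%N ->
  conv sq (fun a => (size (roots a))%:Z) m = conv root_char (fun=> 1) m.
Proof.
move: m; apply: multiplicative_eq.
- apply: conv_multiplicative.
    split=> [|m1 m2 m10 m20 c]; first by rewrite /sq (_ : issq 1)//; apply/issqP; exists 1%N.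
    by rewrite /sq issqM// -mulnb PoszM.
  split=> [|m1 m2 m10 m20 c]; first by rewrite size_roots1.
  by rewrite size_rootsM// PoszM.
- apply: conv_multiplicative; first exact: cmul_multiplicative.
  by split=> [//|m1 m2 _ _ _]; rewrite mulr1.
move=> p e pp; rewrite !conv_prime_pow//.
pose V e := \sum_(j < e.+1) sq (p ^ j)%N * (size (roots (p ^ (e - j))))%:Z.
pose W e := \sum_(j < e.+1) root_char (p ^ j)%N * 1.
rewrite -/(V e) -/(W e).
have VS k : V k.+2 = (size (roots (p ^ k.+2)))%:Z + V k.
  rewrite /V big_ord_recl big_ord_recl /= /sq !issq_prime_pow//= mul1r mul0r add0r subn0.
  by congr +%R; apply: eq_bigr => j _; rewrite !issq_prime_pow//= negbK !subSS.
have cX j : root_char (p ^ j)%N = ((size (roots p))%:Z - 1) ^+ j.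
  by rewrite /root_char cmulX ?prime_gt0// cmul_prime.
have WS k : W k.+2 = W k + ((size (roots p))%:Z - 1) ^+ k.+1 + ((size (roots p))%:Z - 1) ^+ k.+2.
  by rewrite /W big_ord_recr big_ord_recr /= !mulr1 !cX.
have VW0 : V 0 = W 0.
  by rewrite /V /W !big_ord_recl !big_ord0 /= /sq issq_prime_pow//= cX !expn0 size_roots1.
have VW1 : V 1%N = W 1%N.
  rewrite /V /W !big_ord_recl !big_ord0 /= /sq !issq_prime_pow//= !cX expr0 expr1 subn0 expn1.
  by ring.
suff [//] : V e = W e /\ V e.+1 = W e.+1.
elim: e => [//|k [h0 h1]]; split=> //.
rewrite VS WS h0 [_ + W k]addrC -addrA; congr +%R.
(* The last two powers cancel, vanish or add up to 2 in the inert, ramified and split cases: each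
   time the number of roots modulo [p ^ k.+2]. *)
case: (size_roots_prime_pow pp) => [h|[hp h]|h].
- have := h 0; rewrite expn1 h => ->; by rewrite sub0r !exprS !mulN1r opprK addNr.
- by rewrite h hp subrr !expr0n.
- by have := h 0; rewrite expn1 h => ->; rewrite (_ : 2%:Z - 1 = 1)// !expr1n.
Qed.

Lemma root_char_values p : prime p -> [\/ root_char p = - 1, root_char p = 0 | root_char p = 1].
Proof.
move=> pp; rewrite /root_char cmul_prime//.
case: (size_roots_prime_pow pp) => [h|[-> _]|h].
- by constructor 1; have := h 0; rewrite expn1 => ->.
- by constructor 2.
- by constructor 3; have := h 0; rewrite expn1 => ->.
Qed.

End RootCount.

(** * Enumeration of the ideals of given norm *)

Section IdealLists.
Variables (F : fieldExtType rat) (w : F) (t n : int).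
Hypotheses (wgen : quad_gen w t n)
  (OF : forall z, ring_of_integers F z <-> exists x y : int, z = x%:~R + y%:~R * w).

(** In [iota 0 d.+1] the index found is the root itself; for a nonsquare the result is [d.+1]. *)
Definition sqroot (d : nat) : nat := find (fun k : nat => k * k == d)%N (iota 0 d.+1).

Lemma sqroot_sq d : issq d -> d = (sqroot d * sqroot d)%N.
Proof.
move=> sd; have := nth_find 0%N sd; rewrite nth_iota ?add0n; last first.
  by rewrite -[X in (_ < X)%N](size_iota 0) -has_find.
by move/eqP.
Qed.

Definition norm_triples (m : nat) : seq (nat * nat * nat) :=
  [seq (sqroot d, m %/ d, b)%N | d <- [seq d <- divisors m | issq d], b <- roots t n (m %/ d)].

Lemma mem_norm_triples m k a b : (0 < m)%N ->
  ((k, a, b) \in norm_triples m) = quad_triple t n (k, a, b) && (k * k * a == m)%N.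
Proof.
move=> m0; apply/idP/idP.
  move=> /allpairsPdep[d [b' [+ + [-> -> ->]]]]; rewrite !mem_filter -dvdn_divisors// mem_iota add0n.
  move=> /andP[sd dm] /andP[g /= lt]; rewrite -(sqroot_sq sd) mulnC divnK// eqxx andbT.
  have d0 := dvdn_gt0 m0 dm; apply/and4P; split=> //=.
    by rewrite lt0n; apply: contraTneq d0 => e; rewrite (sqroot_sq sd) e.
  by rewrite divn_gt0// (dvdn_leq m0 dm).
move=> /andP[/and4P[/= k0 a0 ba g] /eqP e]; apply/allpairsPdep.
have kk0 : (0 < k * k)%N by rewrite muln_gt0 k0.
have sk : issq (k * k)%N by apply/issqP; exists k.
have rk : sqroot (k * k)%N = k by apply/eqP; rewrite -eqn_sqr -!mulnn -sqroot_sq.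
exists (k * k)%N, b; rewrite !mem_filter sk -dvdn_divisors// -e dvdn_mulr//= mulKn// rk; split=> //.
by rewrite mem_iota add0n ba leq0n !andbT; exact: g.
Qed.

Lemma norm_triples_uniq m : (0 < m)%N -> uniq (norm_triples m).
Proof.
move=> m0; apply: allpairs_uniq_dep.
- by rewrite filter_uniq ?divisors_uniq.
- by move=> d _; rewrite filter_uniq ?iota_uniq.
move=> _ _ /allpairsPdep[d [b [h1 h2 ->]]] /allpairsPdep[d' [b' [h1' h2' ->]]] /= [e1 e2 e3].
move: h1 h1'; rewrite !mem_filter => /andP[sd _] /andP[sd' _].
have dd : d = d' by rewrite (sqroot_sq sd) (sqroot_sq sd') e1.
by subst d' b'.
Qed.

Hypothesis hmax : forall p b : int, 1 < p -> (p ^+ 2 %| qf t n b)%Z -> (p %| 2 * b + t)%Z -> False.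

(** Grouped by the square [d = k * k], the triples of norm [m] are the roots modulo [m / d], so
    their number is the left side of [conv_square_roots]. *)
Lemma size_norm_triples m : (0 < m)%N ->
  (size (norm_triples m))%:Z = \sum_(d <- divisors m) root_char t n d.
Proof.
move=> m0; transitivity (conv (root_char t n) (fun=> 1) m); last first.
  by apply: eq_bigr => d _; rewrite mulr1.
rewrite -conv_square_roots// size_allpairs_dep sumnE big_map big_filter.
rewrite /conv (big_morph Posz PoszD (erefl 0%:Z)) big_mkcond /=; apply: eq_bigr => d _.
by case: (issq d); rewrite ?mul1r ?mul0r.
Qed.

Let qi0 : quad_triple t n (1%N, 1%N, 0%N).
Proof. by rewrite /quad_triple /= dvd1z. Qed.

Let nonzeroP (I : set F) : is_nonzero_ideal I -> `[< is_nonzero_ideal I >].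
Proof. by move/asboolP. Qed.

(** The unit ideal, as default value for [insubd]. *)
Let I0 : nonzero_ideal F := exist _ (quad_ideal w (1%N, 1%N, 0%N)) (nonzeroP (quad_ideal_ideal wgen OF qi0)).

Let mkI kab : nonzero_ideal F := insubd I0 (quad_ideal w kab).

Let val_mkI kab : quad_triple t n kab -> val (mkI kab) = quad_ideal w kab.
Proof.
by move=> q; rewrite /mkI val_insubd (asboolT (quad_ideal_ideal wgen OF q)).
Qed.

Local Notation nu I := (ideal_norm (val (I : nonzero_ideal F))).

Let mkI_ex I : exists2 kab, quad_triple t n kab & I = mkI kab.
Proof.
have [kab q e] := ideal_quad wgen OF (asboolW (valP I)).
by exists kab => //; apply: val_inj; rewrite val_mkI.
Qed.

Let nu_mkI k a b : quad_triple t n (k, a, b) -> nu (mkI (k, a, b)) = (k * k * a)%N.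
Proof. by move=> q; rewrite val_mkI// (quad_ideal_norm wgen OF q). Qed.

Lemma ideal_norm_gt0 (I : nonzero_ideal F) : (0 < nu I)%N.
Proof.
have [[[k a] b] q ->] := mkI_ex I; rewrite nu_mkI//.
by case/and4P: q => /= k0 a0 _ _; rewrite !muln_gt0 k0 a0.
Qed.

Lemma unit_ideal_exists : exists I : nonzero_ideal F, nu I = 1%N.
Proof. by exists (mkI (1, 1, 0)%N); rewrite nu_mkI. Qed.

Let L M := [seq kab | m <- index_iota 1 M, kab <- norm_triples m].

Let memL M k a b : ((k, a, b) \in L M) = quad_triple t n (k, a, b) && (k * k * a < M)%N.
Proof.
apply/allpairsPdep/andP => [[m [kab [h1 h2 e]]]|[q lt]].
  move: h1 h2; rewrite -e mem_index_iota => /andP[m0 mM]; rewrite mem_norm_triples//.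
  by move=> /andP[q /eqP ->].
have m0 : (0 < k * k * a)%N by case/and4P: q => /= k0 a0 _ _; rewrite !muln_gt0 k0 a0.
exists (k * k * a)%N, (k, a, b); rewrite mem_index_iota m0 lt; split=> //.
by rewrite mem_norm_triples// q eqxx.
Qed.

Let L_uniq M : uniq (L M).
Proof.
apply: allpairs_uniq_dep; first exact: iota_uniq.
  by move=> m; rewrite mem_index_iota => /andP[m0 _]; exact: norm_triples_uniq.
move=> _ _ /allpairsPdep[m [[[k a] b] [+ + ->]]] /allpairsPdep[m' [kab' [+ + ->]]] /=.
rewrite !mem_index_iota => /andP[m0 _] h /andP[m0' _] h' e; subst kab'.
move: h h'; rewrite !mem_norm_triples// => /andP[_ /eqP h1] /andP[_ /eqP h2].
have mm : m = m' by rewrite -h1 -h2.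
by subst m'; congr existT.
Qed.

Definition ideals_below M : {fset nonzero_ideal F} := [fset I in [seq mkI kab | kab <- L M]]%fset.

Lemma ideals_belowP M I : (I \in ideals_below M) = (nu I < M)%N.
Proof.
rewrite !inE /=; apply/mapP/idP => [[[[k a] b]]|].
  by rewrite memL => /andP[q lt] ->; rewrite nu_mkI.
by have [[[k a] b] q ->] := mkI_ex I; rewrite nu_mkI// => lt; exists (k, a, b) => //; rewrite memL q.
Qed.

Lemma sum_ideals_below (R : realType) (g : nat -> R) M :
  \sum_(I <- ideals_below M) g (nu I) =
  \sum_(1 <= m < M) (\sum_(d <- divisors m) root_char t n d)%:~R * g m.
Proof.
have pe : perm_eq (ideals_below M) [seq mkI kab | kab <- L M].
  apply: uniq_perm; first exact: fset_uniq.
    rewrite map_inj_in_uniq ?L_uniq// => [[[k a] b] [[k' a'] b']]; rewrite !memL => /andP[q _] /andP[q' _] e.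
    apply: (quad_ideal_inj wgen q q').
    by rewrite -!val_mkI// e.
  by move=> I; rewrite !inE.
rewrite (perm_big _ pe) /= big_map big_allpairs_dep /= big_seq [RHS]big_seq.
apply: eq_bigr => m; rewrite mem_index_iota => /andP[m0 _].
rewrite -size_norm_triples// (eq_big_seq (fun=> g m)).
  by rewrite big_const_seq count_predT iter_addr_0 -mulr_natl.
move=> [[k a] b]; rewrite mem_norm_triples// => /andP[q /eqP e].
by rewrite nu_mkI// e.
Qed.

End IdealLists.

(** * The quadratic character *)

Section SqrtCyclotomic.

(** The quotient of [X ^ m - 1] by [X - 1], evaluated at 1 in its two forms. *)
Lemma prod_one_sub_unity_roots (K : fieldType) m (y : K) : (0 < m)%N -> m.-primitive_root y ->
  \prod_(1 <= j < m) (1 - y ^+ j) = m%:R.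
Proof.
move=> m0 py; have := factor_Xn_sub_1 py; rewrite big_ltn// expr0 subrX1 -polyC1.
move/(mulfI (_ : 'X - 1%:P != 0)) => h; have /(congr1 (horner^~ 1)) := h (negbT (polyXsubC_eq0 _)).
rewrite horner_prod horner_sum (eq_bigr (fun j => 1 - y ^+ j)); last by move=> j _; rewrite hornerXsubC.
move=> ->; rewrite (eq_bigr (fun=> 1)) ?sumr_const ?card_ord//.
by move=> j _; rewrite hornerXn expr1n.
Qed.

Lemma prod_rev (K : comNzRingType) (f : nat -> K) k m : (k <= m)%N ->
  \prod_(m - k <= j < m) f j = \prod_(1 <= j < k.+1) f (m - j)%N.
Proof.
elim: k => [|k IH] km; first by rewrite subn0 !big_geq.
rewrite big_ltn; last by lia.
rewrite big_nat_recr//= (_ : (m - k.+1).+1 = m - k)%N; last by lia.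
by rewrite mulrC IH// ltnW.
Qed.

(* [m = `|D|] is the product of the [1 - z ^+ (8 * j)]; the factors at [j] and [m - j] multiply to the
   square of [y j], and for even [m] the middle factor is [2 = (z ^+ m + z ^+ (7 * m)) ^+ 2]. *)
Lemma sqrt_cyclotomic (D : int) : D != 0 -> exists (z : algC) (q : {poly int}),
  (8 * `|D|%N).-primitive_root z /\ (map_poly intr q).[z] ^+ 2 = D%:~R.
Proof.
move=> D0; set m := `|D|%N; have m0 : (0 < m)%N by rewrite absz_gt0.
have N0 : (0 < 8 * m)%N by rewrite muln_gt0.
have [z pz] := C_prim_root_exists N0; exists z.
(* [S] is the ring [Z[z]]; an integral polynomial expression in [z] is what Frobenius and
   automorphisms act on later. *)
pose S x := exists q : {poly int}, x = (map_poly intr q).[z].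
have SM x y : S x -> S y -> S (x * y).
  by move=> [q ->] [q' ->]; exists (q * q'); rewrite rmorphM hornerM.
have SD x y : S x -> S y -> S (x + y).
  by move=> [q ->] [q' ->]; exists (q + q'); rewrite rmorphD hornerD.
have S1 : S 1 by exists 1; rewrite rmorph1 hornerC.
have SX k : S (z ^+ k) by exists ('X^k); rewrite map_polyXn hornerXn.
have SN x : S x -> S (- x) by move=> [q ->]; exists (- q); rewrite rmorphN hornerN.
have z8 : z ^+ (8 * m) = 1 by exact: prim_expr_order.
have z4 : z ^+ (4 * m) = - 1.
  have : (z ^+ (4 * m)) ^+ 2 == 1 by rewrite -exprM (_ : _ * 2 = 8 * m)%N ?z8//; lia.
  rewrite sqrf_eq1 => /orP[|/eqP //]; rewrite -(prim_order_dvd pz) => /dvdn_leq.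
  by rewrite muln_gt0 m0 => /(_ isT); lia.
suff [s [q qE] s2] : exists2 s, S s & s ^+ 2 = m%:R.
  have [D1|D1] : D = m%:Z \/ D = - m%:Z by rewrite /m; lia.
    by exists q; split=> //; rewrite -qE s2 D1.
  (* [z ^ (2 * m)] is a square root of [-1], which settles negative [D]. *)
  exists ('X^(2 * m) * q); split=> //.
  rewrite rmorphM hornerM /= map_polyXn hornerXn -qE exprMn -exprM (_ : _ * 2 = 4 * m)%N; last by lia.
  by rewrite z4 s2 D1 mulN1r rmorphN.
have pm : m.-primitive_root (z ^+ 8).
  have := @exp_prim_root _ _ _ pz 8; rewrite gcdnMr ?mulKn//.
pose f j := 1 - (z ^+ 8) ^+ j.
(* Modulo [8 * m] the exponent is [2 * m - 4 * j], kept nonnegative. With [x = z ^ (8 * j)] the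
   square of [y j] is [- x^-1 * (1 - x) ^ 2 = (1 - x) * (1 - x^-1)]. *)
pose y j := z ^+ (2 * m + 4 * (2 * m - 1) * j) * f j.
have Sy j : S (y j).
  by apply: (SM _ _ (SX _)); apply: SD => //; apply: SN; rewrite -exprM.
have yE j : (j <= m)%N -> y j ^+ 2 = f j * f (m - j)%N.
  move=> jm; rewrite /y /f exprMn -exprM -!exprM.
  set x := z ^+ (8 * j); set x' := z ^+ (8 * (m - j)).
  have xx : x * x' = 1 by rewrite -exprD -mulnDr subnKC.
  have -> : z ^+ ((2 * m + 4 * (2 * m - 1) * j) * 2) = - x'.
    have e : ((2 * m + 4 * (2 * m - 1) * j) * 2 + 8 * j = 4 * m + 8 * m * (2 * j))%N.
      by case: (m) m0 => // m' _; rewrite (_ : 2 * m'.+1 - 1 = 2 * m' + 1)%N; [ring|lia].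
    have h : z ^+ ((2 * m + 4 * (2 * m - 1) * j) * 2) * x = - 1.
      by rewrite -exprD e exprD z4 exprM z8 expr1n mulr1.
    by rewrite -[LHS]mulr1 -xx mulrA h mulN1r.
  have -> : - x' * (1 - x) ^+ 2 = - x' + 2 * (x * x') - x * (x * x') by ring.
  have -> : (1 - x) * (1 - x') = 1 - x - x' + x * x' by ring.
  by rewrite xx; ring.
pose k := (m.-1)./2.
have km : (k.*2 + ~~ odd m = m.-1)%N.
  by rewrite -[RHS]odd_double_half addnC /k; case: (m) m0 => //= m' _; rewrite negbK.
have kltm : (k < m)%N by lia.
have SP : S (\prod_(1 <= j < k.+1) y j).
  by elim/big_rec: _ => // j x _ Sx; exact: SM.
have PE : (\prod_(1 <= j < k.+1) y j) ^+ 2 = \prod_(1 <= j < k.+1) f j * \prod_(m - k <= j < m) f j.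
  rewrite prod_rev; last by lia.
  rewrite -big_split -prodrXl big_nat [RHS]big_nat; apply: eq_bigr => j /andP[_ jk].
  by rewrite yE//; lia.
have mE : m%:R = \prod_(1 <= j < m - k) f j * \prod_(m - k <= j < m) f j.
  rewrite -(prod_one_sub_unity_roots m0 pm) -(@big_cat_nat _ _ _ (m - k)%N)//; lia.
have [om|em] := boolP (odd m).
  exists (\prod_(1 <= j < k.+1) y j) => //.
  by rewrite PE mE (_ : m - k = k.+1)%N//; move: km; rewrite om /=; lia.
rewrite em /= in km.
exists ((z ^+ m + z ^+ (7 * m)) * \prod_(1 <= j < k.+1) y j).
  by apply: (SM _ _ _ SP); exact: SD.
have fk : f k.+1 = 2.
  rewrite /f -exprM (_ : 8 * k.+1 = 4 * m)%N; last by lia.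
  by rewrite z4 opprK.
have w2 : (z ^+ m + z ^+ (7 * m)) ^+ 2 = 2.
  rewrite sqrrD -!exprM -exprD.
  rewrite (_ : m * 2 = 2 * m)%N; last by lia.
  rewrite (_ : m + 7 * m = 8 * m)%N; last by lia.
  rewrite (_ : 7 * m * 2 = 8 * m + 4 * m + 2 * m)%N; last by lia.
  by rewrite (exprD _ (8 * m + 4 * m)) (exprD _ (8 * m)) z8 z4; ring.
rewrite exprMn PE mE w2 {2}(_ : m - k = k.+2)%N; last by lia.
have -> : \prod_(1 <= j < k.+2) f j = \prod_(1 <= j < k.+1) f j * f k.+1 by rewrite big_nat_recr.
by rewrite fk; ring.
Qed.

End SqrtCyclotomic.

(** * Congruences between algebraic integers and Euler's criterion *)

Section Congruence.
Variable p : nat.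
Hypotheses (pp : prime p) (op : odd p).

Definition cong (x y : algC) := exists2 z, z \in Aint & x = y + p%:R * z.

Let congD x y x' y' : cong x y -> cong x' y' -> cong (x + x') (y + y').
Proof. by move=> [z az ->] [z' az' ->]; exists (z + z'); [exact: rpredD|ring]. Qed.

Let congM x y x' y' : y \in Aint -> y' \in Aint -> cong x y -> cong x' y' -> cong (x * x') (y * y').
Proof.
move=> ay ay' [z az ->] [z' az' ->]; exists (y * z' + z * y' + p%:R * z * z'); last by ring.
by rewrite !(rpredD, rpredM)// rpred_nat.
Qed.

Let cong_trans x y z : cong x y -> cong y z -> cong x z.
Proof. by move=> [u au ->] [v av ->]; exists (u + v); [exact: rpredD|ring]. Qed.

(** All inner binomial coefficients are divisible by [p]. *)
Lemma cong_exprD x y : x \in Aint -> y \in Aint -> cong ((x + y) ^+ p) (x ^+ p + y ^+ p).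
Proof.
move=> ax ay; have p0 := prime_gt0 pp.
exists (\sum_(j < p.-1) x ^+ (p - j.+1) * y ^+ j.+1 *+ ('C(p, j.+1) %/ p)).
  by apply: rpred_sum => j _; rewrite rpredMn// rpredM// rpredX.
rewrite exprDn big_ord_recl; case: p pp p0 => // k pk _.
rewrite big_ord_recr /= subnn bin0 binn !mulr1n !expr0 mulr1 mul1r subn0 -addrA; congr +%R.
rewrite addrC; congr +%R; rewrite mulr_sumr; apply: eq_bigr => j _.
rewrite /bump /= !add1n mulr_natl -mulrnA divnK// prime_dvd_bin//.
by have := ltn_ord j; lia.
Qed.

(** Fermat's little theorem; oddness of [p] carries it over to negative integers. *)
Lemma cong_intX (a : int) : cong (a%:~R ^+ p) a%:~R.
Proof.
have nat_case (k : nat) : cong (k%:R ^+ p) k%:R.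
  have := fermat_little k pp => /eqP; rewrite -natrX => h.
  have kp : (k <= k ^ p)%N.
    by case: k {h} => // k; rewrite -{1}(expn1 k.+1) leq_pexp2l// prime_gt0.
  move: h; rewrite eqn_mod_dvd// => /dvdnP[u hu].
  by exists u%:R; [rewrite rpred_nat|rewrite -natrM mulnC -hu -natrD subnKC].
case: (intP a) => [|k|k]; [exact: (nat_case 0%N)|exact: (nat_case k.+1)|].
have [u au e] := nat_case k.+1; exists (- u); first by rewrite rpredN.
by rewrite rmorphN exprNn -signr_odd op expr1 mulN1r -[X in X ^+ p]/(k.+1%:R) e; ring.
Qed.

Lemma cong_Frobenius (q : {poly int}) (z : algC) : z \in Aint ->
  cong ((map_poly intr q).[z] ^+ p) (map_poly intr q).[z ^+ p].
Proof.
move=> az; have ah (r : {poly int}) y : y \in Aint -> (map_poly intr r).[y] \in Aint.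
  move=> ay; elim/poly_ind: r => [|r c IH]; first by rewrite rmorph0 horner0 rpred0.
  rewrite rmorphD rmorphM /= map_polyX map_polyC /= hornerMXaddC.
  by rewrite rpredD ?rpredM ?Aint_int.
elim/poly_ind: q => [|q c IH].
  by rewrite rmorph0 !horner0 expr0n gtn_eqF ?prime_gt0//; exists 0; [exact: rpred0|rewrite mulr0 addr0].
rewrite rmorphD rmorphM /= map_polyX map_polyC /= !hornerMXaddC.
apply: cong_trans (cong_exprD _ _) _; [by rewrite rpredM// ah|exact: Aint_int|].
apply: congD; last exact: cong_intX.
rewrite exprMn; apply: congM => //; [by apply: ah; exact: rpredX|exact: rpredX|].
by exists 0; [exact: rpred0|rewrite mulr0 addr0].
Qed.

Let pF : p \in [pchar 'F_p].
Proof. exact: pchar_Fp. Qed.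

Let Fp0 (a : int) : (a%:~R == 0 :> 'F_p) = (p%:Z %| a)%Z.
Proof. by rewrite (dvdz_pcharf pF). Qed.

Lemma euler_square (D z : int) : ~~ (p%:Z %| D)%Z -> (p%:Z %| z ^+ 2 - D)%Z ->
  (p%:Z %| D ^+ p./2 - 1)%Z.
Proof.
move=> pD; rewrite -!Fp0 !rmorphB !rmorphXn /= subr_eq0 => /eqP e.
rewrite -Fp0 in pD; have z0 : (z%:~R : 'F_p) != 0.
  by apply: contra pD => /eqP z0; rewrite -e z0 expr0n.
have zp : (z%:~R : 'F_p) ^+ p = z%:~R by have := expf_card (z%:~R : 'F_p); rewrite card_Fp.
rewrite subr_eq0 -e -exprM mul2n; apply/eqP; apply: (mulfI z0).
rewrite mulr1 -exprS -[RHS]zp; congr (_ ^+ _).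
by rewrite -[RHS]odd_double_half op.
Qed.

(** If [D ^ h] were 1 modulo [p], then [D] and the [h] distinct squares of [1, ..., h] would be
    [h + 1] roots of [X ^ h - 1]. *)
Lemma euler_nonsquare (D : int) : ~~ (p%:Z %| D)%Z -> (forall z : int, ~~ (p%:Z %| z ^+ 2 - D)%Z) ->
  (p%:Z %| D ^+ p./2 + 1)%Z.
Proof.
move=> pD ns; set h := p./2; have pE : p = (h.*2).+1 by rewrite -[LHS]odd_double_half op.
have h0 : (0 < h)%N by move: (prime_gt1 pp); lia.
pose a : 'F_p := D%:~R; have a0 : a != 0 by rewrite Fp0.
have xp (x : 'F_p) : x != 0 -> x ^+ h.*2 = 1.
  move=> x0; apply: (mulfI x0); rewrite mulr1 -exprS -pE.
  by have := expf_card x; rewrite card_Fp.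
have : (a ^+ h) ^+ 2 == 1 by rewrite -exprM muln2 xp.
rewrite sqrf_eq1 => /orP[ah|]; last first.
  by rewrite /a -rmorphXn -addr_eq0 -[1 in X in X -> _](rmorph1 (intr : int -> 'F_p)) -rmorphD Fp0.
pose l := [seq (k%:R : 'F_p) ^+ 2 | k <- iota 1 h].
have nz k : (0 < k < p)%N -> (k%:R : 'F_p) != 0.
  move=> /andP[k0 kp]; rewrite -[k%:R]/(k%:Z%:~R) Fp0 dvdzE /=; apply/negP => /(dvdn_leq k0); lia.
have l_uniq : uniq l.
  rewrite map_inj_in_uniq ?iota_uniq// => i j; rewrite !mem_iota => hi hj /eqP.
  rewrite eqf_sqr => /orP[|] /eqP e.
    wlog ij : i j hi hj e / (i <= j)%N.
      by case: (leqP i j) => ij W; [exact: W|apply/esym; apply: W => //; exact: ltnW].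
    apply/eqP; rewrite eqn_leq ij /= leqNgt; apply/negP => ij'.
    suff /nz : (0 < j - i < p)%N by rewrite natrB// e subrr eqxx.
    by lia.
  suff /nz : (0 < i + j < p)%N by rewrite natrD e addNr eqxx.
  by lia.
have al : a \notin l.
  apply/mapP => -[k _ e]; have /negP[] := ns k%:Z; rewrite -Fp0 rmorphB rmorphXn /=.
  by rewrite -/a e subrr.
have := @max_poly_roots _ ('X^h - 1) (a :: l).
rewrite -size_poly_eq0 -polyC1 size_XnsubC//= => /(_ isT).
rewrite /= al l_uniq /root !hornerE (eqP ah) subrr eqxx /= size_map size_iota ltnn.
have -> : all (fun x => ('X^h - 1%:P).[x] == 0) l.
  apply/allP => _ /mapP[k kh ->]; rewrite !hornerE -exprM mul2n xp ?subrr//.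
  by apply: nz; move: kh; rewrite mem_iota; lia.
by move=> /(_ isT isT).
Qed.

(* [s ^+ p] is [s * D ^+ ((p - 1) / 2)], so that [e * s] and [e' * s] agree modulo [p]; otherwise
   [p ^+ 2] would divide [4 * D]. *)
Lemma cong_sign (D e e' : int) (s : algC) : ~~ (p%:Z %| D)%Z -> s ^+ 2 = D%:~R ->
  e ^+ 2 = 1 -> e' ^+ 2 = 1 -> (p%:Z %| D ^+ p./2 - e)%Z -> cong (s ^+ p) (e'%:~R * s) -> e' = e.
Proof.
move=> pD s2 e1 e1' /dvdzP[k hk] [z az h].
have as_ : s \in Aint.
  apply: (@root_monic_Aint ('X^2 - D%:~R%:P)); last 2 first.
  - exact: monicXnsubC.
  - apply/polyOverP => i; rewrite coefB coefXn coefC rpredB ?rpred_nat//.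
    by case: (i == 0)%N; [exact: rpred_int|exact: rpred0].
  by rewrite /root !hornerE s2 subrr.
have sp : s ^+ p = (D ^+ p./2)%:~R * s.
  by rewrite -{1}(odd_double_half p) op /= add1n exprS mulrC -mul2n exprM s2 rmorphXn.
have De : D ^+ p./2 = e + k * p%:Z by rewrite -hk; ring.
have key : (e' - e)%:~R * s = p%:R * (k%:~R * s - z).
  apply/eqP; rewrite -subr_eq0; apply/eqP.
  have : (D ^+ p./2)%:~R * s - (e'%:~R * s + p%:R * z) = 0 by rewrite -h sp subrr.
  rewrite De rmorphD rmorphM rmorphB /= => h2; rewrite -[RHS]oppr0 -h2 -[p%:Z%:~R]/(p%:R : algC).
  by ring.
apply/eqP; case: (e' =P e) => // ne; exfalso.
have d4 : (e' - e) ^+ 2 = 4.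
  have [E|E] : e = 1 \/ e = -1 by move/eqP: e1; rewrite sqrf_eq1 => /orP[] /eqP; [left|right].
    have [E'|E'] : e' = 1 \/ e' = -1 by move/eqP: e1'; rewrite sqrf_eq1 => /orP[] /eqP; [left|right].
      by case: ne; rewrite E E'.
    by rewrite E E'.
  have [E'|E'] : e' = 1 \/ e' = -1 by move/eqP: e1'; rewrite sqrf_eq1 => /orP[] /eqP; [left|right].
    by rewrite E E'.
  by case: ne; rewrite E E'.
have sq : (4 * D)%:~R = p%:R ^+ 2 * (k%:~R * s - z) ^+ 2 :> algC.
  by rewrite -exprMn -key exprMn s2 -rmorphXn d4 -rmorphM.
(* The cofactor squared is an algebraic integer and rational, hence an integer: this brings the
   divisibility down to [int]. *)
have az2 : (k%:~R * s - z) ^+ 2 \in Aint.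
  by rewrite rpredX// rpredB// rpredM// Aint_int.
have pN0 : (p%:R : algC) ^+ 2 != 0 by rewrite expf_neq0// pnatr_eq0 -lt0n prime_gt0.
have rz2 : (k%:~R * s - z) ^+ 2 \in Crat.
  have -> : (k%:~R * s - z) ^+ 2 = (4 * D)%:~R / p%:R ^+ 2.
    by apply: (mulfI pN0); rewrite -sq mulrCA divff// mulr1.
  by rewrite rpred_div ?rpredX ?rpred_nat ?rpred_int.
have /intrP[i iE] := Cint_rat_Aint rz2 az2.
have /intr_inj e4 : (4 * D)%:~R = (p%:Z ^+ 2 * i)%:~R :> algC by rewrite sq iE rmorphM rmorphXn.
have : (p%:Z %| 4 * D)%Z by rewrite e4 expr2 -mulrA dvdz_mulr.
rewrite Gauss_dvdzr ?(negbTE pD)// coprimezE (_ : absz 4%R = (2 ^ 2)%N)// coprimeXr//.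
by rewrite prime_coprime// dvdn_prime2//; apply: contraTneq op => /= ->.
Qed.

End Congruence.

(** Multiplication by [k0] permutes the residues modulo [N] and reverses the sign of [psi], so a
    full period sums to its own opposite; what remains is shorter than a period. *)
Lemma periodic_sum_bound (psi : nat -> int) (N k0 : nat) : (0 < N)%N -> coprime k0 N ->
  (forall d, psi (d + N)%N = psi d) -> (forall d, psi (k0 * d)%N = - psi d) ->
  (forall d, `|psi d| <= 1) ->
  forall k, `|\sum_(0 <= d < k) psi d| <= N%:Z.
Proof.
move=> N0 c per neg b1.
have perM d i : psi (d + N * i)%N = psi d.
  by elim: i => [|i IH]; rewrite ?muln0 ?addn0// mulnS addnCA addnC per.
have per_mod d : psi (d %% N)%N = psi d.
  by rewrite [in RHS](divn_eq d N) addnC mulnC perM.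
have S0 : \sum_(0 <= d < N) psi d = 0.
  rewrite big_mkord; set S := \sum_(_ < _) _.
  suff : S = - S by lia.
  pose h (d : 'I_N) : 'I_N := Ordinal (ltn_pmod (k0 * d) N0).
  have h_inj : injective h.
    move=> x y /(congr1 val) /= /eqP; wlog xy : x y / (y <= x)%N => [W|].
      by case: (leqP y x) => xy e; [exact: W|apply/esym/W; [exact: ltnW|rewrite eq_sym]].
    rewrite eqn_mod_dvd ?leq_mul2l ?xy ?orbT// -mulnBr Gauss_dvdr; last by rewrite coprime_sym.
    rewrite -eqn_mod_dvd// => /eqP; rewrite !modn_small// => e; exact: val_inj.
  rewrite {1}/S (reindex_inj h_inj) /= -sumrN; apply: eq_bigr => d _.
  by rewrite per_mod neg.
move=> k; have [j] := ubnP k; elim: j k => // j IH k kj.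
have [kN|Nk] := ltnP k N.
  apply: le_trans (ler_norm_sum _ _ _) _; apply: (@le_trans _ _ (\sum_(0 <= d < k) 1)).
    by apply: ler_sum => d _; exact: b1.
  by rewrite sumr_const_nat subn0 natz lez_nat ltnW.
rewrite (@big_cat_nat _ _ _ N)//= S0 add0r -{1}(add0n N) big_addn.
rewrite (eq_bigr psi); last by move=> d _; rewrite per.
by apply: IH; lia.
Qed.

(** * The root-counting character as a Galois character *)

Section QuadraticCharacter.
Variable F : fieldExtType rat.
Hypothesis hF : quadratic_field F.
Variables (w : F) (t n : int).
Hypothesis wgen : quad_gen w t n.
Hypothesis hmax : forall p b : int, 1 < p -> (p ^+ 2 %| qf t n b)%Z -> (p %| 2 * b + t)%Z -> False.
Let D : int := t ^+ 2 - 4 * n.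

Lemma disc_neq0 : D != 0.
Proof.
have [w1 wE] := wgen; apply: contra w1 => /eqP D0.
have two0 : (2%:~R : F) != 0 by rewrite -intrF scaler_eq0 oner_eq0 orbF.
have : (2%:~R * w - t%:~R) ^+ 2 = 0.
  rewrite (_ : _ ^+ 2 = 4%:~R * (w * w) - 4%:~R * (t%:~R * w) + t%:~R ^+ 2); last by ring.
  rewrite wE (_ : _ + _ = t%:~R ^+ 2 - 4%:~R * n%:~R); last by ring.
  by rewrite -rmorphXn -rmorphM -rmorphB -/D D0.
move/eqP; rewrite expf_eq0 /= subr_eq0 => /eqP e.
apply/vlineP; exists (2%:~R^-1 * t%:~R); apply: (mulfI two0); rewrite e -!intrF.
by rewrite -[RHS]/(in_alg F _ * in_alg F _) -rmorphM mulVKf// intr_eq0.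
Qed.

(** An embedding [phi] of [F] sends [w] to [theta = (t + s) / 2]. Along it the conjugation of [F],
    [w] to [t - w], extends to [algC] and sends [s = 2 * theta - t] to [- s]. *)
Lemma conj_exists (s : algC) : s ^+ 2 = D%:~R ->
  exists nu : {rmorphism algC -> algC}, nu s = - s.
Proof.
have [w1 wE] := wgen => s2.
have two0 : (2 : algC) != 0 by rewrite pnatr_eq0.
have [theta th] : exists theta : algC, 2 * theta = t%:~R + s.
  by exists ((t%:~R + s) / 2); rewrite mulrC divfK.
have thE : theta * theta = ratr t%:~R * theta - ratr n%:~R.
  rewrite !ratr_int; apply: (mulfI two0); apply: (mulfI two0).
  transitivity ((2 * theta) * (2 * theta)); first by ring.
  transitivity (2 * t%:~R * (2 * theta) - 4%:~R * n%:~R); last by ring.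
  rewrite th (_ : (_ + s) * (_ + s) = t%:~R ^+ 2 + 2 * t%:~R * s + s ^+ 2); last by ring.
  by rewrite s2 rmorphB rmorphXn rmorphM /=; ring.
have [phi [phiw phiQ]] := quad_morphism hF w1 (quad_gen_rat wgen) thE.
have cE : (t%:~R - w) * (t%:~R - w) = in_alg F t%:~R * (t%:~R - w) - in_alg F n%:~R.
  have aZ (m : int) : in_alg F m%:~R = m%:~R by exact: rmorph_int.
  rewrite !aZ [LHS](_ : _ = t%:~R * t%:~R - 2 * (t%:~R * w) + w * w); last by ring.
  by rewrite wE; ring.
have [sigma [sw _]] := quad_morphism hF w1 (quad_gen_rat wgen) cE.
have [nu nuE] := extend_algC_subfield_aut phi sigma.
have nuth : nu theta = t%:~R - theta.
  by rewrite -phiw -nuE sw rmorphB rmorph_int.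
exists nu; have sE : s = 2 * theta - t%:~R by rewrite th; ring.
by rewrite {1}sE rmorphB rmorphM rmorph_int rmorph_nat nuth sE; ring.
Qed.

Let psi (d : nat) : int := if odd d then root_char t n d else 0.

(** The Galois character vanishes at even numbers because its modulus [N] is even, so it is compared
    with [root_char] cut down to the odd ones. *)
Lemma root_char_odd_sum_bound : exists N : nat, forall k,
  `|\sum_(0 <= d < k) (if odd d then root_char t n d else 0)| <= N%:Z.
Proof.
have [z [q [pz s2]]] := sqrt_cyclotomic disc_neq0.
set N := (8 * `|D|)%N in pz; exists N.
have N0 : (0 < N)%N by rewrite muln_gt0 absz_gt0 disc_neq0.
have evN : (2 %| N)%N by rewrite /N (_ : 8 = 2 * 4)%N// -mulnA dvdn_mulr.
have zN : z ^+ N = 1 by exact: prim_expr_order.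
pose Q (x : algC) := (map_poly intr q).[x]; set s := (_.[z]) in s2.
have sQ : s = Q z by [].
have nuQ (nu : {rmorphism algC -> algC}) x : nu (Q x) = Q (nu x).
  rewrite /Q -horner_map -map_poly_comp; congr (_.[_]).
  by apply: eq_map_poly => a /=; rewrite rmorph_int.
have s0 : s != 0.
  by apply: contraTneq disc_neq0 => s0; move/eqP: s2; rewrite s0 expr0n eq_sym intr_eq0 => ->.
have sI (a b : int) : a%:~R * s = b%:~R * s -> a = b by move/(mulIf s0)/intr_inj.
(* For [k] prime to [N], [e k] is the sign by which the automorphism taking [z] to [z ^ k] acts on
   [s]; elsewhere it is 0. *)
have /choice[e eP] : forall k, exists a : int,
    (coprime k N -> a ^+ 2 = 1 /\ Q (z ^+ k) = a%:~R * s) /\ (~~ coprime k N -> a = 0).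
  move=> k.
  have [ck|nck] := boolP (coprime k N); last by exists 0.
  have [u uE] := Qn_aut_exists ck.
  have us : Q (z ^+ k) = u s by rewrite sQ nuQ uE.
  have : (Q (z ^+ k)) ^+ 2 == s ^+ 2 by rewrite us -rmorphXn s2 rmorph_int.
  rewrite eqf_sqr => /orP[] /eqP ->; [exists 1|exists (-1)]; split=> // _; split=> //.
    by rewrite mul1r.
  by rewrite rmorphN1 mulN1r.
have e_co k : coprime k N -> e k ^+ 2 = 1 /\ Q (z ^+ k) = (e k)%:~R * s by case: (eP k).
have e_nco k : ~~ coprime k N -> e k = 0 by case: (eP k).
have e1 : e 1%N = 1.
  by have [_] := e_co 1%N (coprime1n _); rewrite expr1 -sQ -{1}[s]mul1r => /(sI 1) <-.
have eM k l : e (k * l)%N = e k * e l.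
  have [ck|nck] := boolP (coprime k N); last first.
    by rewrite (e_nco k)// mul0r e_nco// coprimeMl negb_and nck.
  have [cl|ncl] := boolP (coprime l N); last first.
    by rewrite (e_nco l)// mulr0 e_nco// coprimeMl negb_and ncl orbT.
  have ckl : coprime (k * l) N by rewrite coprimeMl ck.
  have [_ hk] := e_co k ck; have [_ hl] := e_co l cl; have [_ hkl] := e_co _ ckl.
  apply: sI; rewrite -hkl; have [u uE] := Qn_aut_exists ck.
  have uz : u z = z ^+ k by rewrite uE.
  have -> : Q (z ^+ (k * l)) = u (Q (z ^+ l)) by rewrite nuQ rmorphXn /= uz exprM.
  by rewrite hl rmorphM rmorph_int sQ nuQ uz hk rmorphM -sQ mulrA [(e l)%:~R * _]mulrC.
have eper d : e (d + N)%N = e d.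
  have cE : coprime (d + N) N = coprime d N by rewrite coprime_sym /coprime addnC gcdnDl gcdnC.
  have [cd|ncd] := boolP (coprime d N); last by rewrite !e_nco ?cE.
  have [_ h] := e_co d cd; have [_ h'] : e (d + N)%N ^+ 2 = 1 /\ Q (z ^+ (d + N)) = (e (d + N)%N)%:~R * s.
    by apply: e_co; rewrite cE.
  by apply: sI; rewrite -h -h' exprD zN mulr1.
have e_even d : ~~ odd d -> e d = 0.
  move=> ed; apply: e_nco; apply/negP => /eqP g1.
  have : (2 %| gcdn d N)%N by rewrite dvdn_gcd evN dvdn2 ed.
  by rewrite g1.
have eX p j : e (p ^ j)%N = e p ^+ j.
  by elim: j => [|j IH]; rewrite ?e1// expnS eM IH exprS.
(* If [p] divides [D], both sides are 0. Otherwise [s ^ p] is congruent to [Q (z ^ p) = e p * s] by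
   Frobenius and to the Euler sign of [D] times [s], so the two signs agree. *)
have e_prime p : prime p -> odd p -> e p = root_char t n p.
  move=> pp op; rewrite /root_char cmul_prime//.
  have p8 : ~~ (p %| 8)%N.
    by rewrite (_ : 8 = 2 ^ 3)%N// Euclid_dvdX// dvdn_prime2// andbT; apply: contraTneq op => ->.
  have [pD|pD] := boolP (p%:Z %| D)%Z.
    rewrite (size_roots_disc0 hmax pp op pD) subrr; apply: e_nco.
    by rewrite prime_coprime// negbK dvdn_mull.
  have cp : coprime p N by rewrite prime_coprime// Euclid_dvdM// negb_or p8.
  have [ep2 hp] := e_co p cp.
  have fr := cong_Frobenius pp op q (Aint_prim_root pz).
  rewrite -/(Q _) -/(Q _) hp -/s in fr.
  have [[y py]|ny] := pselect (exists y, (p%:Z %| y ^+ 2 - D)%Z).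
    rewrite (size_roots_square pp op pD py).
    exact: (cong_sign pp op pD s2 (expr1n _ _) ep2 (euler_square pp op pD py) fr).
  have ny' y : ~~ (p%:Z %| y ^+ 2 - D)%Z by apply/negP => h; apply: ny; exists y.
  rewrite (size_roots_nonsquare pp op ny').
  have h : (p%:Z %| D ^+ p./2 - (-1))%Z.
    have -> : D ^+ p./2 - (-1) = D ^+ p./2 + 1 by ring.
    have h := euler_nonsquare pp op pD ny'.
    exact: h.
  by rewrite (cong_sign pp op pD s2 _ ep2 h fr)// sqrrN expr1n.
have psiE d : psi d = e d.
  have [->|d0] := posnP d; first by rewrite e_even.
  move: d d0; apply: multiplicative_eq.
  - split=> [|a b a0 b0 _]; first by rewrite /psi /= /root_char cmul1.
    rewrite /psi oddM; case: (odd a) => /=; last by rewrite mul0r.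
    by case: (odd b); rewrite ?mulr0// /root_char cmulM.
  - by split=> [//|a b _ _ _]; exact: eM.
  move=> p j pp; have [op|ep] := boolP (odd p).
    by rewrite /psi oddX op orbT eX e_prime// /root_char cmulX// prime_gt0.
  have [->|j0] := posnP j; first by rewrite /psi /= e1 /root_char cmul1.
  by rewrite /psi oddX (negbTE ep) orbF gtn_eqF// eX (e_even p)// expr0n gtn_eqF.
(* The conjugation of [F], extended to [algC], negates [s] and raises [z] to a power [k0]. *)
have [nu nus] := conj_exists s2.
have [k0 zk0] : {k0 : 'I_N | nu z = z ^+ k0}.
  by apply: (prim_rootP pz); rewrite -rmorphXn /= zN rmorph1.
have ck0 : coprime k0 N.
  by rewrite -(prim_root_exp_coprime _ pz) -zk0 fmorph_primitive_root.
have ek0 : e k0 = - 1.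
  have [_ h] := e_co k0 ck0; apply: sI; rewrite -h -zk0 -nuQ -sQ nus.
  by rewrite rmorphN1 mulN1r.
apply: (periodic_sum_bound (k0 := k0) N0 ck0).
- by move=> d; rewrite -!/(psi _) !psiE eper.
- by move=> d; rewrite -!/(psi _) !psiE eM ek0 mulN1r.
move=> d; rewrite -!/(psi _) psiE; have [cd|ncd] := boolP (coprime d N); last by rewrite e_nco.
have [/eqP + _] := e_co d cd; rewrite sqrf_eq1 => /orP[] /eqP ->; rewrite ?normrN normr1//.
Qed.

End QuadraticCharacter.

(** * Main term and error for the count of ideals *)

Section IdealCount.
Variables (R : realType) (F : fieldExtType rat).
Hypothesis hF : quadratic_field F.

Lemma sum_divisors (f : nat -> R) m : (0 < m)%N ->
  \sum_(d <- divisors m) f d = \sum_(1 <= d < m.+1 | (d %| m)%N) f d.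
Proof.
move=> m0; rewrite -[RHS]big_filter; apply: perm_big; apply: uniq_perm.
- exact: divisors_uniq.
- by rewrite filter_uniq ?iota_uniq.
move=> d; rewrite mem_filter mem_index_iota -dvdn_divisors//.
have [dm|//] := boolP (d %| m)%N.
by rewrite (dvdn_gt0 m0 dm) ltnS (dvdn_leq m0 dm).
Qed.

Lemma ideal_count_remainder : exists (J : nat -> {fset nonzero_ideal F}) (rho C : R),
  [/\ forall I : nonzero_ideal F, (0 < ideal_norm (val I))%N,
      forall M I, (I \in J M) = (ideal_norm (val I) < M)%N,
      exists I : nonzero_ideal F, ideal_norm (val I) = 1%N &
      forall u : R, 0 <= u ->
        `|count_log (fun I : nonzero_ideal F => ideal_norm (val I)) J u - rho * expR u|
        <= C * expR (4^-1 * u)].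
Proof.
have [w [t [n [wgen OF hmax]]]] := integral_basis hF.
(* [root_char] has the value 1 at 0, as an empty product; the value 0 makes [c (2 * d) = c 2 * c d]
   hold at [d = 0] too. *)
pose c d : R := if d == 0%N then 0 else (root_char t n d)%:~R.
have [N hN] := root_char_odd_sum_bound hF wgen hmax.
have cE d : (0 < d)%N -> c d = (root_char t n d)%:~R by rewrite /c; case: d.
have c2 d : c (2 * d)%N = (root_char t n 2)%:~R * c d.
  have [->|d0] := posnP d; first by rewrite muln0 /c mulr0.
  by rewrite !cE ?muln_gt0// /root_char cmulM// rmorphM.
have eps1 : `|(root_char t n 2)%:~R : R| <= 1.
  have [->|->|->] := root_char_values hmax (isT : prime 2).
  - by rewrite rmorphN1 normrN normr1.
  - by rewrite normr0.
  - by rewrite normr1.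
have hB k : `|\sum_(1 <= d < k) (if odd d then c d else 0)| <= N%:R.
  have -> : \sum_(1 <= d < k) (if odd d then c d else 0) =
      (\sum_(0 <= d < k) (if odd d then root_char t n d else 0))%:~R.
    case: k => [|k]; first by rewrite !big_geq.
    rewrite [in RHS]big_ltn//= add0r rmorph_sum; apply: eq_bigr => d _.
    by case: ifP => //; case: d => // d _; rewrite cE.
  by rewrite -intr_norm -[N%:R]/(N%:Z%:~R) ler_int.
have [rho [C hC]] := remainder_exists c2 eps1 hB.
exists (ideals_below wgen OF), rho, C; split.
- exact: ideal_norm_gt0 wgen OF.
- exact: ideals_belowP.
- exact: unit_ideal_exists wgen OF.
move=> u u0; have uM : expR u <= (Num.truncn (expR u)).+1%:R :> R by apply/ltW/truncnS_gt.
rewrite (count_logE (ideal_norm_gt0 wgen OF) (ideals_belowP wgen OF) uM).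
rewrite /rampsum (sum_ideals_below wgen OF hmax (fun m => ramp m u)).
rewrite (eq_big_nat _ _ (F2 := fun m => (\sum_(1 <= d < m.+1 | (d %| m)%N) c d) * ramp m u)).
  exact: hC.
move=> m /andP[m0 _]; congr (_ * _); rewrite -sum_divisors// rmorph_sum big_seq [RHS]big_seq.
by apply: eq_bigr => d; rewrite -dvdn_divisors// => dm; rewrite cE// (dvdn_gt0 m0 dm).
Qed.

End IdealCount.

Theorem theorem3p1 (R : realType) (F : fieldExtType rat)
    (hF : quadratic_field F) :
  ((pi / 2)%:E <
   \int[@lebesgue_measure R]_(t in [set: R])
     (ComplexField.Normc.normc
        (dedekind_zeta F (Complex (2^-1) t) / Complex (2^-1) t) ^+ 2)%:E)%E.
Proof.
have [J [rho [C [nu_gt0 JP unit_ideal remainder]]]] := ideal_count_remainder R hF.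
exact: (zeta_integral_gt nu_gt0 JP remainder unit_ideal).
Qed.
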